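(* Let $n\ge 1$ and let $\eta\in\mathbb{R}^n$ with $\eta_1>\eta_2>\cdots>\eta_n>0$. Let $X$ be standard $n$-dimensional Brownian motion with $X(0)=\eta$, and let $T$ be the first time at which $X$ leaves the open chamber $\{x\in\mathbb{R}^n:x_1>x_2>\cdots>x_n>0\}$ of $B_n$ (i.e. the first time that two of $n$ independent Brownian particles collide or one of them hits $0$). Then, as $t\to\infty$, $$P(T>t)\sim\left(\prod_{1\le i<j\le n}\frac{\eta_i^2-\eta_j^2}{(2j-1)^2-(2i-1)^2}\right)\left(\prod_{i=1}^n\frac{\eta_i}{2n+1-2i}\right)\frac{2^{3n^2/2}}{\pi^n\,n!}\prod_{k=1}^n\left[\Gamma\!\left(1+\frac k2\right)\Gamma\!\left(\frac{1+k}2\right)\right]t^{-n^2/2}.$$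
   Context: $f(t)\sim g(t)$ as $t\to\infty$ means $f(t)/g(t)\to1$. $\Gamma$ is the Gamma function. The starting point $\eta$ is fixed as $t\to\infty$. *)

(* Defs.v *)
From HB Require Import structures.
From mathcomp Require Import all_boot all_order all_algebra.
From mathcomp Require Import all_classical all_reals all_analysis.
Import Order.TTheory GRing.Theory Num.Theory.
Import numFieldNormedType.Exports.

Set Implicit Arguments.
Unset Strict Implicit.
Unset Printing Implicit Defensive.

Local Open Scope classical_set_scope.
Local Open Scope ring_scope.

Definition mutually_independent (d : measure_display) (Omega : measurableType d)
    (R : realType) (P : probability Omega R) (I : finType)
    (F : I -> set (set Omega)) : Prop :=
  forall (J : {set I}) (A : I -> set Omega),
    (forall i, i \in J -> F i (A i)) ->
    P (\bigcap_(i in [set` J]) A i) = (\prod_(i in J) P (A i))%E.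

Definition sigma_rv (Omega : Type) (R : realType) (f : Omega -> R) :
    set (set Omega) :=
  [set f @^-1` B | B in [set B : set R | measurable B]].

(* Only the times t >= 0 contribute. *)
Definition sigma_process (Omega : Type) (R : realType) (W : R -> Omega -> R) :
    set (set Omega) :=
  <<s [set A | exists2 t : R, 0 <= t & sigma_rv (W t) A] >>.

(* One-dimensional standard Brownian motion started at x.  Processes are
   indexed by all of R, but only their values at times t >= 0 are constrained.
   All paths (not just almost all) are continuous, so that events such as
   {T > t} are measurable without completing P.  The laws of the increments are
   compared on measurable sets only, since the value of a measure on other sets
   carries no information; normal_prob takes the standard deviation as its
   second parameter. *)
Definition brownian_motion1 (d : measure_display) (Omega : measurableType d)
    (R : realType) (P : probability Omega R) (W : R -> {RV P >-> R}) (x : R) :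
    Prop :=
  [/\ forall w, W 0 w = x,
      forall (k : nat) (t : nat -> R), 0 <= t 0%N -> nondecreasing_seq t ->
        mutually_independent P
          (fun j : 'I_k => sigma_rv (fun w => W (t j.+1) w - W (t j) w)),
      forall s t : R, 0 <= s -> s < t ->
        forall B : set R, measurable B ->
          P ((fun w => W t w - W s w) @^-1` B)
            = normal_prob 0 (Num.sqrt (t - s)) B
    & forall w, {within `[0, +oo[, continuous (fun t : R => W t w)}].

(* Standard n-dimensional Brownian motion started at eta: independent
   one-dimensional Brownian motions X 0, ..., X (n-1). *)
Definition brownian_motion (d : measure_display) (Omega : measurableType d)
    (R : realType) (P : probability Omega R) (n : nat)
    (X : 'I_n -> R -> {RV P >-> R}) (eta : 'rV[R]_n) : Prop :=
  (forall i, brownian_motion1 (X i) (eta 0 i)) /\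
  mutually_independent P
    (fun i : 'I_n => sigma_process (fun t w => X i t w)).

(* x_1 > x_2 > ... > x_n > 0, where x_(i+1) is x 0 i. *)
Definition chamberB (R : realType) (n : nat) : set 'rV[R]_n :=
  [set x : 'rV[R]_n |
           (forall i j : 'I_n, (i < j)%N -> x 0 j < x 0 i) /\
           (forall i : 'I_n, 0 < x 0 i)].

(* The first time at which the path x is outside D; it is +oo if there is none. *)
Definition exit_time (R : realType) (V : Type) (D : set V) (x : R -> V) : \bar R :=
  ereal_inf [set s%:E | s in [set s : R | 0 <= s /\ ~ D (x s)]].

(* Euler's integral, for a > 0. *)
Definition Gamma (R : realType) (a : R) : R :=
  \int[lebesgue_measure]_(x in `]0, +oo[) (x `^ (a - 1) * expR (- x)).

Definition asymp_equiv (R : realType) (f g : R -> R) : Prop :=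
  (fun t => f t / g t) @ +oo --> (1 : R).

(* Main.v *)
Require Import Defs.
From HB Require Import structures.
From mathcomp Require Import all_boot all_order all_algebra.
From mathcomp Require Import all_classical all_reals all_analysis.
From mathcomp Require Import measurable_realfun ring lra zify.
From mathcomp Require Import fingroup perm.
Import Order.TTheory GRing.Theory Num.Theory.
Import numFieldNormedType.Exports.

Set Implicit Arguments.
Unset Strict Implicit.
Unset Printing Implicit Defensive.

Local Open Scope classical_set_scope.
Local Open Scope ring_scope.

(** The proof combines a reflection principle with an asymptotic expansion of
an alternating integral.

Reflection principle.  Let eps(x) be the sign of the element of the
hyperoctahedral group that moves x into the open chamber, and 0 when x lies on
a wall x_i = 0 or |x_i| = |x_j|.  It is antisymmetric under the reflections in
the walls and equal to 1 in the chamber.  Before the exit time the path is in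
the chamber, and once the path has met a wall its future is symmetric under
the reflection in that wall, so that the mean of eps(X(t)) over the paths that
have left before time t is 0.  Hence P(T > t) = E eps(X(t)) (exit_prob).  No
strong Markov property is used.  On a time grid, exploring the gaps to the
walls one after the other stops at the first small gap, an event of the past;
resampling the remaining increment of the coordinates involved (resample)
replaces eps by its average under a Gaussian centred near the wall, which is
of the order of the distance to the wall (zero_wall_estimate,
pair_wall_estimate).  The errors are proportional to the probability of the
events on which they occur, so they do not accumulate along the grid
(grid_estimate); refining the grid and using the continuity of the paths
gives the identity.

Law at time t.  The coordinates of X(t) are independent Gaussians.  Folding
each of them onto the positive half-line turns its density into the reflected
density f_i(x) = p(x) - p(-x), where p is the Gaussian density with mean
eta_i, and E eps(X(t)) becomes the integral of det(f_i(x_j)) over the chamber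
(eps_law), written here as the alternating sum altJ f of nested integrals.

Large times.  With e = 1/t, each f_i is, up to an explicit factor, a series in
e whose k-th term has the coefficient e^k eta_i^(2k) / (2k+1)! in front of an
odd Gaussian monomial g_k (gmono) that does not depend on i.  Since altJ is alternating
and multilinear, the first nonvanishing order only involves g_0, ..., g_(n-1)
and is the determinant of the coefficients times altJ g (altJ_asymp); the
determinant is a Vandermonde determinant in the eta_i^2, which produces the
product of the differences.

Constant.  The number altJ g is found by applying the same expansion to bumps
2 b_i x exp(- b_i x^2) with parameters b_i close to each other.  For these the
nested integrals are explicit, and their alternating sum is the product of the
(b_j - b_i) / (b_i + b_j) (alternating_invsums, by Lagrange interpolation).
This gives altJ g as a product of factorials up to sign (altJ_gmono).  The
Gamma factors are turned into the same factorials by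
Gamma(1 + k/2) Gamma((1 + k)/2) = sqrt(pi) k! / 2^k (Gamma_duplication). *)

(** * Bounded integrals and independence *)

Lemma measurable_fun_natr d (T : measurableType d) (R : realType) (b : T -> bool) :
  measurable_fun setT b -> measurable_fun setT (fun x => (b x)%:R : R).
Proof.
move=> mb; rewrite (_ : (fun _ => _) = (fun x => if b x then 1 else 0)).
  by apply: measurable_fun_ifT => //; exact: measurable_cst.
by apply/funext => z; case: (b z).
Qed.

Section bounded_integrals.
Context d (T : measurableType d) (R : realType) (P : probability T R).

Lemma bounded_integrable (f : T -> R) (M : R) :
  measurable_fun setT f -> (forall x, `|f x| <= M) ->
  P.-integrable setT (EFin \o f).
Proof.
move=> mf fM; apply: measurable_bounded_integrable => //.
  by apply: le_lt_trans (probability_le1 _ _) _ => //; rewrite ltry.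
exists M; split; first exact: num_real.
by move=> N MN x _; apply: le_trans (fM x) (ltW MN).
Qed.

Lemma Rintegral_norm_le (f : T -> R) (M : R) :
  measurable_fun setT f -> (forall x, `|f x| <= M) ->
  `|\int[P]_x f x| <= M.
Proof.
move=> mf fM.
have fi := bounded_integrable mf fM.
apply: le_trans (le_normr_Rintegral _ fi) _ => //.
have -> : M = \int[P]_x M.
  by rewrite Rintegral_cst// [X in fine X](probability_setT P) mulr1.
apply: le_Rintegral => //.
- apply: (bounded_integrable (M := M)); first exact: measurableT_comp.
  by move=> x; rewrite normr_id.
- by apply: (bounded_integrable (M := `|M|)).
Qed.

(** Dominated convergence in the form needed for events that are eventually
decided: at each point the integrands are eventually constant. *)
Lemma cvg_Rintegral (f_ : nat -> T -> R) (f : T -> R) (M : R) :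
  (forall k, measurable_fun setT (f_ k)) -> measurable_fun setT f ->
  (forall k x, `|f_ k x| <= M) ->
  (forall x, \forall k \near \oo, f_ k x = f x) ->
  (fun k => \int[P]_x f_ k x) @ \oo --> \int[P]_x f x.
Proof.
move=> mf_ mf fM cf.
have [] := @dominated_convergence _ T R P setT measurableT
  (fun k => EFin \o f_ k) (EFin \o f) (cst M%:E).
- by move=> k; apply/measurable_EFinP.
- exact/measurable_EFinP.
- apply: aeW => x _; apply: cvg_near_cst; near=> k.
  by rewrite /= (_ : f_ k x = f x)//; near: k; exact: cf.
- apply: (bounded_integrable (f := cst M) (M := `|M|)) => //.
- by apply: aeW => x k _ /=; rewrite lee_fin.
- move=> fi _ fcv; apply: fine_cvg.
  rewrite fineK//; last exact: integrable_fin_num fi.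
Unshelve. all: by end_near. Qed.

End bounded_integrals.

Section iterated_integrals.
Context d1 d2 (S : measurableType d1) (U : measurableType d2) (R : realType).
Variables (nu : probability U R).
Variables (H : S * U -> R) (M : R).
Hypotheses (mH : measurable_fun setT H) (HM : forall z, `|H z| <= M).

Lemma measurable_fun_Rintegral_snd :
  measurable_fun setT (fun x => \int[nu]_y H (x, y)).
Proof.
apply/measurableT_comp => //.
pose m : probability S R := dirac point.
exact: (measurable_fubini_F (@bounded_integrable _ _ _ (m \x nu)%E _ _ mH HM)).
Qed.

Variable mu : probability S R.

Let intH : (mu \x nu)%E.-integrable setT (EFin \o H).
Proof. exact: bounded_integrable mH HM. Qed.

Lemma Rintegral_prod : \int[(mu \x nu)%E]_z H z = \int[mu]_x \int[nu]_y H (x, y).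
Proof.
rewrite /Rintegral; congr fine; rewrite -(integral12_prod_meas1 intH).
apply: eq_integral => x _; rewrite /fubini_F fineK//.
have : nu.-integrable setT (EFin \o (fun y => H (x, y))).
  apply: (@bounded_integrable _ _ _ _ _ M) => //.
  exact: (measurableT_comp mH (pair1_measurable x)).
by move/(integrable_fin_num measurableT).
Qed.

Lemma Rintegral_swap :
  \int[mu]_x \int[nu]_y H (x, y) = \int[nu]_y \int[mu]_x H (x, y).
Proof.
rewrite -Rintegral_prod /Rintegral; congr fine.
rewrite -(integral21_prod_meas1 intH).
apply: eq_integral => y _; rewrite /fubini_G fineK//.
have : mu.-integrable setT (EFin \o (fun x => H (x, y))).
  apply: (@bounded_integrable _ _ _ _ _ M) => //.
  exact: (measurableT_comp mH (pair2_measurable y)).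
by move/(integrable_fin_num measurableT).
Qed.

End iterated_integrals.

Section independent_pair.
Context d (T : measurableType d) (R : realType) (P : probability T R).
Context d1 d2 (S : measurableType d1) (U : measurableType d2).
Variables (X : T -> S) (Y : T -> U) (nu : probability U R).
Hypotheses (mX : measurable_fun setT X) (mY : measurable_fun setT Y).
Hypothesis indXY : forall A B, measurable A -> measurable B ->
  P (X @^-1` A `&` Y @^-1` B) = (P (X @^-1` A) * nu B)%E.
Variables (H : S * U -> R) (M : R).
Hypotheses (mH : measurable_fun setT H) (HM : forall z, `|H z| <= M).

Let mX_pack : {mfun T >-> S} := HB.pack X (isMeasurableFun.Build _ _ _ _ _ mX).

Let XY w := (X w, Y w).

Let mXY : measurable_fun setT XY.
Proof. exact: measurable_fun_pair. Qed.

Let mXY_pack : {mfun T >-> (S * U)%type} :=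
  HB.pack XY (isMeasurableFun.Build _ _ _ _ _ mXY).

Let PX : probability S R := distribution P mX_pack.

Let PXY : probability (S * U)%type R := distribution P mXY_pack.

Let joint_law A : measurable A -> PXY A = (PX \x nu)%E A.
Proof.
move=> mA; apply/esym; apply: product_measure_unique  => //.
Qed.

Let intH : (PX \x nu)%E.-integrable setT (EFin \o H).
Proof. exact: bounded_integrable mH HM. Qed.

(** The joint law of X and Y is the product of their laws, so that Y can be
integrated out first. *)
Lemma independent_Fubini : \int[P]_w H (X w, Y w) =
  \int[P]_w \int[nu]_y H (X w, y).
Proof.
transitivity (\int[PXY]_z H z).
  rewrite /Rintegral; congr fine; rewrite [RHS]integral_pushforward//=.
    exact/measurable_EFinP.
  rewrite preimage_setT; apply: (@bounded_integrable _ _ _ _ (H \o XY) M) => [|w].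
    exact: measurableT_comp mH mXY.
  exact: HM.
transitivity (\int[(PX \x nu)%E]_z H z).
  rewrite /Rintegral; congr fine; apply: eq_measure_integral => A mA _.
  exact: joint_law.
rewrite (Rintegral_prod _ mH HM).
have mF := measurable_fun_Rintegral_snd nu mH HM.
rewrite /Rintegral; congr fine; rewrite [LHS]integral_pushforward//=.
  exact/measurable_EFinP.
apply: (@bounded_integrable _ _ _ _ _ M); first exact: measurableT_comp mF mX.
move=> w; apply: Rintegral_norm_le => //.
exact: (measurableT_comp mH (pair1_measurable _)).
Qed.

Lemma independent_Fubini_swap : \int[P]_w H (X w, Y w) =
  \int[nu]_y \int[P]_w H (X w, y).
Proof.
rewrite independent_Fubini.
apply: (@Rintegral_swap _ _ _ _ _ nu (fun z => H (X z.1, z.2)) M _ _ P) => //.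
apply: measurableT_comp => //; apply: measurable_fun_pair => //=.
exact: measurableT_comp.
Qed.

End independent_pair.

(** * Resampling an increment independent of the past *)

Section independence.
Context d (T : measurableType d) (R : realType) (P : probability T R).

(** The events independent of B form a Dynkin system, so that independence
spreads from a pi-system to the sigma-algebra that it generates. *)
Lemma pi_system_independent (G : set (set T)) (B : set T) :
  G `<=` measurable -> setI_closed G -> G setT -> measurable B ->
  (forall A, G A -> P (A `&` B) = (P A * P B)%E) ->
  forall A, <<s G >> A -> P (A `&` B) = (P A * P B)%E.
Proof.
move=> Gm GI GT mB GB A sA.
have PB0 : (0 <= fine (P B)) by rewrite fine_ge0.
have Bfin : P B \is a fin_num by rewrite fin_num_measure.
pose m1 : {measure set T -> \bar R} := mrestr P mB.
pose m2 : {measure set T -> \bar R} := mscale (NngNum PB0) P.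
have /(_ A sA) : forall E, <<s G >> E -> m1 E = m2 E.
  apply: (g_sigma_algebra_measure_unique G Gm (fun=> setT)) => //.
  - by rewrite bigcup_const//; exists 0%N.
  - by move=> C GC; rewrite /m1 /m2 /= /mrestr /mscale/= fineK// GB// muleC.
  - move=> _; rewrite /m1 /= /mrestr; apply: le_lt_trans (probability_le1 _ _) _.
      exact: measurableI.
    by rewrite ltry.
by rewrite /m1 /m2 /= /mrestr /mscale/= fineK// muleC.
Qed.

(** An event B of the j-th member of an independent family that is independent
of a part H of that member is independent of H and of the other members taken
together: the events that intersect one event of H with one event of each other
member form a pi-system. *)
Lemma independent_refine (K : finType) (F : K -> set (set T)) (j : K)
    (H : set (set T)) (B : set T) :
  (forall i, F i `<=` measurable) ->
  (forall i, setI_closed (F i)) ->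
  (forall i, F i setT) -> mutually_independent P F ->
  H `<=` F j -> setI_closed H -> H setT -> F j B ->
  (forall A, H A -> P (A `&` B) = (P A * P B)%E) ->
  forall A, <<s [set A | H A \/ exists2 i, i != j & F i A] >> A ->
  P (A `&` B) = (P A * P B)%E.
Proof.
move=> Fm FI FT indF HF HI HT FB HB A sA.
pose G := [set A : set T | exists Q : K -> set T,
  [/\ H (Q j), forall i, F i (Q i) & A = \bigcap_i Q i]].
have mB : measurable B by exact: Fm FB.
have indT Q : (forall i, F i (Q i)) ->
    P (\bigcap_i Q i) = (P (Q j) * \prod_(i | i != j) P (Q i))%E.
  move=> FQ; have := indF [set: K]%SET Q (fun i _ => FQ i).
  rewrite (_ : [set` [set: K]%SET] = setT); last first.
    by apply/seteqP; split=> // i _; rewrite /= inE.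
  move=> ->; rewrite (bigD1 j)//=; congr (_ * _)%E.
  by apply: eq_bigl => i; rewrite finset.in_setT.
suff : forall A, <<s G >> A -> P (A `&` B) = (P A * P B)%E.
  apply; move: A sA; apply: sub_sigma_algebra2 => C [HC|[i ij FC]].
    exists (fun i => if i == j then C else setT); rewrite eqxx; split => //.
      by move=> i; case: eqP => [->|_]; [exact: HF|exact: FT].
    apply/seteqP; split=> [x Cx i _|x /(_ j I)]; last by rewrite eqxx.
    by case: eqP.
  exists (fun k => if k == i then C else setT).
  rewrite eq_sym (negbTE ij); split => //.
    by move=> k; case: eqP => [->|_] //; exact: FT.
  apply/seteqP; split=> [x Cx k _|x /(_ i I)]; last by rewrite eqxx.
  by case: eqP.
apply: pi_system_independent => //.
- move=> C [Q [_ FQ ->]].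
  by apply: fin_bigcap_measurable => // i _; exact: Fm (FQ i).
- move=> C D [Q [HQ FQ ->]] [Q' [HQ' FQ' ->]].
  exists (fun i => Q i `&` Q' i); split.
  + exact: HI.
  + by move=> i; exact: FI.
  + by rewrite bigcapI.
- exists (fun=> setT); split => //.
  by apply/seteqP; split.
- move=> C [Q [HQ FQ ->]].
  pose Q' i := if i == j then Q i `&` B else Q i.
  have FQ' i : F i (Q' i).
    by rewrite /Q'; case: eqP => [->|//]; apply: FI => //; exact: FQ.
  have -> : \bigcap_i Q i `&` B = \bigcap_i Q' i.
    apply/seteqP; split=> [x [Qx Bx] i _|x Q'x].
      by rewrite /Q'; case: eqP => _; [split => //|]; exact: Qx.
    split; last by have := Q'x j I; rewrite /Q' eqxx => -[].
    by move=> i _; have := Q'x i I; rewrite /Q'; case: eqP => // _ [].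
  rewrite !indT// {1}/Q' eqxx HB// muleAC; congr (_ * _ * _)%E.
  by apply: eq_bigr => i /negbTE ij; rewrite /Q' ij.
Qed.

End independence.

Section generated.
Context d (T : measurableType d) (R : realType).

Lemma sigma_rv_measurable (f : T -> R) :
  measurable_fun setT f -> sigma_rv f `<=` measurable.
Proof. by move=> mf _ [B mB <-]; rewrite -[X in measurable X]setTI; exact: mf. Qed.

Lemma sigma_rv_setI (f : T -> R) : setI_closed (sigma_rv f).
Proof.
by move=> _ _ [B mB <-] [C mC <-]; exists (B `&` C) => //; exact: measurableI.
Qed.

Lemma sigma_rv_setT (f : T -> R) : sigma_rv f setT.
Proof. by exists setT; rewrite ?preimage_setT//; exact: measurableT. Qed.

Lemma sigma_sub_measurable (G : set (set T)) :
  G `<=` measurable -> <<s G >> `<=` measurable.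
Proof.
move=> Gm; apply: smallest_sub => //; split => //.
- by move=> A mA; exact: measurableD.
- by move=> F mF; exact: bigcupT_measurable.
Qed.

Lemma sigma_setI (G : set (set T)) : setI_closed <<s G >>.
Proof.
by move=> A B GA GB; exact: (@measurableI _ (g_sigma_algebraType G)).
Qed.

Lemma sigma_setT (G : set (set T)) : <<s G >> setT.
Proof. exact: (@measurableT _ (g_sigma_algebraType G)). Qed.

Lemma sigma_fun (G : set (set T)) (f : T -> R) :
  sigma_rv f `<=` <<s G >> ->
  measurable_fun setT (f : g_sigma_algebraType G -> R).
Proof. by move=> fG _ B mB; rewrite setTI; apply: fG; exists B. Qed.

Lemma sigma_rv_fun (G : set (set T)) (f : T -> R) :
  measurable_fun setT (f : g_sigma_algebraType G -> R) ->
  sigma_rv f `<=` <<s G >>.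
Proof. by move=> mf _ [B mB <-]; rewrite -[_ @^-1` _]setTI; exact: mf. Qed.

Lemma sigma_id (G : set (set T)) : G `<=` measurable ->
  measurable_fun setT (id : T -> g_sigma_algebraType G).
Proof.
by move=> Gm _ B mB; rewrite setTI; exact: (sigma_sub_measurable Gm mB).
Qed.

End generated.

Section brownian1.
Context (d : measure_display) (Omega : measurableType d)
    (R : realType) (P : probability Omega R) (W : R -> {RV P >-> R}) (x : R).
Hypothesis bmW : brownian_motion1 W x.
Variables (q : nat -> R) (k : nat) (t : R).
Hypotheses (q0 : q 0%N = 0) (ndq : nondecreasing_seq q) (qt : q k < t).

(** W 0 is constant, so that the values at the grid times up to q k are sums of
increments, all of them independent of the increment after q k. *)
Lemma increment_independent_past A B :
  <<s [set A | exists2 l, (l <= k)%N & sigma_rv (W (q l)) A] >> A ->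
  measurable B ->
  P (A `&` (fun w => W t w - W (q k) w) @^-1` B) =
  (P A * P ((fun w => (W t w - W (q k) w)%R) @^-1` B))%E.
Proof.
move=> sA mB; have [W0 indW _ _] := bmW.
(* The grid up to q k, followed by the single further time t. *)
pose r l := if (l <= k)%N then q l else t.
have ndr : nondecreasing_seq r.
  move=> a b ab; rewrite /r; case: (leqP b k) => bk.
    by rewrite (leq_trans ab bk); exact: ndq.
  case: (leqP a k) => // ak; exact: le_trans (ndq ak) (ltW qt).
pose D l w := W (r l.+1) w - W (r l) w.
have mD l : measurable_fun setT (D l) by exact: measurable_funB.
pose G := [set A : set Omega | [set setT] A \/
  exists2 i : 'I_k.+1, i != ord_max & sigma_rv (D i) A].
have GP : forall A, <<s G >> A ->
    P (A `&` (D k @^-1` B)) = (P A * P (D k @^-1` B))%E.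
  apply: (independent_refine (F := fun i : 'I_k.+1 => sigma_rv (D i))).
  - by move=> i; exact: sigma_rv_measurable.
  - by move=> i; exact: sigma_rv_setI.
  - by move=> i; exact: sigma_rv_setT.
  - by apply: indW => //; rewrite /r /= q0.
  - by move=> _ ->; exact: sigma_rv_setT.
  - by move=> _ _ -> ->; rewrite setIT.
  - by [].
  - by exists B.
  - by move=> _ ->; rewrite setTI (probability_setT P) mul1e.
have DkE : D k = (fun w => W t w - W (q k) w).
  by rewrite /D /r leqnn ltnn.
rewrite -DkE; apply: GP; move: A sA; apply: smallest_sub.
  exact: smallest_sigma_algebra.
move=> A [l lk]; move: A.
suff : measurable_fun setT (W (q l) : g_sigma_algebraType G -> R).
  by move/sigma_rv_fun; apply.
elim: l lk => [_|l IHl lk].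
  have -> : W (q 0%N) = cst x :> (Omega -> R).
    by apply/funext => w; rewrite q0 W0.
  exact: measurable_cst.
have -> : W (q l.+1) = (fun w => W (q l) w + D l w) :> (Omega -> R).
  by apply/funext => w; rewrite /D /r lk (ltnW lk) addrC subrK.
apply: measurable_funD; first exact: IHl (ltnW lk).
apply: sigma_fun => A DA; apply: sub_sigma_algebra; right.
by exists (Ordinal (leqW lk)) => //; rewrite -val_eqE /= ltn_eqF.
Qed.

End brownian1.

Section brownian_past.
Context (d : measure_display) (Omega : measurableType d)
    (R : realType) (P : probability Omega R) (n : nat).
Variables (eta : 'rV[R]_n) (X : 'I_n -> R -> {RV P >-> R}).
Hypothesis hX : brownian_motion X eta.

(** What is frozen when the increment of the j-th coordinate after q k is
resampled: that coordinate at the grid times up to q k, and the whole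
trajectories, future included, of the other coordinates. *)
Definition past (q : nat -> R) (k : nat) (j : 'I_n) : set (set Omega) :=
  [set A | (exists2 l, (l <= k)%N & sigma_rv (X j (q l)) A) \/
           (exists2 i, i != j & sigma_process (fun t w => X i t w) A)].

Lemma sigma_process_sub i : sigma_process (fun t w => X i t w) `<=` measurable.
Proof.
apply: sigma_sub_measurable => A [t _ tA].
by apply: sigma_rv_measurable tA.
Qed.

Lemma past_sub q k j : past q k j `<=` measurable.
Proof.
move=> A [[l _ lA]|[i _ iA]]; last exact: sigma_process_sub iA.
by apply: sigma_rv_measurable lA.
Qed.

Lemma past_other q k j i t : i != j -> 0 <= t ->
  measurable_fun setT (X i t : g_sigma_algebraType (past q k j) -> R).
Proof.
move=> ij t0; apply: sigma_fun => A tA; apply: sub_sigma_algebra; right.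
by exists i => //; apply: sub_sigma_algebra; exists t.
Qed.

Lemma past_self q k j l : (l <= k)%N ->
  measurable_fun setT (X j (q l) : g_sigma_algebraType (past q k j) -> R).
Proof.
by move=> lk; apply: sigma_fun => A tA; apply: sub_sigma_algebra; left; exists l.
Qed.

Variables (q : nat -> R) (k : nat) (t : R).
Hypotheses (q0 : q 0%N = 0) (ndq : nondecreasing_seq q) (qt : q k < t).

Let q_ge0 l : 0 <= q l.
Proof. by rewrite -q0; exact: ndq. Qed.

Lemma increment_independent j A B : <<s past q k j >> A -> measurable B ->
  P (A `&` (fun w => X j t w - X j (q k) w) @^-1` B) =
  (P A * normal_prob 0 (Num.sqrt (t - q k)) B)%E.
Proof.
move=> sA mB; have [bmX indX] := hX; have [_ _ lawX _] := bmX j.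
rewrite -(lawX _ _ (q_ge0 k) qt _ mB).
pose G := [set A : set Omega |
  <<s [set A | exists2 l, (l <= k)%N & sigma_rv (X j (q l)) A] >> A \/
  (exists2 i, i != j & sigma_process (fun t w => X i t w) A)].
apply: (independent_refine (F := fun i => sigma_process (fun t w => X i t w))
  (j := j)
  (H := <<s [set A | exists2 l, (l <= k)%N & sigma_rv (X j (q l)) A] >>)).
- exact: sigma_process_sub.
- by move=> i; exact: sigma_setI.
- by move=> i; exact: sigma_setT.
- exact: indX.
- by apply: sub_sigma_algebra2 => C [l lk lC]; exists (q l).
- exact: sigma_setI.
- exact: sigma_setT.
- pose G' := [set A | exists2 t, 0 <= t & sigma_rv (X j t) A].
  have mX r : 0 <= r -> measurable_fun setT
      (X j r : g_sigma_algebraType G' -> R).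
    move=> r0; apply: sigma_fun => C rC; apply: sub_sigma_algebra.
    by exists r.
  have : measurable_fun setT (fun w : g_sigma_algebraType G' =>
      X j t w - X j (q k) w).
    apply: measurable_funB; apply: mX => //.
    exact: le_trans (q_ge0 k) (ltW qt).
  by move/sigma_rv_fun; apply; exists B.
- move=> C sC; exact: (increment_independent_past (bmX j)).
- move: A sA; apply: sub_sigma_algebra2 => C [[l lk lC]|]; last by right.
  by left; apply: sub_sigma_algebra; exists l.
Qed.

Variables (j : 'I_n) (H : g_sigma_algebraType (past q k j) * R -> R) (M : R).
Hypotheses (mH : measurable_fun setT H) (HM : forall z, `|H z| <= M).

Let U w := X j t w - X j (q k) w.

Let mid : measurable_fun setT (id : Omega -> g_sigma_algebraType (past q k j)).
Proof. exact: sigma_id (@past_sub _ _ _). Qed.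

(** The increment of the j-th coordinate after q k can be replaced by a fresh
Gaussian variable, everything else being kept. *)
Lemma resample : \int[P]_w H (w, U w) =
  \int[P]_w \int[normal_prob 0 (Num.sqrt (t - q k))]_u H (w, u).
Proof.
have h := @independent_Fubini _ _ R P _ _ (g_sigma_algebraType (past q k j))
  (measurableTypeR R) id U (normal_prob 0 (Num.sqrt (t - q k))) mid _ _ H M mH HM.
apply: h.
- exact: measurable_funB.
- by move=> A B mA mB; exact: increment_independent.
Qed.

Lemma resample_swap : \int[P]_w H (w, U w) =
  \int[normal_prob 0 (Num.sqrt (t - q k))]_u \int[P]_w H (w, u).
Proof.
apply: (@independent_Fubini_swap _ _ R P _ _ (g_sigma_algebraType (past q k j))
  (measurableTypeR R) id U (normal_prob 0 (Num.sqrt (t - q k))) _ _ _ H M mH HM) => //.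
- exact: measurable_funB.
- by move=> A B mA mB; exact: increment_independent.
Qed.

End brownian_past.

(** * Gaussian integrals *)

Section gaussian.
Context (R : realType).
Local Notation mu := (@lebesgue_measure R).

Lemma integrable_bounded_mul (g p : R -> R) (M : R) :
  measurable_fun setT g -> (forall x, `|g x| <= M) ->
  mu.-integrable setT (EFin \o p) ->
  mu.-integrable setT (EFin \o (fun x => g x * p x)).
Proof.
move=> mg gM ip; have mp : measurable_fun setT p.
  by apply/measurable_EFinP; case/integrableP : ip.
have iMp : mu.-integrable setT (EFin \o (fun x => M * p x)).
  have := integrableZl measurableT M ip.
  by apply: eq_integrable => // x _; rewrite /= EFinM.
apply: le_integrable iMp => //.
  by apply/measurable_EFinP; exact: measurable_funM.
move=> x _; rewrite /= lee_fin !normrM ler_wpM2r//.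
by rewrite (le_trans (gM x))// ler_norm.
Qed.

Lemma Rintegral_normal m s (g : R -> R) (M : R) : measurable_fun setT g ->
  (forall x, `|g x| <= M) ->
  \int[normal_prob m s]_x g x = \int[mu]_x (g x * normal_pdf m s x).
Proof.
move=> mg gM; rewrite /Rintegral; congr fine.
rewrite -(Radon_Nikodym_change_of_variables (normal_prob_dominates m s))//=;
    last first.
  exact: (@bounded_integrable _ (measurableTypeR R) R (normal_prob m s) g M mg gM).
have ipdf := integrable_normal_pdf m s.
under [RHS]eq_integral do rewrite EFinM.
apply: ae_eq_integral => //.
- apply: emeasurable_funM; first exact/measurable_EFinP.
  apply: (measurable_int mu).
  by apply: Radon_Nikodym_integrable; exact: normal_prob_dominates.
- apply: emeasurable_funM; first exact/measurable_EFinP.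
  by apply/measurable_EFinP; exact: measurable_normal_pdf.
- apply: ae_eqe_mul2l => /=.
  rewrite Radon_NikodymE//=; first exact: normal_prob_dominates.
  move=> dom; case: cid => /= h [h1 h2 h3].
  apply: integral_ae_eq => //=.
  + by apply/measurable_EFinP; exact: measurable_normal_pdf.
  + by move=> E _ mE; rewrite -h3.
Qed.

Lemma lebesgue_shift (a : R) (A : set R) : measurable A ->
  pushforward mu ((fun x => a + x) : measurableTypeR R -> measurableTypeR R) A = mu A.
Proof.
move=> mA.
apply/esym/lebesgue_measure_unique => //=.
  by apply: measurable_funD => //; exact: measurable_cst.
move=> _ _ [[b c]] _ <-.
rewrite /pushforward (_ : _ @^-1` _ = `](b - a), (c - a)]%classic); last first.
  by apply/seteqP; split => x /=; rewrite !in_itv/= ltrBlDl lerBrDl.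
rewrite !lebesgue_measure_itv/= !lte_fin ltrD2r; case: ifP => // _.
by rewrite -!EFinB; congr EFin; ring.
Qed.

Lemma Rintegral_shift (a : R) (f : R -> R) : measurable_fun setT f ->
  mu.-integrable setT (EFin \o (fun x => f (a + x))) ->
  \int[mu]_x f (a + x) = \int[mu]_x f x.
Proof.
move=> mf intf; rewrite /Rintegral; congr fine.
have ms : measurable_fun setT ((fun x => a + x) : measurableTypeR R -> measurableTypeR R).
  by apply: measurable_funD => //; exact: measurable_cst.
have h := integral_pushforward ms (mu := mu) (D := setT) (f := EFin \o f).
rewrite preimage_setT in h.
rewrite -[LHS]h//; last exact/measurable_EFinP.
by apply: eq_measure_integral => A mA _; exact: lebesgue_shift.
Qed.

Lemma Rintegral_opp (f : R -> R) : measurable_fun setT f ->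
  mu.-integrable setT (EFin \o (fun x => f (- x))) ->
  \int[mu]_x f (- x) = \int[mu]_x f x.
Proof.
move=> mf intf; rewrite /Rintegral; congr fine.
have ms : measurable_fun setT (-%R : measurableTypeR R -> measurableTypeR R).
  exact: measurable_funN.
have h := integral_pushforward ms (mu := mu) (D := setT) (f := EFin \o f).
rewrite preimage_setT in h.
rewrite -[LHS]h//; last exact/measurable_EFinP.
by apply: eq_measure_integral => A mA _; exact: lebesgue_measureN.
Qed.

Section positive_deviation.
Variables (s : R).
Hypothesis s0 : 0 < s.

Lemma normal_pdfEgt0 m x :
  normal_pdf m s x = normal_peak s * expR (- (x - m) ^+ 2 / (s ^+ 2 *+ 2)).
Proof. by rewrite normal_pdfE// gt_eqF. Qed.

Lemma normal_pdf_shift (m x : R) : normal_pdf m s (m + x) = normal_pdf 0 s x.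
Proof. by rewrite !normal_pdfEgt0 (_ : m + x - m = x - 0)//; ring. Qed.

Lemma Rintegral_normal_shift m (g : R -> R) (M : R) : measurable_fun setT g ->
  (forall x, `|g x| <= M) ->
  \int[normal_prob 0 s]_x g (m + x) = \int[normal_prob m s]_x g x.
Proof.
move=> mg gM.
have ms : measurable_fun setT (fun x : R => m + x).
  by apply: measurable_funD => //; exact: measurable_cst.
have mgs : measurable_fun setT (fun x : R => g (m + x)).
  exact: measurableT_comp mg ms.
rewrite (Rintegral_normal _ _ mgs (fun x => gM _)) (Rintegral_normal _ _ mg gM).
under eq_Rintegral do rewrite -(normal_pdf_shift m).
apply: (Rintegral_shift (f := fun x => g x * normal_pdf m s x)).
  by apply: measurable_funM => //; exact: measurable_normal_pdf.
under [X in _.-integrable _ (_ \o X)]funext do rewrite normal_pdf_shift.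
apply: (integrable_bounded_mul (M := M)) => //.
exact: integrable_normal_pdf.
Qed.

Lemma Rintegral_normal_opp (g : R -> R) (M : R) : measurable_fun setT g ->
  (forall x, `|g x| <= M) ->
  \int[normal_prob 0 s]_x g (- x) = \int[normal_prob 0 s]_x g x.
Proof.
move=> mg gM.
have mgs : measurable_fun setT (fun x : R => g (- x)).
  by apply: measurableT_comp mg _; exact: measurable_funN.
have pdfN x : normal_pdf 0 s (- x) = normal_pdf 0 s x.
  by rewrite !normal_pdfEgt0 (_ : (- x - 0) ^+ 2 = (x - 0) ^+ 2)//; ring.
rewrite (Rintegral_normal _ _ mgs (fun x => gM _)) (Rintegral_normal _ _ mg gM).
under eq_Rintegral do rewrite -pdfN.
apply: (Rintegral_opp (f := fun x => g x * normal_pdf 0 s x)).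
  by apply: measurable_funM => //; exact: measurable_normal_pdf.
under [X in _.-integrable _ (_ \o X)]funext do rewrite pdfN.
apply: (integrable_bounded_mul (M := M)) => //.
exact: integrable_normal_pdf.
Qed.

Lemma Rintegral_normal_pdf m : \int[mu]_x normal_pdf m s x = 1.
Proof. by rewrite /Rintegral integral_normal_pdf. Qed.

(** Completing the square.  Divided by the density with mean a and integrated,
it makes the chi-square divergence of the two Gaussians explicit. *)
Lemma normal_pdf_chi2 (a b x : R) :
  normal_pdf b s x ^+ 2 = normal_pdf a s x *
    (expR ((a - b) ^+ 2 / s ^+ 2) * normal_pdf (2 * b - a) s x).
Proof.
rewrite !normal_pdfEgt0; set p := normal_peak s.
set A := expR _; set B := expR _; set C := expR _; set D := expR _.
have -> : A = expR (- (x - b) ^+ 2 / (s ^+ 2 *+ 2)) by [].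
have e : expR (- (x - b) ^+ 2 / (s ^+ 2 *+ 2)) *
    expR (- (x - b) ^+ 2 / (s ^+ 2 *+ 2)) = B * (C * D).
  by rewrite -!expRD; congr expR; field; rewrite gt_eqF.
transitivity (p ^+ 2 * (B * (C * D))); last by ring.
by rewrite -e; ring.
Qed.

(** The difference of two densities p and p' is at most
kappa p / 2 + (p - p')^2 / (2 kappa p), by the inequality of the arithmetic and
geometric means; the last term integrates to a chi-square divergence. *)
Lemma normal_dist_le (a b kappa M : R) (g : R -> R) : 0 < kappa ->
  measurable_fun setT g -> (forall x, `|g x| <= M) ->
  `|\int[normal_prob a s]_x g x - \int[normal_prob b s]_x g x| <=
  M * (kappa / 2 + (expR ((a - b) ^+ 2 / s ^+ 2) - 1) / (2 * kappa)).
Proof.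
move=> k0 mg gM; set E := expR _.
have M0 : 0 <= M by exact: le_trans (normr_ge0 _) (gM 0).
have ip m := integrable_normal_pdf m s : mu.-integrable setT (EFin \o normal_pdf m s).
have igp m := integrable_bounded_mul mg gM (ip m).
rewrite !(Rintegral_normal _ _ mg gM) -RintegralB//.
under eq_Rintegral do rewrite -mulrBr.
have iB : mu.-integrable setT
    (EFin \o (fun x => g x * (normal_pdf a s x - normal_pdf b s x))).
  have := integrableB measurableT (igp a) (igp b).
  by apply: eq_integrable => // x _; rewrite /= mulrBr EFinB.
apply: le_trans (le_normr_Rintegral _ iB) _ => //.
have iZ c m : mu.-integrable setT (EFin \o (fun x => c * normal_pdf m s x)).
  have := integrableZl measurableT c (ip m).
  by apply: eq_integrable => // x _; rewrite /= EFinM.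
have iD (u v : R -> R) : mu.-integrable setT (EFin \o u) ->
    mu.-integrable setT (EFin \o v) ->
    mu.-integrable setT (EFin \o (fun x => u x + v x)).
  move=> iu iv; have := integrableD measurableT iu iv.
  by apply: eq_integrable.
pose c1 := M * (kappa / 2 + (2 * kappa)^-1).
pose c2 := M * - (kappa^-1).
pose c3 := M * (E / (2 * kappa)).
have -> : M * (kappa / 2 + (E - 1) / (2 * kappa)) =
    \int[mu]_x (c1 * normal_pdf a s x + c2 * normal_pdf b s x
      + c3 * normal_pdf (2 * b - a) s x).
  rewrite RintegralD//; last exact: iD.
  rewrite RintegralD// !RintegralZl// !Rintegral_normal_pdf.
  rewrite /c1 /c2 /c3; field; lra.
apply: le_Rintegral => //; first exact: integrable_norm iB.
  by apply: (iD (fun x => c1 * normal_pdf a s x + c2 * normal_pdf b s x)) => //;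
     exact: iD.
move=> x _; rewrite normrM.
have pa : 0 < normal_pdf a s x.
  by rewrite normal_pdfEgt0 mulr_gt0 ?expR_gt0 ?normal_peak_gt0 ?gt_eqF.
have := normal_pdf_chi2 a b x; rewrite -/E.
move: pa (normal_pdf_ge0 (2 * b - a) s x).
move: (normal_pdf a s x) (normal_pdf b s x) (normal_pdf (2 * b - a) s x).
move=> p p' p'' p0 p''0 pE.
have Ep'' : E * p'' = p' ^+ 2 / p by rewrite pE; field; rewrite gt_eqF.
have -> : c1 * p + c2 * p' + c3 * p'' =
    M * (kappa / 2 * p + (p - p') ^+ 2 / (2 * kappa * p)).
  have -> : c3 * p'' = M / (2 * kappa) * (E * p'') by rewrite /c3; field; lra.
  by rewrite Ep'' /c1 /c2; field; lra.
apply: ler_pM => //.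
rewrite -[in leRHS](real_normK (num_real (p - p'))).
move: `|p - p'| (normr_ge0 (p - p')) => y y0.
have kp : 0 < kappa * p by exact: mulr_gt0.
rewrite -subr_ge0 (_ : _ - _ = (kappa * p - y) ^+ 2 / (2 * kappa * p)).
  by rewrite divr_ge0 ?sqr_ge0// -mulrA mulr_ge0// ltW.
by field; lra.
Qed.

(** The bound normal_dist_le with kappa = delta, where the divergence is of
order delta^2: the total variation is Lipschitz in the mean. *)
Lemma normal_dist_lin (a b delta M : R) (g : R -> R) : 0 < delta ->
  delta ^+ 2 <= s ^+ 2 / 2 -> `|a - b| <= delta ->
  measurable_fun setT g -> (forall x, `|g x| <= M) ->
  `|\int[normal_prob a s]_x g x - \int[normal_prob b s]_x g x| <=
  M * (delta * (2^-1 + s ^- 2)).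
Proof.
move=> d0 ds ab mg gM.
have M0 : 0 <= M by exact: le_trans (normr_ge0 _) (gM 0).
apply: le_trans (normal_dist_le a b d0 mg gM) _; apply: ler_wpM2l => //.
have s20 : 0 < s ^+ 2 by rewrite exprn_gt0.
set z := _ / s ^+ 2.
have z0 : 0 <= z by rewrite divr_ge0 ?sqr_ge0 ?ltW.
have zd : z <= delta ^+ 2 / s ^+ 2.
  rewrite ler_pM2r ?invr_gt0// -(real_normK (num_real (a - b))).
  by apply: lerXn2r => //; rewrite nnegrE ?normr_ge0 ?(ltW d0).
have z12 : z <= 2^-1.
  by apply: le_trans zd _; rewrite ler_pdivrMr// mulrC.
have ez : expR z - 1 <= 2 * z.
  have h := expR_ge1Dx (- z); rewrite expRN in h.
  have e0 := expR_gt0 z.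
  have : expR z * (1 - z) <= expR z * (expR z)^-1 by rewrite ler_wpM2l// ltW.
  rewrite mulfV ?lt0r_neq0//; move: (expR z) e0 z0 z12 => e e0 z0 z12 ez.
  have : (e - 1 - 2 * z) * (1 - z) <= 0 by nra.
  rewrite pmulr_lle0; lra.
have -> : delta * (2^-1 + s ^- 2) =
    delta / 2 + (2 * (delta ^+ 2 / s ^+ 2)) / (2 * delta).
  by field; rewrite !gt_eqF.
rewrite lerD2l ler_pM2r ?invr_gt0 ?mulr_gt0//.
by apply: le_trans ez _; rewrite ler_wpM2l.
Qed.

End positive_deviation.

End gaussian.

(** * The sign of the chamber *)

(** The product of the signs of the a_i, on the set where
y < |a_1| < |a_2| < ... *)
Fixpoint chainsg (R : realType) (l : seq R) (y : R) : R :=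
  if l is a :: l' then
    (if y < `|a| then Num.sg a * chainsg l' `|a| else 0)
  else 1.

(** The list is read from the last index to the first, so that the identity
permutation contributes 1 when 0 < x_n < ... < x_1.  At most one term does not
vanish: that of the permutation which sorts the absolute values. *)
Definition eps (R : realType) (n : nat) (x : 'I_n -> R) : R :=
  \sum_(s : 'S_n) (-1) ^+ s * chainsg [seq x (s i) | i <- rev (enum 'I_n)] 0.

Section chainsg.
Context (R : realType).
Implicit Types (l : seq R) (y : R).

Lemma chainsg_le1 l y : `|chainsg l y| <= 1.
Proof.
elim: l y => [|a l IHl] y /=; first by rewrite normr1.
case: ifP => _; last by rewrite normr0.
by rewrite normrM -[leRHS]mulr1 ler_pM// normr_sg; case: (a != 0).
Qed.

Lemma chainsg_sign (I : eqType) (l : seq I) (e x : I -> R) y :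
  (forall i, i \in l -> e i ^+ 2 = 1) ->
  chainsg [seq e i * x i | i <- l] y =
  (\prod_(i <- l) e i) * chainsg [seq x i | i <- l] y.
Proof.
elim: l y => [|a l IHl] y He /=; first by rewrite big_nil mul1r.
have ea : `|e a| = 1.
  have := He a (mem_head _ _); rewrite -real_normK ?num_real// => /eqP.
  by rewrite -subr_eq0 subr_sqr_1 mulf_eq0 subr_eq0 addr_eq0 =>
    /orP[/eqP//|/eqP h]; have := normr_ge0 (e a); rewrite h; lra.
rewrite normrM ea mul1r; case: ifP => _; last by rewrite mulr0.
rewrite IHl => [|i il]; last by rewrite He// inE il orbT.
rewrite big_cons sgrM; suff -> : Num.sg (e a) = e a by ring.
by rewrite [RHS]numEsg ea mulr1.
Qed.

Lemma chainsg_neq0 l y : chainsg l y != 0 -> path <%R y (map Num.norm l).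
Proof.
elim: l y => [//|a l IHl] y /=; case: ifP => _; last by rewrite eqxx.
by rewrite mulf_eq0 negb_or => /andP[_ /IHl].
Qed.

Lemma chainsg_path l y : 0 <= y -> path <%R y l -> chainsg l y = 1.
Proof.
elim: l y => [//|a l IHl] y y0 /= /andP[ya pl].
have a0 : 0 < a by exact: le_lt_trans y0 ya.
by rewrite gtr0_norm// ya gtr0_sg// mul1r IHl// ltW.
Qed.

Lemma measurable_fun_sgr d (T : measurableType d) (f : T -> R) :
  measurable_fun setT f -> measurable_fun setT (fun w => Num.sg (f w)).
Proof.
move=> mf; rewrite (_ : (fun w => Num.sg (f w)) = (fun w =>
    if f w < 0 then -1 else if 0 < f w then 1 else 0)).
  apply: measurable_fun_ifT; first exact: measurable_fun_ltr.
    exact: measurable_cst.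
  by apply: measurable_fun_ifT; [exact: measurable_fun_ltr|exact: measurable_cst..].
apply/funext => w; case: (ltrgt0P (f w)) => [h|h|->].
- by rewrite gtr0_sg.
- by rewrite ltr0_sg.
- by rewrite sgr0.
Qed.

Lemma measurable_chainsg d (T : measurableType d) (I : Type) (l : seq I)
    (f : I -> T -> R) (g : T -> R) :
  (forall i, measurable_fun setT (f i)) -> measurable_fun setT g ->
  measurable_fun setT (fun w => chainsg [seq f i w | i <- l] (g w)).
Proof.
move=> mf; elim: l g => [|a l IHl] g mg /=; first exact: measurable_cst.
have mn : measurable_fun setT (fun w => `|f a w|) by exact: measurableT_comp.
apply: measurable_fun_ifT; first exact: measurable_fun_ltr.
  by apply: measurable_funM; [exact: measurable_fun_sgr|exact: IHl].
exact: measurable_cst.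
Qed.

End chainsg.

Section eps.
Context (R : realType) (n : nat).
Implicit Types x : 'I_n -> R.

Lemma eps_bound x : `|eps x| <= n`!%:R.
Proof.
apply: le_trans (ler_norm_sum _ _ _) _.
rewrite -card_Sn -sum1_card natr_sum; apply: ler_sum => s _.
by rewrite normrM normr_sign mul1r chainsg_le1.
Qed.

Lemma measurable_eps d (T : measurableType d) (f : 'I_n -> T -> R) :
  (forall i, measurable_fun setT (f i)) ->
  measurable_fun setT (fun w => eps (fun i => f i w)).
Proof.
move=> mf; apply: measurable_sum => s; apply: measurable_funM => //.
by apply: (measurable_chainsg _ (f := fun i => f (s i))).
Qed.

Lemma eps_perm x (t : 'S_n) : eps (fun i => x (t i)) = (-1) ^+ t * eps x.
Proof.
rewrite /eps mulr_sumr (reindex_inj (mulIg t^-1)%g).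
apply: eq_bigr => s _; rewrite odd_permM odd_permV signr_addb mulrA.
rewrite (mulrC ((-1) ^+ t)); congr (_ * chainsg _ 0).
by apply: eq_map => i; rewrite permM permKV.
Qed.

Lemma eps_sign x (e : 'I_n -> R) : (forall i, e i ^+ 2 = 1) ->
  eps (fun i => e i * x i) = (\prod_i e i) * eps x.
Proof.
move=> He; rewrite /eps mulr_sumr; apply: eq_bigr => s _.
rewrite (chainsg_sign (e := fun i => e (s i)) (fun i => x (s i)))//.
rewrite big_rev big_enum/= mulrCA; congr (_ * _).
by rewrite [in RHS](reindex_inj (@perm_inj _ s)).
Qed.

(** Exchanging the two equal coordinates fixes x and changes the sign of eps. *)
Lemma eps_collision x i j : i != j -> x i = x j -> eps x = 0.
Proof.
move=> ij xij; have := eps_perm x (tperm i j).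
rewrite odd_tperm ij expr1 mulN1r (_ : (fun _ => _) = x); first lra.
by apply/funext => k; case: tpermP => [->|->|].
Qed.

Lemma eps_zero x i : x i = 0 -> eps x = 0.
Proof.
move=> xi; pose e j : R := if j == i then -1 else 1.
have : eps (fun j => e j * x j) = - eps x.
  rewrite eps_sign => [|j]; last by rewrite /e; case: eqP; rewrite ?sqrrN expr1n.
  rewrite (bigD1 i)//= {1}/e eqxx big1 ?mulr1 ?mulN1r// => j.
  by rewrite /e => /negbTE ->.
rewrite (_ : (fun _ => _) = x); first lra.
by apply/funext => j; rewrite /e; case: eqP => [->|_]; rewrite ?xi ?mulr0 ?mul1r.
Qed.

(** For a permutation other than the identity, the values taken in the order of
the list do not increase. *)
Lemma eps_chamber x : (forall i j : 'I_n, (i < j)%N -> x j < x i) ->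
  (forall i, 0 < x i) -> eps x = 1.
Proof.
move=> xd x0; pose r : rel 'I_n := fun i j => x i < x j.
have rT : transitive r by move=> a b c; exact: lt_trans.
have rI : irreflexive r by move=> a; rewrite /r ltxx.
have sorted_r : sorted r (rev (enum 'I_n)).
  rewrite rev_sorted; have : sorted ltn (map val (enum 'I_n)).
    by rewrite val_enum_ord iota_ltn_sorted.
  by rewrite sorted_map; apply: sub_sorted => i j /=; exact: xd.
have pathE (s : seq 'I_n) : path <%R 0 (map Num.norm (map x s)) = sorted r s.
  case: s => [//|a s] /=; rewrite normr_gt0 lt0r_neq0//=.
  by elim: s a => //= b s IHs a; rewrite IHs !gtr0_norm.
rewrite /eps (bigD1 1%g)//= odd_perm1 expr0 mul1r [X in _ + X]big1 => [|s s1].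
  rewrite addr0 chainsg_path//.
  have := pathE (rev (enum 'I_n)); rewrite sorted_r -map_comp.
  rewrite (_ : [seq (Num.norm \o x) i | i <- _] =
    [seq x ((1%g : 'S_n) i) | i <- rev (enum 'I_n)]) => [->//|].
  by apply: eq_map => i /=; rewrite perm1 gtr0_norm.
apply/eqP; rewrite mulf_eq0 signr_eq0 /=; apply/negPn/negP.
move=> /chainsg_neq0; rewrite (map_comp x s) pathE => ss.
have es : [seq s i | i <- rev (enum 'I_n)] = rev (enum 'I_n).
  apply: (irr_sorted_eq rT rI) => // i; rewrite mem_rev mem_enum.
  by apply/mapP; exists (s^-1%g i); rewrite ?permKV// mem_rev mem_enum.
move: s1 => /eqP; apply; apply/permP => i; rewrite perm1.
have : i \in rev (enum 'I_n) by rewrite mem_rev mem_enum.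
by move/nthP => /(_ i) [k kn <-]; rewrite -[in RHS]es (nth_map i).
Qed.

End eps.

(** * Gaussian averages near a wall *)

Definition upd (R : realType) (n : nat) (x : 'I_n -> R) (i : 'I_n) (a : R) :
  'I_n -> R := fun k => if k == i then a else x k.

Lemma eps_upd_opp (R : realType) (n : nat) (x : 'I_n -> R) i a :
  eps (upd x i (- a)) = - eps (upd x i a).
Proof.
pose e j : R := if j == i then -1 else 1.
have := @eps_sign _ _ (upd x i a) e.
rewrite (_ : (fun _ => _) = upd x i (- a)) => [->|].
- rewrite (bigD1 i)//= {1}/e eqxx big1 ?mulr1 ?mulN1r// => j.
  by rewrite /e => /negbTE ->.
- by move=> j; rewrite /e; case: eqP; rewrite ?sqrrN expr1n.
- by apply/funext => j; rewrite /e /upd; case: eqP => _; rewrite ?mulN1r ?mul1r.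
Qed.

Lemma eps_upd_swap (R : realType) (n : nat) (x : 'I_n -> R) i j a b : i != j ->
  eps (upd (upd x j a) i b) = - eps (upd (upd x j b) i a).
Proof.
move=> ij; have := eps_perm (upd (upd x j b) i a) (tperm i j).
rewrite odd_tperm ij expr1 mulN1r => <-; congr eps; apply/funext => k.
rewrite /upd; case: tpermP => [->|->|].
- by rewrite eqxx eq_sym (negbTE ij) eqxx.
- by rewrite eq_sym (negbTE ij) !eqxx.
- by move=> /eqP/negbTE -> /eqP/negbTE ->.
Qed.

Lemma measurable_upd d (T : measurableType d) (R : realType) (n : nat)
    (x : 'I_n -> T -> R) i (a : T -> R) :
  (forall k, k != i -> measurable_fun setT (x k)) -> measurable_fun setT a ->
  forall k, measurable_fun setT (fun w => upd (fun k => x k w) i (a w) k).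
Proof. by move=> mx ma k; rewrite /upd; case: eqVneq => // /mx. Qed.

Lemma eq_opp0 (R : realType) (z : R) : z = - z -> z = 0.
Proof. lra. Qed.

(** The pair (i, i) stands for the wall x_i = 0, and (i, j) with i < j for the
wall x_i = x_j. *)
Definition gap (R : realType) (n : nat) (p : 'I_n * 'I_n) (x : 'I_n -> R) : R :=
  if p.1 == p.2 then x p.1 else x p.1 - x p.2.

Section gaussian_average.
Context (R : realType) (n : nat).
Variables (s delta : R).
Hypotheses (s0 : 0 < s) (d0 : 0 < delta) (ds : delta ^+ 2 <= s ^+ 2 / 2).
Local Notation C := (n`!%:R * (delta * (2^-1 + s ^- 2))).
Local Notation N := (normal_prob 0 s).
Implicit Types x : 'I_n -> R.

Let normal_integrable (f : R -> R) M : measurable_fun setT f ->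
  (forall u, `|f u| <= M) -> N.-integrable setT (EFin \o f).
Proof. exact: (@bounded_integrable _ (measurableTypeR R) R N f M). Qed.

Let normal_norm_le (f : R -> R) M : measurable_fun setT f ->
  (forall u, `|f u| <= M) -> `|\int[N]_u f u| <= M.
Proof. exact: (@Rintegral_norm_le _ (measurableTypeR R) R N f M). Qed.

Let measurable_addl (a : R) : measurable_fun setT (fun u : R => a + u).
Proof. by apply: measurable_funD => //; exact: measurable_cst. Qed.

Let measurable_eps_upd x i : measurable_fun setT (fun u => eps (upd x i u)).
Proof.
apply: (measurable_eps (f := fun k u => upd x i u k)).
by apply: (measurable_upd (x := fun k u => x k)).
Qed.

(** Centred on the wall the average vanishes, by the symmetry u -> - u; moving
the centre by delta changes it by at most C. *)
Lemma average_zero_wall x i a : `|a| <= delta ->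
  `|\int[N]_u eps (upd x i (a + u))| <= C.
Proof.
move=> ad; set g := fun u => eps (upd x i u).
have mg : measurable_fun setT g by exact: measurable_eps_upd.
have gM u : `|g u| <= n`!%:R by exact: eps_bound.
have g0 : \int[N]_u g u = 0.
  have := Rintegral_normal_opp s0 mg gM.
  rewrite /g; under eq_Rintegral do rewrite eps_upd_opp -mulN1r.
  rewrite RintegralZl//; first by rewrite mulN1r => /esym; exact: eq_opp0.
  exact: normal_integrable mg gM.
rewrite (Rintegral_normal_shift s0 a mg gM) -[X in `|X|]subr0 -[X in _ - X]g0.
by apply: normal_dist_lin => //; rewrite subr0.
Qed.

(** As for a coordinate wall, the reflection being the exchange of the two
coordinates: with equal centres, exchanging u and v changes the sign. *)
Lemma average_pair_wall x i j a b : i != j -> `|a - b| <= delta ->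
  `|\int[N]_u \int[N]_v eps (upd (upd x j (b + v)) i (a + u))| <= C.
Proof.
move=> ij ab.
have mH c : measurable_fun setT (fun z : R * R =>
    eps (upd (upd x j (b + z.2)) i (c + z.1))).
  apply: (measurable_eps (f := fun k (z : R * R) =>
    upd (upd x j (b + z.2)) i (c + z.1) k)).
  apply: (measurable_upd (x := fun k (z : R * R) => upd x j (b + z.2) k)).
    move=> k _; apply: (measurable_upd (x := fun k z => x k)) => //.
    by apply: measurable_funD => //; exact: measurable_cst.
  by apply: measurable_funD => //; exact: measurable_cst.
have HM c z : `|eps (upd (upd x j (b + z.2)) i (c + z.1))| <= n`!%:R.
  exact: eps_bound.
set g := fun u => \int[N]_v eps (upd (upd x j (b + v)) i u).
have mg : measurable_fun setT g.
  have := @measurable_fun_Rintegral_snd _ _ (measurableTypeR R)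
    (measurableTypeR R) R N _ _ (mH 0) (HM 0).
  by under eq_fun do under eq_Rintegral do rewrite /= add0r.
have mgu u : measurable_fun setT (fun v => eps (upd (upd x j (b + v)) i u)).
  apply: (measurable_eps (f := fun k v => upd (upd x j (b + v)) i u k)).
  apply: (measurable_upd (x := fun k v => upd x j (b + v) k)) => //.
  move=> k _; apply: (measurable_upd (x := fun k v => x k)) => //.
have gM u : `|g u| <= n`!%:R.
  exact: (normal_norm_le (mgu u) (fun v => eps_bound _)).
have g0 : \int[N]_u g (b + u) = 0.
  have sw : \int[N]_u g (b + u) =
      \int[N]_v \int[N]_u eps (upd (upd x j (b + v)) i (b + u)).
    exact: (@Rintegral_swap _ _ (measurableTypeR R) (measurableTypeR R) R N _ _
      (mH b) (HM b) N).
  have eN : \int[N]_v \int[N]_u eps (upd (upd x j (b + v)) i (b + u)) =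
      - \int[N]_u g (b + u).
    transitivity (\int[N]_v (-1 * g (b + v))).
      apply: eq_Rintegral => v _.
      have iK : N.-integrable setT
          (EFin \o (fun u => eps (upd (upd x j (b + u)) i (b + v)))).
        exact: (normal_integrable (mgu (b + v)) (fun u => eps_bound _)).
      rewrite -[RHS](RintegralZl _ measurableT iK).
      by apply: eq_Rintegral => u _; rewrite mulN1r -eps_upd_swap.
    have ig : N.-integrable setT (EFin \o (fun v => g (b + v))).
      have mgb := measurableT_comp mg (measurable_addl b).
      exact: (normal_integrable mgb (fun u => gM _)).
    by rewrite (RintegralZl _ measurableT ig) mulN1r.
  exact: eq_opp0 (etrans sw eN).
rewrite (Rintegral_normal_shift s0 a mg gM) -[X in `|X|]subr0 -[X in _ - X]g0.
by rewrite (Rintegral_normal_shift s0 b mg gM); apply: normal_dist_lin.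
Qed.

End gaussian_average.

Lemma Rintegral_le_indic d (T : measurableType d) (R : realType)
    (P : probability T R) (A : set T) (f : T -> R) (C : R) :
  measurable A -> measurable_fun setT f -> (forall w, `|f w| <= C * \1_A w) ->
  `|\int[P]_w f w| <= C * fine (P A).
Proof.
move=> mA mf fC.
have mi : measurable_fun setT (\1_A : T -> R) by exact: measurable_indic.
have norm_indic1 w : `|\1_A w| <= 1 :> R.
  by rewrite indicE; case: (_ \in _); rewrite ?normr1 ?normr0.
have ii := bounded_integrable P mi norm_indic1.
have iC : P.-integrable setT (EFin \o (fun w => C * \1_A w)).
  have mC : measurable_fun setT (fun w => C * \1_A w).
    by apply: measurable_funM => //; exact: measurable_cst.
  apply: (bounded_integrable P mC (M := `|C|)) => w.
  by rewrite normrM -[leRHS]mulr1 ler_wpM2l.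
have ifn : P.-integrable setT (EFin \o f).
  apply: (le_integrable measurableT _ _ iC); first exact/measurable_EFinP.
  by move=> w _; rewrite /= lee_fin (le_trans (fC w))// ler_norm.
apply: le_trans (le_normr_Rintegral measurableT ifn) _.
have -> : C * fine (P A) = \int[P]_w (C * \1_A w).
  rewrite (RintegralZl _ measurableT ii); congr (_ * _).
  by rewrite /Rintegral integral_indic// setIT.
apply: le_Rintegral => //; exact: integrable_norm ifn.
Qed.

Section wall_estimate.
Context (d : measure_display) (Omega : measurableType d)
    (R : realType) (P : probability Omega R) (n : nat).
Variables (eta : 'rV[R]_n) (X : 'I_n -> R -> {RV P >-> R}).
Hypothesis hX : brownian_motion X eta.
Variables (q : nat -> R) (k : nat) (t delta : R) (A : set Omega).
Hypotheses (q0 : q 0%N = 0) (ndq : nondecreasing_seq q) (qt : q k < t).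
Hypotheses (d0 : 0 < delta) (dt : delta ^+ 2 <= (t - q k) / 2).
Hypothesis pastA : forall j, <<s past X q k j >> A.

Let tq0 : 0 <= t - q k. Proof. by rewrite subr_ge0 ltW. Qed.
Let s0 : 0 < Num.sqrt (t - q k). Proof. by rewrite sqrtr_gt0 subr_gt0. Qed.
Let ds : delta ^+ 2 <= (Num.sqrt (t - q k)) ^+ 2 / 2.
Proof. by rewrite sqr_sqrtr. Qed.
Let t0 : 0 <= t.
Proof. by apply: le_trans (ltW qt); rewrite -q0; exact: ndq. Qed.

Local Notation N := (normal_prob 0 (Num.sqrt (t - q k))).
Local Notation G := (fun j => g_sigma_algebraType (past X q k j)).
Let C : R := n`!%:R * (delta * (2^-1 + (t - q k)^-1)).

Let CE : n`!%:R * (delta * (2^-1 + (Num.sqrt (t - q k)) ^- 2)) = C.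
Proof. by rewrite sqr_sqrtr. Qed.

Let mA j : measurable_fun setT (\1_A : G j -> R).
Proof. by apply: measurable_indic; exact: pastA. Qed.

Let measurableA (j : 'I_n) : measurable A.
Proof. by apply: (sigma_sub_measurable _ (@pastA j)); exact: past_sub. Qed.

Let norm_indic1 w : `|\1_A w| <= 1 :> R.
Proof. by rewrite indicE; case: (_ \in _); rewrite ?normr1 ?normr0. Qed.

(** On the past event A the j-th coordinate is within delta of 0 at time q k.
Resampling its increment between q k and t leaves a Gaussian average near the
wall. *)
Lemma zero_wall_estimate j : (forall w, A w -> `|X j (q k) w| <= delta) ->
  `|\int[P]_w (\1_A w * eps (fun i => X i t w))| <= C * fine (P A).
Proof.
move=> Aj; pose Y w i := X i t w.
pose H (z : G j * R) := \1_A z.1 * eps (upd (Y z.1) j (X j (q k) z.1 + z.2)).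
have mH : measurable_fun setT H.
  apply: measurable_funM; first exact: measurableT_comp (@mA j) measurable_fst.
  apply: (measurable_eps (f := fun i (z : G j * R) =>
    upd (Y z.1) j (X j (q k) z.1 + z.2) i)).
  apply: (measurable_upd (x := fun i (z : G j * R) => Y z.1 i)).
    move=> i ij; apply: (measurableT_comp (@past_other _ _ _ _ _ X q k _ _ _ ij t0)).
    exact: measurable_fst.
  apply: measurable_funD => //.
  exact: measurableT_comp (@past_self _ _ _ _ _ X q k _ k (leqnn k)) measurable_fst.
have HM z : `|H z| <= n`!%:R.
  by rewrite normrM -[leRHS]mul1r; apply: ler_pM => //; exact: eps_bound.
have -> : \int[P]_w (\1_A w * eps (fun i => X i t w)) =
    \int[P]_w H (w, X j t w - X j (q k) w).
  apply: eq_Rintegral => w _; rewrite /H /=; congr (_ * eps _).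
  by apply/funext => i; rewrite /upd /Y; case: eqP => [->|//]; rewrite addrC subrK.
rewrite (resample hX q0 ndq qt mH HM).
have mF := measurable_fun_Rintegral_snd N mH HM.
apply: (@Rintegral_le_indic _ _ _ P A (fun w => \int[N]_u H (w, u)) C (@measurableA j)).
  exact: (measurableT_comp mF (sigma_id (@past_sub _ _ _ _ _ X q k j))).
move=> w; rewrite /H /= indicE; case: (boolP (w \in A)) => wA.
  under eq_Rintegral do rewrite mul1r.
  rewrite mulr1 -CE; apply: average_zero_wall => //.
  by apply: Aj; exact: set_mem wA.
under eq_Rintegral do rewrite mul0r.
by rewrite mulr0 (Rintegral_cst N measurableT) mul0r normr0.
Qed.

(** Both increments are resampled, first that of j and then that of i; for the
second, the first fresh variable is a parameter. *)
Lemma pair_wall_estimate i j : i != j ->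
  (forall w, A w -> `|X i (q k) w - X j (q k) w| <= delta) ->
  `|\int[P]_w (\1_A w * eps (fun i => X i t w))| <= C * fine (P A).
Proof.
move=> ij Aj; pose Y w i := X i t w; have ji : j != i by rewrite eq_sym.
pose H (z : G j * R) := \1_A z.1 * eps (upd (Y z.1) j (X j (q k) z.1 + z.2)).
have mH : measurable_fun setT H.
  apply: measurable_funM; first exact: measurableT_comp (@mA j) measurable_fst.
  apply: (measurable_eps (f := fun i (z : G j * R) =>
    upd (Y z.1) j (X j (q k) z.1 + z.2) i)).
  apply: (measurable_upd (x := fun i (z : G j * R) => Y z.1 i)).
    move=> l lj; apply: (measurableT_comp (@past_other _ _ _ _ _ X q k _ _ _ lj t0)).
    exact: measurable_fst.
  apply: measurable_funD => //.
  exact: measurableT_comp (@past_self _ _ _ _ _ X q k _ k (leqnn k)) measurable_fst.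
have HM z : `|H z| <= n`!%:R.
  by rewrite normrM -[leRHS]mul1r; apply: ler_pM => //; exact: eps_bound.
have -> : \int[P]_w (\1_A w * eps (fun i => X i t w)) =
    \int[P]_w H (w, X j t w - X j (q k) w).
  apply: eq_Rintegral => w _; rewrite /H /=; congr (_ * eps _).
  by apply/funext => l; rewrite /upd /Y; case: eqP => [->|//]; rewrite addrC subrK.
rewrite (resample hX q0 ndq qt mH HM).
pose K (z : (G i * R) * R) := \1_A z.1.1 * eps (upd (upd (Y z.1.1) j
  (X j (q k) z.1.1 + z.2)) i (X i (q k) z.1.1 + z.1.2)).
have mK : measurable_fun setT K.
  have m11 : measurable_fun setT (fun z : (G i * R) * R => z.1.1).
    exact: measurableT_comp measurable_fst measurable_fst.
  apply: measurable_funM; first exact: measurableT_comp (@mA i) m11.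
  apply: (measurable_eps (f := fun l (z : (G i * R) * R) =>
    upd (upd (Y z.1.1) j
      (X j (q k) z.1.1 + z.2)) i (X i (q k) z.1.1 + z.1.2) l)).
  apply: (measurable_upd (x := fun l (z : (G i * R) * R) =>
      upd (Y z.1.1) j (X j (q k) z.1.1 + z.2) l)).
    move=> l li; rewrite /upd; case: (l == j).
      apply: measurable_funD => //.
      apply: (measurableT_comp (@past_other _ _ _ _ _ X q k _ _ _ ji _) m11).
      by rewrite -q0; exact: ndq.
    exact: (measurableT_comp (@past_other _ _ _ _ _ X q k _ _ _ li t0) m11).
  apply: measurable_funD.
    exact: measurableT_comp (@past_self _ _ _ _ _ X q k _ k (leqnn k)) m11.
  exact: measurableT_comp measurable_snd measurable_fst.
have KM z : `|K z| <= n`!%:R.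
  by rewrite normrM -[leRHS]mul1r; apply: ler_pM => //; exact: eps_bound.
have mF := measurable_fun_Rintegral_snd N mK KM.
have FM z : `|\int[N]_v K (z, v)| <= n`!%:R.
  apply: (@Rintegral_norm_le _ (measurableTypeR R) R N) => [|v].
    exact: (measurableT_comp mK (pair1_measurable z)).
  exact: KM.
have -> : \int[P]_w \int[N]_v H (w, v) =
    \int[P]_w \int[N]_v K ((w, X i t w - X i (q k) w), v).
  apply: eq_Rintegral => w _; apply: eq_Rintegral => v _.
  rewrite /H /K /=; congr (_ * eps _).
  apply/funext => l; rewrite /upd /Y; case: (eqVneq l i) => [->|//].
  by rewrite (negbTE ij) addrC subrK.
rewrite (resample hX q0 ndq qt mF FM).
have mFF := measurable_fun_Rintegral_snd N mF FM.
apply: (@Rintegral_le_indic _ _ _ P A (fun w => \int[N]_u \int[N]_v K ((w, u), v)) C (@measurableA j)).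
  exact: (measurableT_comp mFF (sigma_id (@past_sub _ _ _ _ _ X q k i))).
move=> w; rewrite /K /= indicE; case: (boolP (w \in A)) => wA.
  under eq_Rintegral do under eq_Rintegral do rewrite mul1r.
  rewrite mulr1 -CE; apply: average_pair_wall => //.
  by apply: Aj; exact: set_mem wA.
under eq_Rintegral do under eq_Rintegral do rewrite mul0r.
under eq_Rintegral do rewrite (Rintegral_cst N measurableT) mul0r.
by rewrite mulr0 (Rintegral_cst N measurableT) mul0r normr0.
Qed.

End wall_estimate.

(** * The reflection principle on a time grid *)

Section restricted_mean.
Context d (T : measurableType d) (R : realType) (P : probability T R).

Definition mean_on (f : T -> R) (A : set T) : R := \int[P]_w (\1_A w * f w).

Lemma mean_on1 A : measurable A -> mean_on (cst 1) A = fine (P A).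
Proof.
move=> mA; rewrite /mean_on; under eq_Rintegral do rewrite mulr1.
by rewrite /Rintegral integral_indic// setIT.
Qed.

Variables (f : T -> R) (M : R).
Hypotheses (mf : measurable_fun setT f) (fM : forall w, `|f w| <= M).

Lemma measurable_indicM A : measurable A ->
  measurable_fun setT (fun w => \1_A w * f w).
Proof. by move=> mA; apply: measurable_funM => //; exact: measurable_indic. Qed.

Lemma indicM_le A w : `|\1_A w * f w| <= M.
Proof.
rewrite normrM -[leRHS]mul1r; apply: ler_pM => //.
by rewrite indicE; case: (_ \in _); rewrite ?normr1 ?normr0.
Qed.

Lemma integrable_indicM A : measurable A ->
  P.-integrable setT (EFin \o (fun w => \1_A w * f w)).
Proof. by move=> mA; exact: bounded_integrable (measurable_indicM mA) (indicM_le A). Qed.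

Lemma mean_onU A B : measurable A -> measurable B -> A `&` B = set0 ->
  mean_on f (A `|` B) = mean_on f A + mean_on f B.
Proof.
move=> mA mB AB.
rewrite -(RintegralD measurableT (integrable_indicM mA) (integrable_indicM mB)).
apply: eq_Rintegral => w _; rewrite -mulrDl; congr (_ * _).
rewrite !indicE in_setU; case: (boolP (w \in A)) => wA; last by rewrite add0r.
suff -> : (w \in B) = false by rewrite addr0.
apply/negP => /set_mem wB; have : (A `&` B) w by split=> //; exact: set_mem.
by rewrite AB.
Qed.

Lemma le_mean_on (g : T -> R) (M' : R) A : measurable A ->
  measurable_fun setT g -> (forall w, `|g w| <= M') ->
  (forall w, A w -> f w <= g w) -> mean_on f A <= mean_on g A.
Proof.
move=> mA mg gM fg.
have ig : P.-integrable setT (EFin \o (fun w => \1_A w * g w)).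
  apply: (@bounded_integrable _ _ _ P _ M').
    by apply: measurable_funM => //; exact: measurable_indic.
  move=> w; rewrite normrM -[leRHS]mul1r; apply: ler_pM => //.
  by rewrite indicE; case: (_ \in _); rewrite ?normr1 ?normr0.
apply: le_Rintegral => //; first exact: integrable_indicM.
move=> w _; rewrite indicE; case: (boolP (w \in A)) => wA; rewrite ?mul0r//.
by rewrite !mul1r; exact/fg/set_mem.
Qed.

Lemma mean_on_setT : mean_on f setT = \int[P]_w f w.
Proof. by apply: eq_Rintegral => w _; rewrite indicT mul1r. Qed.

End restricted_mean.

Lemma split_increment_le (R : realType) (g x y a b c e f u : R) :
  `|x| <= a -> `|y| <= f -> 0 <= e -> 0 <= b ->
  `|g + (x + y) - g| <= c + (a + b) + (u + (e + f)) - (c + u).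
Proof. by rewrite !ler_norml => /andP[? ?] /andP[? ?] ? ?; apply/andP; split; lra. Qed.

Section grid.
Context (d : measure_display) (Omega : measurableType d)
    (R : realType) (P : probability Omega R) (n : nat).
Variables (eta : 'rV[R]_n) (X : 'I_n -> R -> {RV P >-> R}).
Hypotheses (hX : brownian_motion X eta) (heta : chamberB eta).
Variables (q : nat -> R) (K : nat) (s t delta : R).
Hypotheses (q0 : q 0%N = 0) (ndq : nondecreasing_seq q).
Hypotheses (qs : forall k, q k <= s) (st : s < t).
Hypotheses (d0 : 0 < delta) (dt : delta ^+ 2 <= (t - s) / 2).

Definition clear (k : nat) (p : 'I_n * 'I_n) : set Omega :=
  [set w | delta < gap p (fun i => X i (q k) w)].

(** Exploring the grid time after time and, at each time, pair after pair: l
lists the pairs that have been inspected at the current time k, and no small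
gap has been met so far. *)
Definition stays (k : nat) (l : seq ('I_n * 'I_n)) : set Omega :=
  (\bigcap_(m in [set m | (m < k)%N])
     \bigcap_(p in [set p : 'I_n * 'I_n | (p.1 <= p.2)%N]) clear m p) `&`
  \bigcap_(p in [set p | p \in l]) clear k p.

(** Outside this event a gap cannot pass below - delta without having been
within delta of its wall at a grid time. *)
Definition jumps : set Omega :=
  \bigcup_(m in [set m | (m < K)%N]) \bigcup_i
    [set w | delta < `|X i (q m.+1) w - X i (q m) w|].

Let C : R := n`!%:R * (delta * (2^-1 + (t - s)^-1)).
Let F w := eps (fun i => X i t w).

Let C0 : 0 <= C.
Proof. by rewrite !mulr_ge0 ?addr_ge0 ?invr_ge0 ?subr_ge0// ltW. Qed.

Let q_ge0 k : 0 <= q k.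
Proof. by rewrite -q0; exact: ndq. Qed.

Let qt k : q k < t. Proof. exact: le_lt_trans (qs k) st. Qed.

Lemma measurable_past i j k m : (m <= k)%N ->
  measurable_fun setT (X i (q m) : g_sigma_algebraType (past X q k j) -> R).
Proof.
move=> mk; case: (eqVneq i j) => [->|ij]; first exact: past_self.
exact: past_other.
Qed.

Lemma measurable_gap j k m p : (m <= k)%N ->
  measurable_fun setT ((fun w => gap p (fun i => X i (q m) w)) :
    g_sigma_algebraType (past X q k j) -> R).
Proof.
move=> mk; rewrite /gap; case: (p.1 == p.2); first exact: measurable_past.
by apply: measurable_funB; exact: measurable_past.
Qed.

Lemma clear_past j k m p : (m <= k)%N -> <<s past X q k j >> (clear m p).
Proof.
move=> mk; have := @measurable_gap j k m p mk measurableT `]delta, +oo[%classic.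
rewrite setTI => /(_ (measurable_itv _)); congr (<<s _ >> _).
by apply/seteqP; split=> w /=; rewrite /clear /= in_itv/= andbT.
Qed.

Lemma stays_past j k l : <<s past X q k j >> (stays k l).
Proof.
apply: (@measurableI _ (g_sigma_algebraType (past X q k j))).
  apply: fin_bigcap_measurable; first exact: finite_II.
  move=> m mk; apply: fin_bigcap_measurable; first exact: finite_finset.
  by move=> p _; apply: clear_past; exact: ltnW.
apply: fin_bigcap_measurable; first exact: finite_finset.
by move=> p _; exact: clear_past.
Qed.

Lemma measurable_clear k p : measurable (clear k p).
Proof. exact: (sigma_sub_measurable (@past_sub _ _ _ _ _ X q k p.1) (@clear_past p.1 k k p (leqnn k))). Qed.

Lemma measurable_stays k l : measurable (stays k l).
Proof.
apply: measurableI.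
  apply: fin_bigcap_measurable; first exact: finite_II.
  move=> m mk; apply: fin_bigcap_measurable; first exact: finite_finset.
  by move=> p _; exact: measurable_clear.
apply: fin_bigcap_measurable; first exact: finite_finset.
by move=> p _; exact: measurable_clear.
Qed.

Lemma measurable_jumps : measurable jumps.
Proof.
apply: fin_bigcup_measurable; first exact: finite_II.
move=> m _; apply: fin_bigcup_measurable; first exact: finite_finset.
move=> i _; rewrite -[X in measurable X]setTI.
have mf : measurable_fun setT (fun w => `|X i (q m.+1) w - X i (q m) w|).
  by apply: measurableT_comp => //; exact: measurable_funB.
have := mf measurableT `]delta, +oo[%classic (measurable_itv _).
by congr measurable; apply/seteqP; split=> w /=; rewrite in_itv/= andbT.
Qed.

Lemma opposite_sides_far (a b : R) : delta < a -> b < - delta -> delta < `|b - a|.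
Proof. by move=> da bd; rewrite distrC; apply: lt_le_trans (ler_norm _); have := d0; lra. Qed.

Lemma opposite_gaps_far (a1 a2 b1 b2 : R) : delta < a1 - a2 -> b1 - b2 < - delta ->
  `|b1 - a1| <= delta -> `|b2 - a2| <= delta -> False.
Proof. by move=> ? ?; rewrite !ler_norml => /andP[? ?] /andP[? ?]; have := d0; lra. Qed.

Lemma gap_jump k (p : 'I_n * 'I_n) w : (k < K)%N -> clear k p w ->
  gap p (fun i => X i (q k.+1) w) < - delta -> jumps w.
Proof.
move=> kK; rewrite /clear /gap /=; case: eqP => [_|_] c1 c2.
  by exists k => //; exists p.1 => //=; exact: opposite_sides_far.
case: (ltP delta `|X p.1 (q k.+1) w - X p.1 (q k) w|) => j1.
  by exists k => //; exists p.1.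
case: (ltP delta `|X p.2 (q k.+1) w - X p.2 (q k) w|) => j2.
  by exists k => //; exists p.2.
by have := opposite_gaps_far c1 c2 j1 j2.
Qed.

(** At time 0 the gaps are positive because the starting point is in the
chamber; later on, the gap was above delta one step before. *)
Lemma undershoot_jump k l (p : 'I_n * 'I_n) w : (k <= K)%N -> (p.1 <= p.2)%N ->
  stays k l w -> gap p (fun i => X i (q k) w) < - delta -> jumps w.
Proof.
case: k => [|k] kK pp [sk _] gp; last first.
  by apply: (gap_jump kK _ gp); exact: sk k (ltnSn k) p pp.
exfalso; have [bmX _] := hX; have [eta1 eta2] := heta.
have X0 i : X i (q 0%N) w = eta 0 i by rewrite q0; have [-> _ _ _] := bmX i.
move: gp; rewrite /gap !X0; case: eqP => [_|/eqP p12].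
  by have := eta2 p.1; have := d0; lra.
by have := eta1 p.1 p.2; rewrite ltn_neqAle pp andbT => /(_ p12); have := d0; lra.
Qed.

Let M := n`!%:R : R.
Let one_j : Omega -> R := \1_jumps.

Let mF : measurable_fun setT F.
Proof. by apply: (measurable_eps (f := fun i w => X i t w)) => i. Qed.
Let FM w : `|F w| <= M. Proof. exact: eps_bound. Qed.
Let mJ : measurable_fun setT one_j.
Proof. by apply: measurable_indic; exact: measurable_jumps. Qed.
Let JM w : `|one_j w| <= 1.
Proof. by rewrite /one_j indicE; case: (_ \in _); rewrite ?normr1 ?normr0. Qed.
Let m1 : measurable_fun setT (cst 1 : Omega -> R).
Proof. exact: measurable_cst. Qed.
Let M1 w : `|(cst 1 : Omega -> R) w| <= 1. Proof. by rewrite normr1. Qed.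

(** The cost of stopping the exploration on A: C for a wall that is close, M
for a wall that has been jumped over.  It is additive in A, so that the costs of
successive steps telescope. *)
Let Phi A := C * mean_on P (cst 1) A + M * mean_on P one_j A.

Lemma stays_cons k l p : stays k (p :: l) = stays k l `&` clear k p.
Proof.
apply/seteqP; split=> w.
  move=> [h1 h2]; split; last by apply: h2; rewrite /= mem_head.
  by split => // r rl; apply: h2; rewrite /= inE rl orbT.
move=> [[h1 h2] h3]; split => // r /=; rewrite inE => /orP[/eqP -> //|].
exact: h2.
Qed.

(** Where the exploration stops at p, the gap is either within delta of its
wall, and averaging leaves at most C times the probability, or below - delta,
and the path has jumped. *)
Lemma clear_step k l (p : 'I_n * 'I_n) : (k <= K)%N -> (p.1 <= p.2)%N ->
  `|mean_on P F (stays k l) - mean_on P F (stays k (p :: l))| <=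
  Phi (stays k l) - Phi (stays k (p :: l)).
Proof.
move=> kK pp; set G := stays k l; set G' := stays k (p :: l).
pose g : Omega -> R := fun w => gap p (fun i => X i (q k) w).
pose A1 := G `&` (g @^-1` `[(- delta), delta]%classic).
pose A2 := G `&` (g @^-1` `]-oo, (- delta)[%classic).
have mg j : measurable_fun setT (g : g_sigma_algebraType (past X q k j) -> R).
  exact: measurable_gap.
have Gpast (Q : interval R) j : <<s past X q k j >> (G `&` g @^-1` [set` Q]).
  apply: (@measurableI _ (g_sigma_algebraType (past X q k j))).
    exact: stays_past.
  by rewrite -[_ @^-1` _]setTI; apply: mg => //; exact: measurable_itv.
have mGQ (Q : interval R) : measurable (G `&` g @^-1` [set` Q]).
  exact: (sigma_sub_measurable (@past_sub _ _ _ _ _ X q k p.1) (Gpast Q p.1)).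
have A1past : forall j, <<s past X q k j >> A1 by exact: Gpast.
have mA1 : measurable A1 by exact: mGQ.
have mA2 : measurable A2 by exact: mGQ.
have mG' : measurable G' by exact: measurable_stays.
have GE : G = G' `|` (A1 `|` A2).
  rewrite /G' stays_cons; apply/seteqP; split=> w; last by move=> [[]|[[]|[]]].
  move=> Gw; case: (ltP delta (g w)) => gd; first by left.
  right; case: (ltP (g w) (- delta)) => gd'; [right|left]; split => //=.
    by rewrite in_itv /= gd'.
have dis12 : A1 `&` A2 = set0.
  apply/seteqP; split=> w // [[_ /=]]; rewrite in_itv/= => /andP[g1 _].
  by move=> [_ /=]; rewrite in_itv/= ltNge g1.
have disG : G' `&` (A1 `|` A2) = set0.
  rewrite /G' stays_cons; apply/seteqP; split=> w // [[_ /= c]].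
  move=> [[_ /=]|[_ /=]]; rewrite in_itv/=.
    by move=> /andP[_]; rewrite leNgt c.
  have Nd : - delta <= delta by have := d0; lra.
  by move=> gd; have := lt_le_trans c (ltW (lt_le_trans gd Nd)); rewrite ltxx.
have split (f : Omega -> R) (N : R) : measurable_fun setT f -> (forall w, `|f w| <= N) ->
    mean_on P f G = mean_on P f G' + (mean_on P f A1 + mean_on P f A2).
  move=> mf fN; rewrite GE (mean_onU P mf fN)//; last exact: measurableU.
  by rewrite (mean_onU P mf fN).
rewrite /Phi (split _ _ mF FM) (split _ _ m1 M1) (split _ _ mJ JM).
have d2 : delta ^+ 2 <= (t - q k) / 2.
  apply: le_trans dt _; rewrite ler_pM2r ?invr_gt0// lerD2l lerN2; exact: qs.
have CC : n`!%:R * (delta * (2^-1 + (t - q k)^-1)) <= C.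
  rewrite ler_wpM2l// ler_pM2l// lerD2l lef_pV2 ?posrE ?subr_gt0//.
  by rewrite lerD2l lerN2; exact: qs.
have h1 : `|mean_on P F A1| <= C * mean_on P (cst 1) A1.
  rewrite mean_on1//.
  apply: (@le_trans _ _ (n`!%:R * (delta * (2^-1 + (t - q k)^-1)) * fine (P A1))).
    case: (eqVneq p.1 p.2) => p12.
      apply: (zero_wall_estimate hX q0 ndq (qt k) d0 d2 A1past (j := p.1)).
      move=> w [_] /=; rewrite in_itv /g /gap p12 eqxx /= => /andP[g1 g2].
      by rewrite ler_norml g1.
    apply: (pair_wall_estimate hX q0 ndq (qt k) d0 d2 A1past p12).
    move=> w [_] /=; rewrite in_itv /g /gap (negbTE p12) /= => /andP[g1 g2].
    by rewrite ler_norml g1.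
  by rewrite ler_wpM2r// fine_ge0.
have h2 : `|mean_on P F A2| <= M * mean_on P one_j A2.
  apply: (@le_trans _ _ (M * fine (P A2))).
    apply: Rintegral_le_indic => //; first exact: measurable_indicM.
    move=> w; have i0 : 0 <= \1_A2 w :> R by rewrite indicE.
    by rewrite normrM (ger0_norm i0) mulrC ler_wpM2r.
  rewrite ler_wpM2l// -mean_on1//; apply: (le_mean_on P m1 M1 _ mJ JM) => //.
  move=> w [Gw /=]; rewrite in_itv/= => gw.
  rewrite /one_j indicE mem_set//; exact: undershoot_jump Gw gw.
have h3 : 0 <= M * mean_on P one_j A1.
  rewrite mulr_ge0// Rintegral_ge0// => w _.
  by rewrite mulr_ge0// /one_j indicE.
have h4 : 0 <= C * mean_on P (cst 1) A2.
  by rewrite mean_on1// mulr_ge0// fine_ge0.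
by rewrite !mulrDr; exact: split_increment_le.
Qed.

Lemma clear_steps k l : (k <= K)%N -> (forall p : 'I_n * 'I_n, p \in l -> (p.1 <= p.2)%N) ->
  `|mean_on P F (stays k [::]) - mean_on P F (stays k l)| <=
  Phi (stays k [::]) - Phi (stays k l).
Proof.
move=> kK; elim: l => [_|p l IHl lp]; first by rewrite !subrr normr0.
apply: le_trans (ler_distD (mean_on P F (stays k l)) _ _) _.
rewrite -[leRHS](subrKA (Phi (stays k l))); apply: lerD.
  by apply: IHl => r rl; apply: lp; rewrite inE rl orbT.
by apply: clear_step => //; apply: lp; rewrite mem_head.
Qed.

Lemma stays_next k :
  stays k [seq p : 'I_n * 'I_n <- enum {: 'I_n * 'I_n} | (p.1 <= p.2)%N] = stays k.+1 [::].
Proof.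
apply/seteqP; split=> w.
  move=> [h1 h2]; split => // m /=; rewrite ltnS leq_eqVlt => /orP[/eqP -> p pp|].
    by apply: h2; rewrite /= mem_filter pp mem_enum.
  exact: h1.
move=> [h1 _]; split => [m /= mk|p /=]; first exact: (h1 m (ltnW mk)).
by rewrite mem_filter => /andP[pp _]; exact: (h1 k (ltnSn k)).
Qed.

Lemma grid_steps k : (k <= K.+1)%N ->
  `|mean_on P F (stays 0 [::]) - mean_on P F (stays k [::])| <=
  Phi (stays 0 [::]) - Phi (stays k [::]).
Proof.
elim: k => [_|k IHk kK]; first by rewrite !subrr normr0.
apply: le_trans (ler_distD (mean_on P F (stays k [::])) _ _) _.
rewrite -[leRHS](subrKA (Phi (stays k [::]))); apply: lerD.
  by apply: IHk; exact: ltnW.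
rewrite -stays_next; apply: clear_steps => // p.
by rewrite mem_filter => /andP[].
Qed.

(** The sum over all steps, whose costs telescope: the bound does not depend on
the number of steps. *)
Lemma grid_estimate :
  `|\int[P]_w eps (fun i => X i t w) -
    mean_on P (fun w => eps (fun i => X i t w)) (stays K.+1 [::])| <=
  n`!%:R * (delta * (2^-1 + (t - s)^-1)) + n`!%:R * fine (P jumps).
Proof.
have s0T : stays 0 [::] = setT.
  by apply/seteqP; split=> w // _; split=> m.
have := grid_steps (leqnn K.+1); rewrite s0T mean_on_setT => h.
apply: le_trans h _; rewrite /Phi mean_on1// mean_on_setT mean_on1; last exact: measurable_stays.
have -> : \int[P]_w one_j w = fine (P jumps).
  by rewrite /Rintegral integral_indic ?setIT//; exact: measurable_jumps.
rewrite [fine (P setT)](_ : _ = 1); last by rewrite [X in fine X](probability_setT P).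
rewrite mulr1 lerBlDr lerDl addr_ge0// mulr_ge0//; first exact: fine_ge0.
by apply: Rintegral_ge0 => w _; rewrite mulr_ge0// /one_j indicE.
Qed.

End grid.

(** * Continuous paths and dyadic grids *)

Section continuous_paths.
Context (R : realType).

Definition half_line_continuous (g : R -> R) : Prop :=
  forall x, 0 <= x -> forall e, 0 < e ->
  exists2 d, 0 < d & forall y, 0 <= y -> `|x - y| < d -> `|g x - g y| < e.

Lemma within_half_line (g : R -> R) :
  {within `[0, +oo[, continuous g} -> half_line_continuous g.
Proof.
move=> /subspace_continuousP cg x x0 e e0.
have /cvgrPdist_lt/(_ e e0) : g @ within `[0, +oo[ (nbhs x) --> g x.
  by apply: cg; rewrite /= in_itv/= x0.
rewrite near_withinE => /nbhs_ballP [d /= d0 H]; exists d => // y y0 xy.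
by apply: H => //; rewrite /= in_itv/= y0.
Qed.

Lemma half_line_continuousB (f g : R -> R) : half_line_continuous f ->
  half_line_continuous g -> half_line_continuous (fun r => f r - g r).
Proof.
move=> cf cg x x0 e e0.
have e20 : 0 < e / 2 by lra.
have [d1 d10 h1] := cf x x0 _ e20; have [d2 d20 h2] := cg x x0 _ e20.
exists (Num.min d1 d2); first by rewrite lt_min d10.
move=> y y0; rewrite lt_min => /andP[y1 y2].
have := h1 y y0 y1; have := h2 y y0 y2.
by rewrite !ltr_norml => /andP[? ?] /andP[? ?]; apply/andP; split; lra.
Qed.

Variables (g : R -> R).
Hypothesis cg : half_line_continuous g.

Lemma half_line_uniform (s e : R) : 0 <= s -> 0 < e ->
  exists2 d, 0 < d & forall x y, 0 <= x <= s -> 0 <= y -> `|x - y| < d ->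
    `|g x - g y| < e.
Proof.
move=> s0 e0.
have /compact_near_coveringP nc := @segment_compact R 0 s.
have : \forall d \near 0^'+, `[0, s]%classic `<=`
    (fun x => forall y, 0 <= x -> 0 <= y -> `|x - y| < d -> `|g x - g y| < e).
  apply: nc => x; rewrite /= in_itv/= => /andP[x0 _].
  have e20 : 0 < e / 2 by lra.
  have [d d0 hd] := cg x0 e20.
  have d20 : 0 < d / 2 by lra.
  near=> x' i => y x'0 y0 x'y.
  have xx' : `|x - x'| < d / 2 by near: x'; exact: nbhsx_ballx.
  have id : i < d / 2 by near: i; exact: nbhs_right_lt.
  have h1 : `|g x - g x'| < e / 2 by apply: hd => //; apply: lt_trans xx' _; lra.
  have h2 : `|g x - g y| < e / 2.
    apply: hd => //; apply: le_lt_trans (ler_distD x' _ _) _.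
    have {}id : `|x' - y| < d / 2 by exact: lt_trans x'y id.
    by rewrite (splitr d) ltrD.
  apply: le_lt_trans (ler_distD (g x) _ _) _; rewrite (distrC (g x')).
  by rewrite (splitr e) ltrD.
move=> nH; near (0 : R)^'+ => d.
exists d; first by near: d; exact: nbhs_right_gt.
move=> x y /andP[x0 xs] y0 xy.
have : (`[0, s]%classic `<=` (fun x => forall y, 0 <= x -> 0 <= y ->
  `|x - y| < d -> `|g x - g y| < e)) by near: d.
by apply => //=; rewrite in_itv/= x0.
Unshelve. all: by end_near. Qed.

Lemma dyadic_small (s e : R) : 0 < e -> exists m0, forall m, (m0 <= m)%N ->
  s / 2 ^+ m < e.
Proof.
move=> e0; exists (Num.bound (s / e)) => m mm.
rewrite ltr_pdivrMr ?exprn_gt0// mulrC -ltr_pdivrMr//.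
case: (lerP 0 (s / e)) => [se|se]; last by apply: lt_trans se _; rewrite exprn_gt0.
apply: lt_le_trans (archi_boundP se) _; rewrite -natrX ler_nat.
by apply: leq_trans mm _; exact: ltnW (ltn_expl _ _).
Qed.

(** Truncating k makes the grid a nondecreasing sequence indexed by all of nat,
as required of q above. *)
Definition dyadic (s : R) (m k : nat) : R := s * (minn k (2 ^ m))%:R / (2 ^ m)%:R.

Lemma dyadicE s m k : (k <= 2 ^ m)%N -> dyadic s m k = s * k%:R / 2 ^+ m.
Proof. by move=> km; rewrite /dyadic (minn_idPl km) natrX. Qed.

Lemma dyadic_le s m k : 0 <= s -> dyadic s m k <= s.
Proof.
move=> s0; rewrite /dyadic -mulrA -[leRHS]mulr1 ler_wpM2l// ler_pdivrMr.
  by rewrite mul1r ler_nat geq_minr.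
by rewrite ltr0n expn_gt0.
Qed.

Lemma dyadic_ge0 s m k : 0 <= s -> 0 <= dyadic s m k.
Proof. by move=> s0; rewrite /dyadic !mulr_ge0. Qed.

Lemma dyadic0 s m : dyadic s m 0 = 0.
Proof. by rewrite /dyadic min0n mulr0 mul0r. Qed.

Lemma dyadic_nd s m : 0 <= s -> nondecreasing_seq (dyadic s m).
Proof.
move=> s0 a b ab; rewrite /dyadic ler_wpM2r ?invr_ge0// ler_wpM2l// ler_nat.
by rewrite leq_min geq_minr geq_min ab.
Qed.

Lemma dyadic_refine s m m' k : (m <= m')%N -> (k <= 2 ^ m)%N ->
  dyadic s m k = dyadic s m' (k * 2 ^ (m' - m)).
Proof.
move=> mm km; rewrite !dyadicE//; last first.
  by rewrite -{2}(subnKC mm) expnD leq_mul2r km orbT.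
rewrite -{2}(subnKC mm) exprD natrM natrX; field.
by rewrite !expf_neq0// pnatr_eq0.
Qed.

(** Uniform continuity on the compact interval from 0 to s. *)
Lemma dyadic_steps_small (s e : R) : 0 < s -> 0 < e ->
  exists m0, forall m, (m0 <= m)%N -> forall k, (k < 2 ^ m)%N ->
  `|g (dyadic s m k.+1) - g (dyadic s m k)| <= e.
Proof.
move=> s0 e0; have [d d0 hd] := half_line_uniform (ltW s0) e0.
have [m0 hm] := dyadic_small s d0; exists m0 => m mm k km.
apply: ltW; rewrite distrC; apply: hd.
- by rewrite dyadic_ge0 ?dyadic_le ?(ltW s0).
- by rewrite dyadic_ge0 ?(ltW s0).
rewrite !dyadicE//; last exact: ltnW.
rewrite -mulrBl -mulrBr -natr1 opprD addNKr mulrN mulr1 mulNr normrN gtr0_norm.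
  exact: hm.
by rewrite divr_gt0// exprn_gt0.
Qed.

Lemma dyadic_dense (s r e : R) : 0 < s -> 0 <= r <= s -> 0 < e ->
  exists m k, (k <= 2 ^ m)%N /\ `|g r - g (dyadic s m k)| < e.
Proof.
move=> s0 /andP[r0 rs] e0; have [d d0 hd] := cg r0 e0.
have [m hm] := dyadic_small s d0; exists m.
have p0 : 0 < 2 ^+ m :> R by rewrite exprn_gt0.
pose k := Num.truncn (r * 2 ^+ m / s).
have z0 : 0 <= r * 2 ^+ m / s by rewrite divr_ge0 ?mulr_ge0// ltW.
have /andP[k1 k2] : k%:R <= r * 2 ^+ m / s < k.+1%:R by exact: truncn_itv.
have km : (k <= 2 ^ m)%N.
  rewrite -(ler_nat R) natrX; apply: le_trans k1 _.
  by rewrite ler_pdivrMr// mulrC ler_wpM2l// ltW.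
exists k; split => //; apply: hd.
  by rewrite dyadic_ge0// ltW.
rewrite dyadicE//; have := hm m (leqnn m) => sd.
have rE : r = s / 2 ^+ m * (r * 2 ^+ m / s) by field; rewrite !gt_eqF.
have kE : s * k%:R / 2 ^+ m = s / 2 ^+ m * k%:R by ring.
have sp : 0 < s / 2 ^+ m by rewrite divr_gt0.
rewrite kE [X in `|X - _|]rE -mulrBr; rewrite -natr1 in k2.
rewrite ger0_norm; last by rewrite mulr_ge0 ?subr_ge0// (ltW sp).
apply: lt_trans sd; rewrite -[ltRHS]mulr1 ltr_pM2l//; lra.
Qed.

Lemma half_line_min (s : R) : 0 <= s -> (forall r, 0 <= r <= s -> 0 < g r) ->
  exists2 c, 0 < c & forall r, 0 <= r <= s -> c <= g r.
Proof.
move=> s0 gp.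
have cs : {within `[0, s], continuous g}.
  apply/subspace_continuousP => x; rewrite /= in_itv/= => /andP[x0 xs].
  apply/cvgrPdist_lt => e e0; have [d d0 hd] := cg x0 e0.
  rewrite near_withinE; apply/nbhs_ballP; exists d => //= y xy.
  by rewrite in_itv/= => /andP[y0 _]; exact: hd.
have [c] := EVT_min s0 cs; rewrite in_itv/= => cs' cmin.
by exists (g c); [exact: gp|move=> r rs; apply: cmin; rewrite in_itv].
Qed.

Lemma half_line_limit_ge0 (t : R) : 0 < t -> (forall r, 0 <= r < t -> 0 < g r) ->
  0 <= g t.
Proof.
move=> t0 gp; rewrite leNgt; apply/negP => gt0.
have gn : 0 < - g t by lra.
have [d d0 hd] := cg (ltW t0) gn.
pose r := Num.max 0 (t - d / 2).
have r0 : 0 <= r by rewrite le_max lexx.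
have rt : r < t by rewrite gt_max t0/=; lra.
have rd : t - d / 2 <= r by rewrite le_max lexx orbT.
have gr : 0 < g r by apply: gp; rewrite r0.
have : `|t - r| < d by rewrite ger0_norm ?subr_ge0 ?ltW//; lra.
move=> /(hd _ r0); rewrite ltr_norml => /andP[h1 h2]; lra.
Qed.

Lemma half_line_stays_pos (t : R) : 0 <= t -> 0 < g t ->
  exists2 d, 0 < d & forall r, t <= r -> r < t + d -> 0 < g r.
Proof.
move=> t0 gt0; have [d d0 hd] := cg t0 gt0; exists d => // r tr rd.
have : `|t - r| < d by rewrite distrC ger0_norm ?subr_ge0//; lra.
move=> /(hd _ (le_trans t0 tr)); rewrite ltr_norml => /andP[h1 h2]; lra.
Qed.

End continuous_paths.

(** * The law of the exit time *)

Lemma cvg_mean_on d (T : measurableType d) (R : realType) (P : probability T R)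
    (f : T -> R) (M : R) (A_ : nat -> set T) (A : set T) :
  measurable_fun setT f -> (forall w, `|f w| <= M) ->
  (forall j, measurable (A_ j)) -> measurable A ->
  (forall w, \forall j \near \oo, A_ j w <-> A w) ->
  (fun j => mean_on P f (A_ j)) @ \oo --> mean_on P f A.
Proof.
move=> mf fM mA_ mA AA.
apply: (@cvg_Rintegral _ _ _ P (fun j w => \1_(A_ j) w * f w) _ M).
- by move=> k; exact: measurable_indicM.
- exact: measurable_indicM.
- by move=> k w; exact: indicM_le.
move=> w; have := AA w; apply: filterS => j Aj.
rewrite !indicE; congr (_%:R * _); congr nat_of_bool.
by apply/idP/idP => /set_mem/Aj/mem_set.
Qed.

Section exit.
Context (d : measure_display) (Omega : measurableType d)
    (R : realType) (P : probability Omega R) (n : nat).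
Variables (eta : 'rV[R]_n) (X : 'I_n -> R -> {RV P >-> R}).
Hypotheses (hX : brownian_motion X eta) (heta : chamberB eta).

Definition staying (s : R) : set Omega :=
  [set w | forall r, 0 <= r <= s -> forall p : 'I_n * 'I_n, (p.1 <= p.2)%N ->
    0 < gap p (fun i => X i r w)].

(** Countably many times and a positive margin make this event measurable; it
increases to staying s as delta decreases to 0. *)
Definition dyadic_staying (s delta : R) : set Omega :=
  [set w | forall m k, (k <= 2 ^ m)%N -> forall p : 'I_n * 'I_n,
    (p.1 <= p.2)%N -> delta < gap p (fun i => X i (dyadic s m k) w)].

Lemma gap_continuous w p : half_line_continuous (fun r => gap p (fun i => X i r w)).
Proof.
have [bmX _] := hX.
have cX i : half_line_continuous (fun r => X i r w).
  by apply: within_half_line; have [_ _ _] := bmX i.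
rewrite /gap; case: (p.1 == p.2); first exact: cX.
exact: half_line_continuousB.
Qed.

Lemma measurable_gapT r p : measurable_fun setT (fun w => gap p (fun i => X i r w)).
Proof.
by rewrite /gap; case: (p.1 == p.2); [|exact: measurable_funB].
Qed.

Lemma measurable_dyadic_staying s delta : measurable (dyadic_staying s delta).
Proof.
have -> : dyadic_staying s delta = \bigcap_m \bigcap_(k in [set k | (k <= 2 ^ m)%N])
    \bigcap_(p in [set p : 'I_n * 'I_n | (p.1 <= p.2)%N])
      clear X (dyadic s m) delta k p.
  apply/seteqP; split=> w.
    by move=> h m _ k /= km p pp; exact: h.
  by move=> h m k km p pp; exact: (h m I k km p pp).
apply: bigcapT_measurable => m; apply: fin_bigcap_measurable.
  by apply: (sub_finite_set _ (finite_II (2 ^ m).+1)) => k /=.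
move=> k _; apply: fin_bigcap_measurable; first exact: finite_finset.
move=> p _; rewrite /clear -[X in measurable X]setTI.
have := @measurable_gapT (dyadic s m k) p measurableT _ (measurable_itv `]delta, +oo[).
by congr measurable; apply/seteqP; split=> w /=; rewrite in_itv/= andbT.
Qed.

Lemma dyadic_staying_sub s delta : 0 < s -> 0 < delta ->
  dyadic_staying s delta `<=` staying s.
Proof.
move=> s0 d0 w h r rs p pp.
have [m [k [km hk]]] := dyadic_dense (@gap_continuous w p) s0 rs d0.
have := h m k km p pp; move: hk; rewrite ltr_norml => /andP[h1 h2] h3; lra.
Qed.

(** On a compact interval the positive continuous gaps are bounded away from 0. *)
Lemma staying_near s w : 0 < s -> staying s w ->
  \forall delta \near 0^'+, dyadic_staying s delta w.
Proof.
move=> s0 h.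
have hp (p : 'I_n * 'I_n) : \forall delta \near 0^'+, (p.1 <= p.2)%N ->
    forall r, 0 <= r <= s -> delta < gap p (fun i => X i r w).
  case: (boolP (p.1 <= p.2)%N) => pp; last by near=> d'.
  have [c c0 hc] := half_line_min (@gap_continuous w p) (ltW s0) (fun r rs => h r rs p pp).
  near=> delta => _ r rs; apply: lt_le_trans (hc r rs).
  by near: delta; exact: nbhs_right_lt.
have H : \forall delta \near 0^'+, forall p : 'I_n * 'I_n, (p.1 <= p.2)%N ->
    forall r, 0 <= r <= s -> delta < gap p (fun i => X i r w).
  exact: filter_forall hp.
near=> delta => m k km p pp; have hd : forall p : 'I_n * 'I_n, (p.1 <= p.2)%N ->
    forall r, 0 <= r <= s -> delta < gap p (fun i => X i r w) by near: delta.
by apply: hd => //; rewrite dyadic_ge0 ?dyadic_le ?ltW.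
Unshelve. all: by end_near. Qed.

Lemma near_harmonic (Q : R -> Prop) : (\forall delta \near 0^'+, Q delta) ->
  \forall j \near \oo, Q (harmonic j).
Proof.
move=> [e /= e0 He].
have /cvgrPdist_lt/(_ e e0) := @cvg_harmonic R.
by apply: filterS => j hj; apply: He => //; exact: harmonic_gt0.
Qed.

Lemma staying_bigcup s : 0 < s ->
  staying s = \bigcup_j dyadic_staying s (harmonic j).
Proof.
move=> s0; apply/seteqP; split=> w.
  move=> /(staying_near s0)/near_harmonic [j _ Hj].
  by exists j => //; apply: Hj => /=.
by move=> [j _]; apply: dyadic_staying_sub => //; exact: harmonic_gt0.
Qed.

Lemma measurable_staying s : 0 < s -> measurable (staying s).
Proof.
move=> s0; rewrite staying_bigcup//; apply: bigcupT_measurable => j.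
exact: measurable_dyadic_staying.
Qed.

Variables (t : R) (t0 : 0 < t).
Let F w := eps (fun i => X i t w).
Let mF : measurable_fun setT F.
Proof. by apply: (measurable_eps (f := fun i w => X i t w)) => i. Qed.
Let FM w : `|F w| <= n`!%:R. Proof. exact: eps_bound. Qed.

(** A violation at one dyadic time is seen by all finer grids. *)
Lemma stays_near s delta w : 0 < s -> \forall m \near \oo,
  stays X (dyadic s m) delta (2 ^ m).+1 [::] w <-> dyadic_staying s delta w.
Proof.
move=> s0; case: (pselect (dyadic_staying s delta w)) => [h|h].
  near=> m; split => // _; split => // k /= km p pp; exact: h.
have [m0 [k [km [p [pp hk]]]]] : exists m k, (k <= 2 ^ m)%N /\
    exists p : 'I_n * 'I_n, (p.1 <= p.2)%N /\
    ~ delta < gap p (fun i => X i (dyadic s m k) w).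
  apply: contrapT => H; apply: h => m k km p pp; apply: contrapT => H'.
  by apply: H; exists m, k; split => //; exists p.
near=> m; split=> [[h1 _]|/h//]; exfalso.
have mm : (m0 <= m)%N by near: m; exact: nbhs_infty_ge.
apply: hk; rewrite (dyadic_refine s mm km); apply: h1 => //=.
by rewrite ltnS -{2}(subnKC mm) expnD leq_mul2r km orbT.
Unshelve. all: by end_near. Qed.

(** Each path is uniformly continuous, hence has no jump on a fine grid. *)
Lemma jumps_near s delta w : 0 < s -> 0 < delta -> \forall m \near \oo,
  jumps X (dyadic s m) (2 ^ m) delta w <-> set0 w.
Proof.
move=> s0 d0; have [bmX _] := hX.
have hi (i : 'I_n) : \forall m \near \oo, forall k, (k < 2 ^ m)%N ->
    `|X i (dyadic s m k.+1) w - X i (dyadic s m k) w| <= delta.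
  have cX : half_line_continuous (fun r => X i r w).
    by apply: within_half_line; have [_ _ _] := bmX i.
  have [m0 hm] := dyadic_steps_small cX s0 d0.
  by exists m0 => // m /= mm k km; exact: hm.
have H : \forall m \near \oo, forall i : 'I_n, forall k, (k < 2 ^ m)%N ->
    `|X i (dyadic s m k.+1) w - X i (dyadic s m k) w| <= delta.
  exact: filter_forall hi.
move: H; apply: filterS => m hm; split => // -[k /= km [i _ /=]].
by rewrite ltNge hm.
Qed.

(** The limit of grid_estimate along finer and finer grids, delta being fixed:
the probability of a jump tends to 0. *)
Lemma mean_dyadic_staying s delta : 0 < s -> s < t -> 0 < delta ->
  delta ^+ 2 <= (t - s) / 2 ->
  `|\int[P]_w F w - mean_on P F (dyadic_staying s delta)| <=
  n`!%:R * (delta * (2^-1 + (t - s)^-1)).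
Proof.
move=> s0 st d0 dts.
have c1 : (fun m => mean_on P F (stays X (dyadic s m) delta (2 ^ m).+1 [::])) @ \oo
    --> mean_on P F (dyadic_staying s delta).
  apply: (cvg_mean_on mF FM) => [m||w].
  - by apply: measurable_stays; [exact: dyadic0|apply: dyadic_nd; exact: ltW].
  - exact: measurable_dyadic_staying.
  - exact: stays_near.
have c2 : (fun m => mean_on P (cst 1 : Omega -> R) (jumps X (dyadic s m) (2 ^ m) delta)) @ \oo
    --> mean_on P (cst 1 : Omega -> R) set0.
  apply: (@cvg_mean_on _ _ _ P (cst 1) 1) => [|w|m||w].
  - exact: measurable_cst.
  - by rewrite normr1.
  - exact: measurable_jumps.
  - exact: measurable0.
  - exact: jumps_near.
rewrite mean_on1// measure0 /= in c2.
have c3 : (fun m => n`!%:R * (delta * (2^-1 + (t - s)^-1)) +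
    n`!%:R * mean_on P (cst 1 : Omega -> R) (jumps X (dyadic s m) (2 ^ m) delta)) @ \oo
    --> n`!%:R * (delta * (2^-1 + (t - s)^-1)) + n`!%:R * 0.
  by apply: cvgD; [exact: cvg_cst|apply: cvgMr].
rewrite mulr0 addr0 in c3.
have c4 : (fun m => `|\int[P]_w F w -
    mean_on P F (stays X (dyadic s m) delta (2 ^ m).+1 [::])|) @ \oo -->
    `|\int[P]_w F w - mean_on P F (dyadic_staying s delta)|.
  by apply: cvg_norm; apply: cvgB => //; exact: cvg_cst.
apply: (ler_cvg_to c4 c3); apply: nearW => m; rewrite mean_on1; last exact: measurable_jumps.
exact: (grid_estimate hX heta (2 ^ m) (dyadic0 s m)
  (dyadic_nd m (ltW s0)) (fun k => dyadic_le m k (ltW s0)) st d0 dts).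
Qed.

(** The limit delta -> 0.  The resampled increment lasts at least t - s > 0,
which is why s stays below t. *)
Lemma mean_staying s : 0 < s -> s < t -> \int[P]_w F w = mean_on P F (staying s).
Proof.
move=> s0 st; apply/eqP; rewrite -subr_eq0 -normr_le0; apply/eqP/eqP.
have c1 : (fun j => mean_on P F (dyadic_staying s (harmonic j))) @ \oo
    --> mean_on P F (staying s).
  apply: (cvg_mean_on mF FM) => [j||w].
  - exact: measurable_dyadic_staying.
  - exact: measurable_staying.
  - case: (pselect (staying s w)) => [h|h].
      by have := near_harmonic (staying_near s0 h); apply: filterS.
    by apply: nearW => j; split => // /(dyadic_staying_sub s0 (harmonic_gt0 j)).
have c2 : (fun j => `|\int[P]_w F w - mean_on P F (dyadic_staying s (harmonic j))|)
    @ \oo --> `|\int[P]_w F w - mean_on P F (staying s)|.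
  by apply: cvg_norm; apply: cvgB => //; exact: cvg_cst.
have c3 : (fun j => n`!%:R * (harmonic j * (2^-1 + (t - s)^-1))) @ \oo
    --> n`!%:R * (0 * (2^-1 + (t - s)^-1)).
  by apply: cvgMr; apply: cvgMl; exact: cvg_harmonic.
rewrite mul0r mulr0 in c3.
apply: (ler_cvg_to c2 c3).
apply: (near_harmonic (Q := fun x => `|\int[P]_w F w - mean_on P F (dyadic_staying s x)|
  <= n`!%:R * (x * (2^-1 + (t - s)^-1)))).
have ts2 : 0 < (t - s) / 2 by rewrite divr_gt0// subr_gt0.
near=> x; have x0 : 0 < x by near: x; exact: nbhs_right_gt.
apply: mean_dyadic_staying => //.
have x1 : x <= 1 by near: x; exact: nbhs_right_le.
have xts : x <= (t - s) / 2 by near: x; exact: nbhs_right_le.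
by apply: le_trans xts; rewrite expr2 ger_pMl.
Unshelve. all: by end_near. Qed.

Lemma eps_staying w : staying t w -> F w = 1.
Proof.
move=> /(_ t); rewrite lexx (ltW t0) => /(_ isT) h.
apply: eps_chamber => [i j ij|i].
  have := h (i, j) (ltnW ij); rewrite /gap /= -val_eqE /= ltn_eqF// subr_gt0//.
by have := h (i, i) (leqnn i); rewrite /gap eqxx.
Qed.

(** A path that leaves the chamber exactly at time t is on a wall at that time,
by continuity. *)
Lemma eps_leaving w : (forall r, 0 <= r < t -> forall p : 'I_n * 'I_n,
    (p.1 <= p.2)%N -> 0 < gap p (fun i => X i r w)) ->
  ~ staying t w -> F w = 0.
Proof.
move=> h nst.
have [p [pp gp]] : exists p : 'I_n * 'I_n, (p.1 <= p.2)%N /\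
    gap p (fun i => X i t w) = 0.
  apply: contrapT => H; apply: nst => r /andP[r0]; rewrite le_eqVlt => /orP[/eqP ->|rt].
    move=> p pp; rewrite lt_neqAle; apply/andP; split.
      by apply/eqP => gp; apply: H; exists p.
    apply: (half_line_limit_ge0 (@gap_continuous w p) t0) => r' rt'; exact: h.
  by apply: h; rewrite r0.
move: gp; rewrite /gap; case: eqP => [_|/eqP p12] gp.
  exact: (eps_zero gp).
by apply: (eps_collision p12); apply/eqP; rewrite -subr_eq0 gp.
Qed.

(** The limit s -> t: the events staying s decrease to the event of being in
the chamber before t, where eps is 1 or 0 according to whether the path is still
in the chamber at time t. *)
Lemma staying_prob : fine (P (staying t)) = \int[P]_w F w.
Proof.
pose s j := t * (1 - harmonic j.+1).
have h1 j : 0 < 1 - harmonic j.+1 :> R.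
  by rewrite subr_gt0 /= invf_lt1// ltr1n.
have s0 j : 0 < s j by rewrite mulr_gt0.
have st j : s j < t.
  by rewrite -[ltRHS]mulr1 ltr_pM2l// ltrBlDr ltrDl; exact: harmonic_gt0.
pose A := \bigcap_j staying (s j).
have mA : measurable A by apply: bigcapT_measurable => j; exact: measurable_staying.
have c1 : (fun j => mean_on P F (staying (s j))) @ \oo --> mean_on P F A.
  apply: (cvg_mean_on mF FM) => [j||w]; [exact: measurable_staying|by []|].
  case: (pselect (A w)) => [h|h].
    by apply: nearW => j; split => // _; exact: h.
  have [j0 hj0] : exists j, ~ staying (s j) w.
    by apply: contrapT => H; apply: h => j _; apply: contrapT => H'; apply: H; exists j.
  near=> j; split => // hj; exfalso; apply: hj0 => r /andP[r0 rs]; apply: hj.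
  rewrite r0/=; apply: le_trans rs _; rewrite ler_pM2l// lerD2l lerN2 /=.
  rewrite lef_pV2 ?posrE// ler_nat !ltnS; near: j; exact: nbhs_infty_ge.
have c2 : (fun j => mean_on P F (staying (s j))) @ \oo --> \int[P]_w F w.
  by under eq_fun do rewrite -mean_staying//; exact: cvg_cst.
have <- : mean_on P F A = \int[P]_w F w by exact: (cvg_unique _ c1 c2).
rewrite /mean_on.
have -> : fine (P (staying t)) = \int[P]_w \1_(staying t) w.
  by rewrite /Rintegral integral_indic ?setIT//; exact: measurable_staying.
apply: eq_Rintegral => w _; rewrite !indicE.
case: (boolP (w \in A)) => wA; last first.
  rewrite mul0r; apply/eqP; rewrite pnatr_eq0 eqb0; apply: contra wA => /set_mem h.
  apply/mem_set => j _ r /andP[r0 rs]; apply: h; rewrite r0 (le_trans rs)// ltW//.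
rewrite mul1r; case: (boolP (w \in staying t)) => [/set_mem h|h].
  by rewrite eps_staying.
rewrite eps_leaving// => [r /andP[r0 rt]|]; last by move=> /mem_set; rewrite (negbTE h).
have : 0 < 1 - r / t by rewrite subr_gt0 ltr_pdivrMr// mul1r.
move=> e0; have /cvgrPdist_lt/(_ _ e0) [j _ /(_ j.+1 (leqnSn j))] := @cvg_harmonic R.
rewrite sub0r normrN ger0_norm ?harmonic_ge0// => hj.
move/set_mem : wA => /(_ j I); apply; rewrite r0/= /s.
by rewrite mulrC -ler_pdivrMr//; lra.
Unshelve. all: by end_near. Qed.

End exit.

Section exit_time_law.
Context (d : measure_display) (Omega : measurableType d)
    (R : realType) (P : probability Omega R) (n : nat).
Variables (eta : 'rV[R]_n) (X : 'I_n -> R -> {RV P >-> R}).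
Hypotheses (hX : brownian_motion X eta) (heta : chamberB eta).

Lemma chamber_gap (f : 'I_n -> R) : chamberB (\row_i f i) <->
  forall p : 'I_n * 'I_n, (p.1 <= p.2)%N -> 0 < gap p f.
Proof.
split=> [[h1 h2] p pp|h].
  rewrite /gap; case: eqP => [_|/eqP p12]; first by have := h2 p.1; rewrite mxE.
  by have := h1 p.1 p.2; rewrite ltn_neqAle pp andbT !mxE subr_gt0; exact.
split=> [i j ij|i]; rewrite !mxE.
  have := h (i, j) (ltnW ij).
  by rewrite /gap /= -val_eqE /= ltn_eqF// subr_gt0.
by have := h (i, i) (leqnn i); rewrite /gap eqxx.
Qed.

(** Since the chamber is open, a path that is inside up to and including t
remains inside a little longer. *)
Lemma exit_after (t : R) : 0 <= t ->
  [set w | (t%:E < exit_time (@chamberB R n) (fun r => \row_i X i r w))%E] =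
  staying X t.
Proof.
move=> t0; apply/seteqP; split=> w /=.
  move=> tT r /andP[r0 rt]; apply/chamber_gap; apply: contrapT => out.
  suff : (exit_time (@chamberB R n) (fun r => \row_i X i r w) <= t%:E)%E.
    by rewrite leNgt tT.
  by apply: (@le_trans _ _ r%:E); [apply: ereal_inf_lbound; exists r|rewrite lee_fin].
move=> st.
have hp (p : 'I_n * 'I_n) : \forall e \near 0^'+, (p.1 <= p.2)%N ->
    forall r, t <= r -> r < t + e -> 0 < gap p (fun i => X i r w).
  case: (boolP (p.1 <= p.2)%N) => pp; last by near=> e.
  have gt0 : 0 < gap p (fun i => X i t w) by apply: st => //; rewrite t0 lexx.
  have [c c0 hc] := half_line_stays_pos (gap_continuous hX w p) t0 gt0.
  near=> e => _ r tr re; apply: hc => //; apply: lt_trans re _; rewrite ltrD2l.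
  by near: e; exact: nbhs_right_lt.
have H : \forall e \near 0^'+, forall p : 'I_n * 'I_n, (p.1 <= p.2)%N ->
    forall r, t <= r -> r < t + e -> 0 < gap p (fun i => X i r w).
  exact: filter_forall hp.
near (0 : R)^'+ => e.
have e0 : 0 < e by near: e; exact: nbhs_right_gt.
have He : forall p : 'I_n * 'I_n, (p.1 <= p.2)%N ->
    forall r, t <= r -> r < t + e -> 0 < gap p (fun i => X i r w) by near: e.
apply: (@lt_le_trans _ _ (t + e)%:E); first by rewrite lte_fin ltrDl.
apply: le_ereal_inf_tmp => _ [r [r0 out] <-]; rewrite lee_fin leNgt; apply/negP => re.
apply: out; apply/chamber_gap => p pp; case: (lerP r t) => rt.
  by apply: st => //; rewrite r0.
by apply: He => //; exact: ltW.
Unshelve. all: by end_near. Qed.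

Lemma exit_prob (t : R) : 0 < t ->
  fine (P [set w | (t%:E < exit_time (@chamberB R n) (fun r => \row_i X i r w))%E]) =
  \int[P]_w eps (fun i => X i t w).
Proof.
by move=> t0; rewrite exit_after ?ltW//; exact: (staying_prob hX heta t0).
Qed.

End exit_time_law.

(** * Alternating nested integrals *)

Lemma measurable_Rintegral_param d1 d2 (S : measurableType d1)
    (U : measurableType d2) (R : realType)
    (nu : {sigma_finite_measure set U -> \bar R}) (H : S * U -> R) :
  measurable_fun setT H -> measurable_fun setT (fun x => \int[nu]_y H (x, y)).
Proof.
move=> mH; apply/measurableT_comp => //.
rewrite (_ : (fun _ => _) = (fun x =>
  (\int[nu]_y ((EFin \o H)^\+ (x, y)) - \int[nu]_y ((EFin \o H)^\- (x, y)))%E)).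
  have mE : measurable_fun setT (EFin \o H) by exact/measurable_EFinP.
  apply: emeasurable_funB; apply: measurable_fun_fubini_tonelli_F => //.
    exact: measurable_funepos.
  exact: measurable_funeneg.
apply/funext => x; rewrite integralE.
have -> : (fun x1 => (H (x, x1))%:E) = (EFin \o H) \o pair x by [].
by rewrite funepos_comp funeneg_comp.
Qed.

Lemma Rintegral_bigsum d (T : measurableType d) (R : realType)
    (m : {measure set T -> \bar R}) (D : set T) (I : Type) (r : seq I)
    (h : I -> T -> R) : measurable D ->
  (forall i, m.-integrable D (EFin \o h i)) ->
  \int[m]_(x in D) (\sum_(i <- r) h i x) = \sum_(i <- r) \int[m]_(x in D) h i x.
Proof.
move=> mD ih; elim: r => [|i r IHr].
  rewrite big_nil; under eq_Rintegral do rewrite big_nil.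
  by rewrite Rintegral_cst// mul0r.
rewrite big_cons -IHr -RintegralD//.
  by apply: eq_Rintegral => x _; rewrite big_cons.
have := @integrable_sum _ T R m D mD I r xpredT (fun i => EFin \o h i) (fun i _ => ih i).
by apply: eq_integrable => // x _; rewrite /= sumEFin.
Qed.

Section iterated.
Context (R : realType).
Local Notation mu := (@lebesgue_measure R).
Local Notation pos := (`]0, +oo[%classic : set R).

(** The integral of f_1(x_1) f_2(x_2) ... over y < x_1 < x_2 < ... *)
Fixpoint iterJ (fs : seq (R -> R)) (y : R) : R :=
  if fs is f :: fs' then
    \int[mu]_(x in pos) ((y < x)%R%:R * (f x * iterJ fs' x))
  else 1.

(** The factor 2 b makes the integral over x > y equal to exp(- b y^2), so that
nested integrals of bumps remain explicit. *)
Definition gbump (b x : R) : R := 2 * b * x * expR (- (b * x ^+ 2)).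

(** The total mass of gbump b over the half-line is 1: every nested integral of
m such functions is at most C^m. *)
Definition dominated (b C : R) (f : R -> R) : Prop :=
  measurable_fun setT f /\ forall x, 0 < x -> `|f x| <= C * gbump b x.

Lemma continuous_gbump b : continuous (gbump b).
Proof.
move=> x; apply: (@cvgM R R (nbhs x) _ (fun x => 2 * b * x) (fun x => expR (- (b * x ^+ 2)))).
  by apply: cvgMr; exact: cvg_id.
apply: continuous_cvg; first exact: continuous_expR.
by apply: cvgN; apply: cvgMr; exact: exprn_continuous.
Qed.

Lemma measurable_gbump b : measurable_fun setT (gbump b).
Proof. by apply: continuous_measurable_fun; exact: continuous_gbump. Qed.

Lemma gbump_ge0 b x : 0 < b -> 0 <= x -> 0 <= gbump b x.
Proof. by move=> b0 x0; rewrite mulr_ge0 ?expR_ge0// mulr_ge0// mulr_ge0// ltW. Qed.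

Lemma integral_gbump b y : 0 < b -> 0 <= y ->
  (\int[mu]_(x in `]y, +oo[) (gbump b x)%:E = (expR (- (b * y ^+ 2)))%:E)%E.
Proof.
move=> b0 y0; pose G x := - expR (- (b * x ^+ 2)).
have dG (x : R) : is_derive x 1 G (gbump b x).
  rewrite /G /gbump.
  apply: is_derive_eq.
  by rewrite /GRing.scale /=; ring.
rewrite integral_itv_obnd_cbnd; last first.
  by apply/measurable_EFinP/measurable_funTS; exact: measurable_gbump.
rewrite (@ge0_continuous_FTC2y _ _ G _ 0).
- by rewrite /G -EFinB opprK add0r.
- by move=> x yx; apply: gbump_ge0 => //; exact: le_trans yx.
- by apply: continuous_subspaceT; exact: continuous_gbump.
- rewrite -oppr0; apply: cvgN.
  apply: (cvg_comp (fun x => b * x ^+ 2) (fun x => expR (- x))); last exact: cvgr_expR.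
  exact: (gt0_cvgMry b0 cvgr_expr2).
- by move=> x _; exact: ex_derive.
- apply: cvg_at_right_filter; apply: differentiable_continuous.
  by apply/derivable1_diffP; exact: ex_derive.
- by move=> x _; rewrite derive1E; exact: derive_val.
Qed.

Let mpos : measurable (pos : set (measurableTypeR R)).
Proof. exact: measurable_itv. Qed.

Lemma integrable_gbump b : 0 < b -> mu.-integrable pos (EFin \o gbump b).
Proof.
move=> b0; apply/integrableP; split.
  by apply/measurable_EFinP/measurable_funTS; exact: measurable_gbump.
apply: (@le_lt_trans _ _ (\int[mu]_(x in pos) (gbump b x)%:E)%E).
  rewrite le_eqVlt; apply/orP; left; apply/eqP; apply: eq_integral => x /set_mem.
  rewrite /= in_itv/= andbT => x0.
  by rewrite ger0_norm// gbump_ge0// ltW.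
by rewrite integral_gbump// ltry.
Qed.

Lemma Rintegral_gbump_tail b y : 0 < b -> 0 <= y ->
  \int[mu]_(x in pos) ((y < x)%R%:R * gbump b x) = expR (- (b * y ^+ 2)).
Proof.
move=> b0 y0; rewrite /Rintegral -[RHS]/(fine (expR (- (b * y ^+ 2)))%:E).
congr fine; rewrite -integral_gbump// integral_mkcond [RHS]integral_mkcond.
apply: eq_integral => x _; rewrite /patch !mem_setE !in_itv/= !andbT.
case: (ltrP y x) => yx; first by rewrite (le_lt_trans y0 yx) mul1r.
by rewrite mul0r if_same.
Qed.

Lemma dominated_integrable_mul b C f (k : R -> R) M : 0 < b -> dominated b C f ->
  measurable_fun setT k -> (forall x, 0 < x -> `|k x| <= M) ->
  mu.-integrable pos (EFin \o (fun x => f x * k x)).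
Proof.
move=> b0 [mf fC] mk kM.
have iCM : mu.-integrable pos (EFin \o (fun x => C * M * gbump b x)).
  have := integrableZl mpos (C * M) (integrable_gbump b0).
  by apply: eq_integrable => // x _; rewrite /= EFinM.
apply: le_integrable iCM => //.
  by apply/measurable_EFinP/measurable_funTS; exact: measurable_funM.
move=> x; rewrite /= in_itv/= andbT => x0; rewrite lee_fin.
apply: le_trans (ler_norm _); rewrite normrM mulrAC.
by apply: ler_pM => //; [exact: fC|exact: kM].
Qed.

Lemma measurable_iterJ (fs : seq (R -> R)) :
  (forall i, (i < size fs)%N -> measurable_fun setT (nth 0 fs i)) ->
  measurable_fun setT (iterJ fs).
Proof.
elim: fs => [_|f fs IHfs mfs] /=; first exact: measurable_cst.
have mf : measurable_fun setT f by exact: (mfs 0%N).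
have mJ : measurable_fun setT (iterJ fs) by apply: IHfs => i; exact: (mfs i.+1).
have mH : measurable_fun setT (fun z : R * R =>
    \1_pos z.2 * ((z.1 < z.2)%R%:R * (f z.2 * iterJ fs z.2))).
  apply: measurable_funM.
    by apply: measurableT_comp measurable_snd; apply: measurable_indic.
  apply: measurable_funM; last first.
    by apply: measurable_funM; apply: measurableT_comp measurable_snd.
  rewrite (_ : (fun _ => _) = (fun z : R * R => if (z.1 < z.2)%R then 1 else 0)).
    apply: measurable_fun_ifT; [|exact: measurable_cst..].
    by apply: measurable_fun_ltr.
  by apply/funext => z; case: (_ < _).
have := @measurable_Rintegral_param _ _ R (measurableTypeR R) R mu _ mH.
congr measurable_fun; apply/funext => y; rewrite [RHS]Rintegral_mkcond.
apply: eq_Rintegral => x _ /=; rewrite /patch indicE.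
by case: (x \in pos); rewrite ?mul1r ?mul0r.
Qed.

Lemma measurable_cut y : measurable_fun setT (fun x : R => (y < x)%R%:R : R).
Proof. by apply: measurable_fun_natr; exact: measurable_fun_ltr. Qed.

Lemma integrable_cut b C f (k : R -> R) M y : 0 < b -> dominated b C f ->
  measurable_fun setT k -> (forall x, 0 < x -> `|k x| <= M) ->
  mu.-integrable pos (EFin \o (fun x => (y < x)%R%:R * (f x * k x))).
Proof.
move=> b0 df mk kM.
have := @dominated_integrable_mul b C f (fun x => (y < x)%R%:R * k x) M b0 df.
under [X in _.-integrable _ (_ \o X)]eq_fun do rewrite mulrCA.
apply; first by apply: measurable_funM => //; exact: measurable_cut.
move=> x x0; apply: le_trans (kM x x0); case: (y < x); rewrite ?mul1r ?mul0r//.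
by rewrite normr0.
Qed.

Lemma cut_bound b C f (k : R -> R) M y : 0 < b -> dominated b C f ->
  measurable_fun setT k -> (forall x, 0 < x -> `|k x| <= M) ->
  `|\int[mu]_(x in pos) ((y < x)%R%:R * (f x * k x))| <= C * M.
Proof.
move=> b0 df mk kM; have ic := integrable_cut y b0 df mk kM.
apply: le_trans (le_normr_Rintegral mpos ic) _.
have ib := integrable_gbump b0.
have -> : C * M = \int[mu]_(x in pos) (C * M * gbump b x).
  rewrite (RintegralZl _ mpos ib) /Rintegral integral_gbump//.
  by rewrite expr0n mulr0 oppr0 expR0 mulr1.
apply: le_Rintegral => //; first exact: integrable_norm ic.
  have := integrableZl mpos (C * M) ib.
  by apply: eq_integrable => // x _; rewrite /= EFinM.
move=> x; rewrite /= in_itv/= andbT => x0.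
have [_ fC] := df.
have h : `|f x * k x| <= C * M * gbump b x.
  by rewrite normrM mulrAC; apply: ler_pM => //; [exact: fC|exact: kM].
apply: le_trans h; case: (y < x); rewrite ?mul1r ?mul0r//.
by rewrite normr0.
Qed.

Section families.
Variables (I : eqType) (b C : R).
Hypotheses (b0 : 0 < b) (C1 : 1 <= C).

Let C0 : 0 <= C. Proof. exact: le_trans C1. Qed.

Lemma measurable_iterJ_map (l : seq I) (F : I -> R -> R) :
  (forall i, i \in l -> dominated b C (F i)) ->
  measurable_fun setT (iterJ [seq F i | i <- l]).
Proof.
move=> dF; apply: measurable_iterJ => i; rewrite size_map => il.
case: l dF il => [//|j l] dF il; rewrite (nth_map j)//.
by have [] := dF _ (mem_nth j il).
Qed.

Lemma iterJ_bound (l : seq I) (F : I -> R -> R) y :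
  (forall i, i \in l -> dominated b C (F i)) ->
  `|iterJ [seq F i | i <- l] y| <= C ^+ size l.
Proof.
elim: l y => [|i l IHl] y dF /=; first by rewrite normr1 expr0.
have dFl j : j \in l -> dominated b C (F j) by move=> jl; apply: dF; rewrite inE jl orbT.
have di := dF i (mem_head i l).
rewrite exprS; apply: (cut_bound y b0 di (measurable_iterJ_map dFl)).
by move=> x _; exact: IHl.
Qed.

(** The factors are exchanged one at a time. *)
Lemma iterJ_lipschitz (l : seq I) (F G : I -> R -> R) D y : 0 <= D ->
  (forall i, i \in l -> dominated b C (F i)) ->
  (forall i, i \in l -> dominated b C (G i)) ->
  (forall i, i \in l -> dominated b D (fun x => F i x - G i x)) ->
  `|iterJ [seq F i | i <- l] y - iterJ [seq G i | i <- l] y| <=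
  (size l)%:R * D * C ^+ size l.
Proof.
move=> D0; elim: l y => [|i l IHl] y dF dG dFG /=.
  by rewrite subrr normr0 !mul0r.
have il : i \in i :: l by exact: mem_head.
have dFl j : j \in l -> dominated b C (F j) by move=> jl; apply: dF; rewrite inE jl orbT.
have dGl j : j \in l -> dominated b C (G j) by move=> jl; apply: dG; rewrite inE jl orbT.
have dFGl j : j \in l -> dominated b D (fun x => F j x - G j x).
  by move=> jl; apply: dFG; rewrite inE jl orbT.
have mF := measurable_iterJ_map dFl; have mG := measurable_iterJ_map dGl.
have bF x := iterJ_bound x dFl; have bG x := iterJ_bound x dGl.
have bFG x := IHl x dFl dGl dFGl.
rewrite -RintegralB//; last 2 first.
- exact: (integrable_cut y b0 (dF i il) mF (fun x _ => bF x)).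
- exact: (integrable_cut y b0 (dG i il) mG (fun x _ => bG x)).
set JF := iterJ _ in mF bF bFG *; set JG := iterJ _ in mG bG bFG *.
have mB : measurable_fun setT (fun x => JF x - JG x) by exact: measurable_funB.
have -> : \int[mu]_(x in pos) ((y < x)%R%:R * (F i x * JF x) -
      (y < x)%R%:R * (G i x * JG x)) =
    \int[mu]_(x in pos) ((y < x)%R%:R * ((F i x - G i x) * JF x)) +
    \int[mu]_(x in pos) ((y < x)%R%:R * (G i x * (JF x - JG x))).
  rewrite -RintegralD//.
  - by apply: eq_Rintegral => x _; ring.
  - exact: (integrable_cut y b0 (dFG i il) mF (fun x _ => bF x)).
  - exact: (integrable_cut y b0 (dG i il) mB (fun x _ => bFG x)).
apply: le_trans (ler_normD _ _) _.
apply: (@le_trans _ _ (D * C ^+ size l + C * ((size l)%:R * D * C ^+ size l))).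
  apply: lerD.
    exact: (cut_bound y b0 (dFG i il) mF (fun x _ => bF x)).
  exact: (cut_bound y b0 (dG i il) mB (fun x _ => bFG x)).
rewrite exprS -natr1.
have : 0 <= D * C ^+ size l by rewrite mulr_ge0// exprn_ge0.
have : 0 <= (size l)%:R * D * C ^+ size l by rewrite !mulr_ge0// exprn_ge0.
move: (C ^+ size l) (size l)%:R => c m h1 h2; have := C1; nra.
Qed.

End families.

Section multilinear.
Variables (I K : finType) (b C : R) (A : I -> K -> R) (F : K -> R -> R).
Hypotheses (b0 : 0 < b) (C1 : 1 <= C) (dF : forall k, dominated b C (F k)).

(** Expansion of a product of sums: v picks one term in each factor. *)
Lemma iterJ_multilinear (l : seq I) y :
  iterJ [seq (fun x => \sum_k A i k * F k x) | i <- l] y =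
  \sum_(v : (size l).-tuple K) (\prod_(p <- zip l v) A p.1 p.2) *
    iterJ [seq F k | k <- v] y.
Proof.
elim: l y => [|i l IHl] y /=.
  rewrite (bigD1 [tuple])//= big_nil mulr1 big1 ?addr0// => v.
  by move/eqP; case; exact: tuple0.
pose h (p : K * (size l).-tuple K) x := (y < x)%R%:R * (F p.1 x *
  iterJ [seq F k | k <- p.2] x).
have dv (v : (size l).-tuple K) k : k \in (v : seq K) -> dominated b C (F k).
  by [].
have ih p : mu.-integrable pos (EFin \o h p).
  have hh := (integrable_cut y b0 (dF p.1) (measurable_iterJ_map (@dv p.2))
    (fun x _ => iterJ_bound b0 x (@dv p.2))).
  exact hh.
pose c (p : K * (size l).-tuple K) := A i p.1 * \prod_(r <- zip l p.2) A r.1 r.2.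
have ich p : mu.-integrable pos (EFin \o (fun x => c p * h p x)).
  have := integrableZl mpos (c p) (ih p).
  by apply: eq_integrable => // x _; rewrite /= EFinM.
transitivity (\int[mu]_(x in pos) \sum_p c p * h p x).
  apply: eq_Rintegral => x _; rewrite IHl.
  rewrite -(pair_bigA _ (fun k v => c (k, v) * h (k, v) x))/= mulr_suml mulr_sumr.
  apply: eq_bigr => k _; rewrite !mulr_sumr; apply: eq_bigr => v _.
  by rewrite /c /h /=; ring.
rewrite (Rintegral_bigsum _ mpos ich).
rewrite (reindex (fun p : K * (size l).-tuple K => cons_tuple p.1 p.2))/=; last first.
  exists (fun v => (thead v, behead_tuple v)) => [[k v] _|v _] /=.
    by congr pair; apply: val_inj.
  by case/tupleP: v => k v; apply: val_inj => /=; rewrite theadE.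
apply: eq_bigr => -[k v] _ /=; rewrite big_cons /= (RintegralZl _ mpos (ih _)).
by [].
Qed.

End multilinear.

End iterated.

Section alternating.
Context (R : realType) (n : nat).
Local Notation rl := (rev (enum 'I_n)).

(** The integral of the determinant of F_i(x_j) over 0 < x_n < ... < x_1. *)
Definition altJ (F : 'I_n -> R -> R) : R :=
  \sum_(s : 'S_n) (-1) ^+ s * iterJ [seq F (s i) | i <- rl] 0.

Let rl_uniq : uniq rl. Proof. by rewrite rev_uniq enum_uniq. Qed.
Let mem_rl i : i \in rl. Proof. by rewrite mem_rev mem_enum. Qed.

Lemma sum_tuple_ffun (E : seq 'I_n -> R) :
  \sum_(v : (size rl).-tuple 'I_n) E v =
  \sum_(f : {ffun 'I_n -> 'I_n}) E [seq f i | i <- rl].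
Proof.
rewrite (reindex (fun f : {ffun 'I_n -> 'I_n} => map_tuple f (in_tuple rl)))//=.
exists (fun v : (size rl).-tuple 'I_n => [ffun i => nth i v (index i rl)]).
  move=> f _; apply/ffunP => i; rewrite ffunE /= (nth_map i) ?index_mem//.
  by rewrite nth_index.
move=> v _; apply: val_inj => /=; case: (posnP n) => [n0|n0].
  have s0 : size rl = 0%N by rewrite size_rev size_enum_ord.
  by case: v => v /= /eqP; rewrite s0 => /size0nil ->; rewrite (size0nil s0).
pose i0 := Ordinal n0; apply: (@eq_from_nth _ i0); first by rewrite size_map size_tuple.
move=> k; rewrite size_map => kn; rewrite (nth_map i0)// ffunE index_uniq//.
by apply: set_nth_default; rewrite size_tuple.
Qed.

Lemma det_select (A : 'M[R]_n) (f : {ffun 'I_n -> 'I_n}) :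
  \sum_(s : 'S_n) (-1) ^+ s * \prod_i A (s i) (f i) =
  \det (\matrix_(i, j) A j (f i)).
Proof.
by apply: eq_bigr => s _; congr (_ * _); apply: eq_bigr => i _; rewrite mxE.
Qed.

(** After multilinear expansion, the terms in which two factors coincide carry a
determinant with two equal rows; the others are indexed by permutations. *)
Lemma altJ_det (A : 'M[R]_n) (F : 'I_n -> R -> R) b C : 0 < b ->
  (forall k, dominated b C (F k)) ->
  altJ (fun i x => \sum_k A i k * F k x) = \det A * altJ F.
Proof.
move=> b0 dF; pose E (f : {ffun 'I_n -> 'I_n}) := iterJ [seq F (f i) | i <- rl] 0.
transitivity (\sum_(f : {ffun 'I_n -> 'I_n})
    \det (\matrix_(i, j) A j (f i)) * E f).
  transitivity (\sum_(s : 'S_n) \sum_(f : {ffun 'I_n -> 'I_n})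
      ((-1) ^+ s * \prod_i A (s i) (f i)) * E f).
    apply: eq_bigr => s _.
    rewrite (iterJ_multilinear (fun i k => A (s i) k) b0 dF).
    rewrite (sum_tuple_ffun (fun v => (\prod_(p <- zip rl v) A (s p.1) p.2) *
      iterJ [seq F k | k <- v] 0)) mulr_sumr.
    apply: eq_bigr => f _; rewrite mulrA; congr (_ * _ * _).
      by rewrite -{1}[rl]map_id zip_map big_map/= big_rev big_enum.
    by rewrite /E -map_comp.
  rewrite exchange_big; apply: eq_bigr => f _.
  by rewrite -mulr_suml det_select.
rewrite (bigID (fun f : {ffun 'I_n -> 'I_n} => injectiveb f))/= addrC big1 ?add0r.
  rewrite (reindex (@pval _)) /=; last first.
    pose in_Sn := insubd (1%g : 'S_n).
    by exists in_Sn => /= f Uf; first apply: val_inj; apply: insubdK.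
  rewrite /altJ mulr_sumr; apply: eq_big => [s|s _]; first exact: (valP s).
  have -> : \matrix_(i, j) A j (pval s i) = row_perm s A^T.
    by apply/matrixP => i j; rewrite !mxE pvalE.
  rewrite row_permE det_mulmx det_perm det_tr mulrCA mulrA; congr (_ * _).
  by rewrite /E; congr (iterJ _ _); apply: eq_map => i; rewrite pvalE.
move=> f /injectivePn[i1 [i2 i12 ef]].
by rewrite (determinant_alternate i12) ?mul0r// => j; rewrite !mxE ef.
Qed.

Lemma altJ_lipschitz (F G : 'I_n -> R -> R) b C D : 0 < b -> 1 <= C -> 0 <= D ->
  (forall k, dominated b C (F k)) -> (forall k, dominated b C (G k)) ->
  (forall k, dominated b D (fun x => F k x - G k x)) ->
  `|altJ F - altJ G| <= n`!%:R * (n%:R * D * C ^+ n).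
Proof.
move=> b0 C1 D0 dF dG dFG; rewrite /altJ -sumrB.
apply: le_trans (ler_norm_sum _ _ _) _.
rewrite -card_Sn -sum1_card natr_sum mulr_suml; apply: ler_sum => s _.
rewrite -mulrBr normrM normr_sign !mul1r.
have sz : size rl = n by rewrite size_rev size_enum_ord.
have := iterJ_lipschitz (l := rl) (F := fun i => F (s i)) (G := fun i => G (s i))
  b0 C1 0 D0 (fun i _ => dF (s i)) (fun i _ => dG (s i)) (fun i _ => dFG (s i)).
by rewrite sz.
Qed.

Lemma altJ_scale (c : 'I_n -> R) (F : 'I_n -> R -> R) b C : 0 < b ->
  (forall k, dominated b C (F k)) ->
  altJ (fun i x => c i * F i x) = (\prod_i c i) * altJ F.
Proof.
move=> b0 dF; have := altJ_det (diag_mx (\row_i c i)) b0 dF.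
rewrite det_diag; under [X in _ = X * _]eq_bigr do rewrite mxE.
move=> <-; congr altJ; apply/funext => i; apply/funext => x.
rewrite (bigD1 i)//= big1 ?addr0; first by rewrite !mxE eqxx mulr1n.
by move=> j ji; rewrite !mxE eq_sym (negbTE ji) mulr0n mul0r.
Qed.

Lemma dominated_sum (F : 'I_n -> R -> R) (a : 'I_n -> R) b C : 0 < b -> 0 <= C ->
  (forall k, dominated b C (F k)) ->
  dominated b ((\sum_k `|a k|) * C) (fun x => \sum_k a k * F k x).
Proof.
move=> b0 C0 dF; split.
  apply: measurable_sum => k; apply: measurable_funM; first exact: measurable_cst.
  by have [] := dF k.
move=> x x0; apply: le_trans (ler_norm_sum _ _ _) _.
rewrite -mulrA mulr_suml; apply: ler_sum => k _.
by rewrite normrM ler_wpM2l//; have [_] := dF k; exact.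
Qed.

Lemma dominated_le (b C C' : R) f : 0 < b -> C <= C' -> dominated b C f -> dominated b C' f.
Proof.
move=> b0 CC [mf h]; split=> // x x0; apply: le_trans (h x x0) _.
by rewrite ler_wpM2r// gbump_ge0// ltW.
Qed.

(** Write D for the diagonal matrix of the e^k.  The remainder e^n r equals
M D applied to D^-1 M^-1 (e^n r), whose entries are at most of order e because
k <= n - 1.  Thus F is M D applied to a perturbation of size e of g; altJ_det
takes out the determinant and altJ_lipschitz bounds the effect of the
perturbation. *)
Lemma altJ_asymp (M : 'M[R]_n) (C : R) : M \in unitmx -> 1 <= C ->
  exists K, forall (e b : R) (F g r : 'I_n -> R -> R),
  0 < e -> e <= 1 -> 0 < b ->
  (forall i x, F i x = \sum_(k < n) e ^+ k * M i k * g k x + e ^+ n * r i x) ->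
  (forall k, dominated b C (g k)) -> (forall k, dominated b C (r k)) ->
  `|altJ F - \det M * (\prod_(k < n) e ^+ k) * altJ g| <=
  K * (\prod_(k < n) e ^+ k) * e.
Proof.
move=> uM C1.
have C0 : 0 <= C by exact: le_trans C1.
pose S := \sum_k \sum_i `|invmx M k i|.
have S0 : 0 <= S by rewrite sumr_ge0// => k _; rewrite sumr_ge0.
pose C' := C + S * C.
have CC' : C <= C' by rewrite lerDl mulr_ge0.
have C'1 : 1 <= C' by exact: le_trans CC'.
exists (`|\det M| * (n`!%:R * (n%:R * (S * C) * C' ^+ n))) => e b F g r e0 e1 b0 FE dg dr.
(* The k-th entry of D^-1 M^-1 (e^n r) is e * rt k. *)
pose rt (k : 'I_n) x := \sum_i (e ^+ (n.-1 - k) * invmx M k i) * r i x.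
have drt k : dominated b (S * C) (rt k).
  apply: dominated_le b0 _ (dominated_sum _ b0 C0 dr); rewrite ler_wpM2r//.
  rewrite /S [leRHS](bigD1 k)//= -[leLHS]addr0; apply: lerD; last first.
    by rewrite sumr_ge0// => j _; rewrite sumr_ge0.
  apply: ler_sum => i _; rewrite normrM; have ek := exprn_ge0 (n.-1 - k) (ltW e0).
  by rewrite (ger0_norm ek) ler_piMl// exprn_ile1// ltW.
pose G k x := g k x + e * rt k x.
have mG k : measurable_fun setT (G k).
  apply: measurable_funD; first by have [] := dg k.
  by apply: measurable_funM; [exact: measurable_cst|have [] := drt k].
have dG k : dominated b C' (G k).
  split=> // x x0; apply: le_trans (ler_normD _ _) _; rewrite /C' mulrDl.
  apply: lerD; first by have [_] := dg k; exact.
  rewrite normrM (gtr0_norm e0) -[leRHS]mul1r; apply: ler_pM => //; first exact: ltW.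
  by have [_] := drt k; exact.
have dg' k : dominated b C' (g k) by exact: dominated_le b0 CC' (dg k).
have dGg k : dominated b (e * (S * C)) (fun x => G k x - g k x).
  split; first by apply: measurable_funB => //; have [] := dg k.
  move=> x x0; rewrite /G addrC addKr normrM (gtr0_norm e0) -mulrA ler_pM2l//.
  by have [_] := drt k; exact.
pose A := M *m diag_mx (\row_k e ^+ k).
have AE i k : A i k = M i k * e ^+ k.
  rewrite mxE (bigD1 k)//= !mxE eqxx mulr1n big1 ?addr0// => j jk.
  by rewrite !mxE (negbTE jk) mulr0n mulr0.
have FA : F = fun i x => \sum_k A i k * G k x.
  apply/funext => i; apply/funext => x; rewrite FE /G.
  under [RHS]eq_bigr do rewrite mulrDr.
  rewrite big_split/=; congr (_ + _).
    by apply: eq_bigr => k _; rewrite AE (mulrC (e ^+ k)).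
  have MV : M *m invmx M = 1%:M by exact: mulmxV.
  transitivity (\sum_k \sum_l e ^+ n * (M i k * invmx M k l) * r l x).
    rewrite exchange_big/=; under eq_bigr do rewrite -mulr_suml -mulr_sumr.
    transitivity (\sum_l e ^+ n * (i == l)%:R * r l x).
      rewrite (bigD1 i)//= eqxx mulr1 big1 ?addr0// => j ji.
      by rewrite eq_sym (negbTE ji) mulr0 mul0r.
    apply: eq_bigr => l _; congr (_ * _ * _).
    by have := congr1 (fun Q : 'M[R]_n => Q i l) MV; rewrite !mxE.
  apply: eq_bigr => k _; rewrite AE /rt !mulr_sumr; apply: eq_bigr => l _.
  have -> : e ^+ n = e ^+ k * (e * e ^+ (n.-1 - k)).
    rewrite -exprS -exprD; congr (e ^+ _).
    by have := ltn_ord k; case: (n) k => [[]//|m] k /= km; rewrite -subSn// subnKC// ltnW.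
  by ring.
have detA : \det A = \det M * \prod_(k < n) e ^+ k.
  by rewrite det_mulmx det_diag; congr (_ * _); apply: eq_bigr => k _; rewrite mxE.
have p0 : 0 < \prod_(k < n) e ^+ k by rewrite prodr_gt0// => k _; rewrite exprn_gt0.
rewrite FA (altJ_det _ b0 dG) detA -mulrBr normrM normrM (gtr0_norm p0).
have L := altJ_lipschitz b0 C'1 (mulr_ge0 (ltW e0) (mulr_ge0 S0 C0)) dG dg' dGg.
apply: le_trans (ler_wpM2l _ L) _; first by rewrite mulr_ge0// ltW.
by rewrite le_eqVlt; apply/orP; left; apply/eqP; ring.
Qed.

End alternating.

(** * An alternating sum of nested reciprocals *)

Section symmetrization.
Context (R : realFieldType).

Lemma sum_lift_perm n (f : 'S_n.+1 -> R) :
  \sum_s f s = \sum_m \sum_(s : 'S_n) f (lift_perm ord_max m s).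
Proof.
rewrite pair_bigA /= (reindex (fun p : 'I_n.+1 * 'S_n => lift_perm ord_max p.1 p.2))//.
apply: onW_bij; apply: inj_card_bij.
  move=> [m s] [m' s'] /= e.
  have mm : m = m' by rewrite -(lift_perm_id ord_max m s) e lift_perm_id.
  rewrite mm in e *; congr pair; apply/permP => k.
  apply: (@lift_inj _ m'); by rewrite -!(lift_perm_lift ord_max) e.
by rewrite card_prod card_ord !card_Sn -factS.
Qed.

(** The polynomial prod_i (X + a_i) - prod_i (X - a_i) has degree at most n and
equals 2 a_m prod_k (a_m + a_k) at a_m; comparing its coefficient of X^n with that
of its Lagrange interpolant at the a_m gives twice the identity. *)
Lemma lagrange_sum n (a : 'I_n.+1 -> R) : injective a ->
  \sum_m a m * \prod_(k < n) ((a m + a (lift m k)) / (a m - a (lift m k))) =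
  \sum_m a m.
Proof.
move=> inj_a.
pose P : {poly R} := \prod_i ('X - (- a i)%:P) - \prod_i ('X - (a i)%:P).
pose L (m : 'I_n.+1) : {poly R} := \prod_(k < n) ('X - (a (lift m k))%:P).
pose D (m : 'I_n.+1) := \prod_(k < n) (a m - a (lift m k)).
have D0 m : D m != 0.
  apply/prodf_neq0 => k _; rewrite subr_eq0 (inj_eq inj_a).
  exact: neq_lift.
have Pa m : P.[a m] = 2 * a m * \prod_(k < n) (a m + a (lift m k)).
  rewrite /P hornerD hornerN !horner_prod [X in _ - X](bigD1 m)//= hornerXsubC subrr.
  rewrite mul0r subr0 (bigD1_ord m)//= !hornerXsubC opprK; congr (_ * _); first ring.
  by apply: eq_bigr => k _; rewrite hornerXsubC opprK.
have La m j : (L m).[a j] = if j == m then D m else 0.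
  rewrite /L horner_prod; case: (unliftP m j) => [k ->|->].
    rewrite eq_sym (negbTE (neq_lift m k)) (bigD1 k)//= hornerXsubC subrr.
    by rewrite mul0r.
  by rewrite eqxx; apply: eq_bigr => k _; rewrite hornerXsubC.
pose Q := \sum_m (P.[a m] / D m) *: L m.
pose T (c : 'I_n.+1 -> R) : {poly R} := \prod_i ('X - (c i)%:P).
have sizeT c : size (T c) = n.+2.
  by rewrite /T size_prod_XsubC /index_enum -enumT size_enum_ord.
have leadT c : (T c)`_n.+1 = 1.
  by have := lead_coef_prod_XsubC (index_enum 'I_n.+1) xpredT c;
    rewrite -/(T c) /lead_coef sizeT.
have subT c : (T c)`_n = - \sum_i c i.
  have := @coefPn_prod_XsubC R [seq c i | i <- index_enum 'I_n.+1].
  by rewrite size_map /index_enum -enumT size_enum_ord !big_map; apply.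
have sizeP : (size P <= n.+1)%N.
  apply/leq_sizeP => j; rewrite coefB leq_eqVlt => /orP[/eqP <-|nj].
    by rewrite -/(T _) -/(T a) !leadT subrr.
  by rewrite -/(T _) -/(T a) !nth_default ?sizeT// subrr.
have sizeL m : size (L m) = n.+1.
  by rewrite /L size_prod_XsubC /index_enum -enumT size_enum_ord.
have PQ : P = Q.
  apply/eqP; rewrite -subr_eq0; apply/eqP.
  apply: (@roots_geq_poly_eq0 _ _ [seq a i | i <- enum 'I_n.+1]).
  - apply/allP => _ /mapP[j _ ->]; rewrite /root hornerD hornerN /Q horner_sum.
    rewrite (bigD1 j)//= hornerZ La eqxx divfK// big1 ?addr0 ?subrr// => m mj.
    by rewrite hornerZ La eq_sym (negbTE mj) mulr0.
  - by rewrite map_inj_uniq// enum_uniq.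
  rewrite size_map size_enum_ord; apply: leq_trans (size_polyD _ _) _.
  rewrite geq_max sizeP size_polyN /=.
  apply: leq_trans (size_sum _ _ _) _; apply/bigmax_leqP => m _.
  by apply: leq_trans (size_scale_leq _ _) _; rewrite sizeL.
have coefP : P`_n = 2 * \sum_m a m.
  by rewrite coefB -/(T _) -/(T a) !subT sumrN; ring.
have coefQ : Q`_n = \sum_m P.[a m] / D m.
  rewrite /Q coef_sum; apply: eq_bigr => m _; rewrite coefZ.
  suff -> : (L m)`_n = 1 by rewrite mulr1.
  have := lead_coef_prod_XsubC (index_enum 'I_n) xpredT (fun k => a (lift m k)).
  by rewrite -/(L m) /lead_coef sizeL.
suff e : 2 * (\sum_m a m * \prod_(k < n) ((a m + a (lift m k)) / (a m - a (lift m k))))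
    = 2 * \sum_m a m by apply: (mulfI _ e); rewrite pnatr_eq0.
rewrite -coefP PQ coefQ mulr_sumr; apply: eq_bigr => m _.
by rewrite Pa prodf_div; ring.
Qed.

(** The product in the formula for Schur's Pfaffian. *)
Definition vand n (a : 'I_n -> R) : R :=
  \prod_(i < n) \prod_(j < n | (i < j)%N) ((a j - a i) / (a i + a j)).

Lemma sign_above n (m : nat) : (m <= n)%N ->
  \prod_(k < n) (-1) ^+ (m <= k)%N = (-1) ^+ (n - m) :> R.
Proof.
elim: n => [|n IHn] mn; first by rewrite big_ord0 sub0n.
rewrite big_ord_recr /=; move: mn; rewrite leq_eqVlt => /orP[/eqP ->|].
  rewrite ltnn expr0 mulr1 subnn expr0 big1// => k _.
  by rewrite leqNgt (ltn_trans (ltn_ord k))// expr0.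
by rewrite ltnS => mn; rewrite IHn// mn subSn// exprSr.
Qed.

(** Taking out the index m: the pairs (m, k) with k > m appear in the opposite
order and there are n - m of them. *)
Lemma vand_lift n (a : 'I_n.+1 -> R) (m : 'I_n.+1) :
  (forall i, 0 < a i) ->
  vand a = (-1) ^+ (n - m) * \prod_(k < n) ((a m - a (lift m k)) / (a m + a (lift m k)))
    * vand (fun k => a (lift m k)).
Proof.
move=> a0; pose g (i j : 'I_n.+1) := if (i < j)%N then (a j - a i) / (a i + a j) else 1.
have vE : vand a = \prod_i \prod_j g i j.
  by apply: eq_bigr => i _; rewrite big_mkcond.
rewrite vE (bigD1_ord m)//= (bigD1_ord m)//= {1}/g ltnn mul1r.
under [X in _ * X = _]eq_bigr do rewrite (bigD1_ord m)//=.
rewrite big_split/= mulrA; congr (_ * _); last first.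
  apply: eq_bigr => k _; rewrite [RHS]big_mkcond; apply: eq_bigr => l _.
  rewrite /g /=; congr (if _ then _ else _); rewrite /bump.
  by case: (leqP m k) (leqP m l) => [mk|km] [ml|lm]; rewrite ?add1n ?add0n ?ltnS//; lia.
rewrite -sign_above; last by rewrite -ltnS.
rewrite -!big_split/=; apply: eq_bigr => k _.
have ne : a m + a (lift m k) != 0 by rewrite gt_eqF// addr_gt0.
have ne' : a (lift m k) + a m != 0 by rewrite addrC.
rewrite /g /= /bump; case: (leqP m k) => mk /=.
  rewrite add1n ltnS mk ltnNge ltnW//= expr1; first by field.
rewrite add0n ltnNge (ltnW mk)/= mk expr0; by field.
Qed.

(** One over the product of the sums of all nonempty tails of l. *)
Fixpoint invsums (l : seq R) : R :=
  if l is b :: l' then (\sum_(x <- l) x)^-1 * invsums l' else 1.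

Lemma rev_enum_ordS n :
  rev (enum 'I_n.+1) = ord_max :: [seq lift ord_max i | i <- rev (enum 'I_n)].
Proof.
rewrite enum_ordSr rev_rcons map_rev; congr (_ :: rev _).
by apply: eq_map => i; apply: val_inj; rewrite /= /bump leqNgt ltn_ord.
Qed.

(** Induction on n, sorting the permutations by the image m of the last index,
which is the head of the list: its factor is the inverse of the full sum for every
m, and the remaining sum over m is lagrange_sum. *)
Theorem alternating_invsums n (a : 'I_n -> R) :
  (forall i, 0 < a i) -> injective a ->
  \sum_(s : 'S_n) (-1) ^+ s * invsums [seq a (s i) | i <- rev (enum 'I_n)] =
  (\prod_i (a i)^-1) * vand a.
Proof.
elim: n a => [|n IHn] a a0 inj_a.
  rewrite (bigD1 1%g)//= big1 ?addr0 => [|s]; last first.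
    by case/eqP; apply/permP => -[].
  rewrite odd_perm1 expr0 mul1r /vand !big_ord0 mulr1.
  have -> // : rev (enum 'I_0) = [::].
  by apply: size0nil; rewrite size_rev size_enum_ord.
rewrite sum_lift_perm.
have sum0 : 0 < \sum_i a i.
  by rewrite big_ord_recl ltr_pwDl// sumr_ge0// => i _; exact: ltW.
transitivity ((\sum_i a i)^-1 * \sum_(m < n.+1) ((-1) ^+ (n - m) *
    ((\prod_k (a (lift m k))^-1) * vand (fun k => a (lift m k))))).
  rewrite mulr_sumr; apply: eq_bigr => m _.
  rewrite -IHn => [|k|k l /inj_a/lift_inj//]; last exact: a0.
  rewrite mulr_sumr mulr_sumr; apply: eq_bigr => s _.
  rewrite rev_enum_ordS /= lift_perm_id -map_comp.
  rewrite (eq_map (_ : _ =1 (fun i => a (lift m (s i))))); last first.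
    by move=> i; rewrite /= lift_perm_lift.
  rewrite odd_lift_perm !signr_addb !signr_odd /=.
  have -> : \sum_(x <- a m :: [seq a (lift m (s i)) | i <- rev (enum 'I_n)]) x =
      \sum_i a i.
    rewrite big_cons big_map big_rev big_enum/= [RHS](bigD1_ord m)//=.
    by congr (_ + _); rewrite [RHS](reindex_perm s).
  have -> : (-1) ^+ n * (-1) ^+ m = (-1) ^+ (n - m) :> R.
    rewrite -{1}(subnK (_ : (m <= n)%N)); last by rewrite -ltnS.
    by rewrite exprD -mulrA -expr2 sqrr_sign mulr1.
  by rewrite mulrCA -!mulrA.
apply: (mulfI (lt0r_neq0 sum0)); rewrite mulrA mulfV ?gt_eqF// mul1r.
rewrite -[in RHS]lagrange_sum// mulr_suml; apply: eq_bigr => m _.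
rewrite (vand_lift m a0) (bigD1_ord m (F := fun i => (a i)^-1))//=.
have am : a m != 0 by rewrite gt_eqF.
have -> : \prod_(k < n) ((a m + a (lift m k)) / (a m - a (lift m k))) =
  (\prod_(k < n) ((a m - a (lift m k)) / (a m + a (lift m k))))^-1.
  by rewrite -prodfV; apply: eq_bigr => k _; rewrite invf_div.
have : \prod_(k < n) ((a m - a (lift m k)) / (a m + a (lift m k))) != 0.
  apply/prodf_neq0 => k _; apply: mulf_neq0.
    by rewrite subr_eq0 (inj_eq inj_a) neq_lift.
  by rewrite invr_eq0 gt_eqF// addr_gt0.
move: (\prod_(k < n) (_ / _)) => p p0.
by field; rewrite am p0.
Qed.

End symmetrization.

(** * Taylor remainders of the exponential *)

Section exponential_series.
Context (R : realType).
Implicit Types z : R.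

Let S (z : R) (m : nat) := \sum_(k < m) z ^+ k / k`!%:R.

Lemma expR_partial_sum z m : 0 <= z -> S z m <= expR z.
Proof.
move=> z0; have nd : nondecreasing_seq (series (exp_coeff z)).
  apply/nondecreasing_seqP => k; rewrite /series /= big_nat_recr//= lerDl.
  exact: exp_coeff_ge0.
have := nondecreasing_cvgn_le nd (is_cvg_series_exp_coeff z) m.
by rewrite /series /= big_mkord.
Qed.

Lemma exp_term_le z k : 0 <= z -> z ^+ k <= k`!%:R * expR z.
Proof.
move=> z0; have := expR_partial_sum k.+1 z0; rewrite /S big_ord_recr/= => h.
rewrite mulrC -ler_pdivrMr ?ltr0n ?fact_gt0//; apply: le_trans h.
by rewrite lerDr sumr_ge0// => i _; rewrite divr_ge0// exprn_ge0.
Qed.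

Lemma partial_sum_diff z m N :
  `|S z (m + N) - S z m| <= `|z| ^+ m * S `|z| N.
Proof.
rewrite /S big_split_ord/= addrAC subrr add0r; apply: le_trans (ler_norm_sum _ _ _) _.
rewrite mulr_sumr; apply: ler_sum => k _.
rewrite normrM normrX exprD normfV normr_nat -mulrA ler_wpM2l ?exprn_ge0//.
rewrite ler_wpM2l ?exprn_ge0// lef_pV2 ?posrE ?ltr0n ?fact_gt0// ler_nat.
exact: leq_fact (leq_addl m k).
Qed.

Lemma expR_taylor z m : `|expR z - S z m| <= `|z| ^+ m * expR `|z|.
Proof.
have cS : (fun N => S z (m + N)) @ \oo --> expR z.
  have : series (exp_coeff z) @ \oo --> expR z by exact: is_cvg_series_exp_coeff.
  rewrite -(cvg_shiftn m) => h.
  rewrite (_ : (fun N => S z (m + N)) = [sequence series (exp_coeff z) (N + m)%N]_N)//.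
  by apply/funext => N; rewrite /series /= big_mkord addnC.
have c1 : (fun N => `|S z (m + N) - S z m|) @ \oo --> `|expR z - S z m|.
  by apply: cvg_norm; apply: cvgB; [exact: cS|exact: cvg_cst].
apply: (cvgr_to_le c1); apply: nearW => N.
apply: le_trans (partial_sum_diff z m N) _.
by rewrite ler_wpM2l ?exprn_ge0// expR_partial_sum.
Qed.

Lemma sinh_taylor z n : 0 <= z ->
  `|(expR z - expR (- z)) / 2 - \sum_(k < n) z ^+ (2 * k + 1) / (2 * k + 1)`!%:R| <=
  z ^+ (2 * n + 1) * expR z.
Proof.
move=> z0.
have e : \sum_(k < n) z ^+ (2 * k + 1) / (2 * k + 1)`!%:R =
    (S z (2 * n + 1) - S (- z) (2 * n + 1)) / 2.
  elim: n => [|n IHn].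
    by rewrite big_ord0 /S !big_ord_recl !big_ord0 !expr0 subrr mul0r.
  rewrite big_ord_recr /= IHn /S (_ : 2 * n.+1 + 1 = (2 * n + 1).+2)%N; last by lia.
  rewrite !big_ord_recr /=.
  have -> : (- z) ^+ (2 * n + 1) = - z ^+ (2 * n + 1).
    by rewrite exprNn exprD exprM sqrrN !expr1n mul1r expr1 mulN1r.
  have -> : (- z) ^+ (2 * n + 1).+1 = z ^+ (2 * n + 1).+1.
    rewrite exprNn (_ : (2 * n + 1).+1 = 2 * n.+1)%N; last by lia.
    by rewrite !exprM sqrrN !expr1n mul1r.
  move: (\sum_(i < 2 * n + 1) _) (\sum_(i < 2 * n + 1) _) => a b.
  by field; rewrite !pnatr_eq0 -!lt0n !fact_gt0.
have h1 := expR_taylor z (2 * n + 1); have h2 := expR_taylor (- z) (2 * n + 1).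
rewrite normrN in h2; rewrite (ger0_norm z0) in h1 h2.
rewrite e (_ : _ - _ = ((expR z - S z (2 * n + 1)) - (expR (- z) - S (- z) (2 * n + 1))) / 2); last by ring.
rewrite normrM (ger0_norm (_ : 0 <= 2^-1)) ?invr_ge0//.
rewrite ler_pdivrMr//; apply: le_trans (ler_normB _ _) _.
by apply: le_trans (lerD h1 h2) _; rewrite mulr_natr mulr2n.
Qed.

End exponential_series.

(** * The alternating integral of odd Gaussian monomials *)

Section gaussian_moments.
Context (R : realType).
Local Notation mu := (@lebesgue_measure R).
Local Notation pos := (`]0, +oo[%classic : set R).

(** The inner integral is a multiple of exp(- S y^2), where S is the sum of the
remaining parameters; multiplied by the next bump, it is again a bump. *)
Lemma iterJ_gbumps (bs : seq R) y : 0 <= y -> (forall b, b \in bs -> 0 < b) ->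
  iterJ [seq gbump b | b <- bs] y =
  (\prod_(b <- bs) b) * invsums bs * expR (- ((\sum_(b <- bs) b) * y ^+ 2)).
Proof.
elim: bs y => [|b bs IHbs] y y0 bs0 /=.
  by rewrite !big_nil mul0r oppr0 expR0 !mulr1.
have b0 : 0 < b by apply: bs0; rewrite mem_head.
have bs0' c : c \in bs -> 0 < c by move=> cbs; apply: bs0; rewrite inE cbs orbT.
rewrite !big_cons; set p := \prod_(j <- bs) j; set S := \sum_(j <- bs) j.
have S0 : 0 <= S by rewrite /S big_seq sumr_ge0// => c /bs0'/ltW.
have bS : 0 < b + S by rewrite ltr_pwDl.
transitivity (\int[mu]_(x in pos)
    (p * invsums bs * (b / (b + S)) * ((y < x)%R%:R * gbump (b + S) x))).
  apply: eq_Rintegral => x /set_mem; rewrite /= in_itv/= andbT => x0.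
  rewrite (IHbs _ (ltW x0) bs0') -/p -/S /gbump.
  have -> : expR (- ((b + S) * x ^+ 2)) = expR (- (b * x ^+ 2)) * expR (- (S * x ^+ 2)).
    by rewrite -expRD mulrDl opprD.
  move: (expR _) (expR _) (invsums bs) => u v z.
  by field; rewrite gt_eqF.
rewrite RintegralZl//; last first.
- have dB : dominated (b + S) 1 (gbump (b + S)).
    split; first exact: measurable_gbump.
    by move=> x x0; rewrite mul1r ger0_norm// gbump_ge0// ltW.
  have k1 x : 0 < x -> `|(cst 1 : R -> R) x| <= 1 by rewrite normr1.
  have mk : measurable_fun setT (cst 1 : R -> R) by exact: measurable_cst.
  have := integrable_cut y bS dB mk k1.
  by apply: eq_integrable => // x _; rewrite /= mulr1.
rewrite Rintegral_gbump_tail//.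
by field; rewrite gt_eqF.
Qed.

Lemma altJ_gbumps n (b : 'I_n -> R) : (forall i, 0 < b i) -> injective b ->
  altJ (fun i => gbump (b i)) = vand b.
Proof.
move=> b0 inj_b; rewrite /altJ.
transitivity ((\prod_i b i) * \sum_(s : 'S_n) (-1) ^+ s *
    invsums [seq b (s i) | i <- rev (enum 'I_n)]).
  rewrite mulr_sumr; apply: eq_bigr => s _.
  have := @iterJ_gbumps [seq b (s i) | i <- rev (enum 'I_n)] 0 (lexx 0) _.
  rewrite -map_comp => ->; last by move=> _ /mapP[i _ ->].
  rewrite expr0n mulr0 oppr0 expR0 mulr1 big_map big_rev big_enum /=.
  by rewrite mulrCA; congr (_ * _); rewrite [RHS](reindex_perm s).
rewrite alternating_invsums// mulrA -big_split/= big1 ?mul1r// => i _.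
by rewrite mulfV// gt_eqF.
Qed.

(** The odd Gaussian monomials.  The power of al makes gmono al k x dx invariant
under the scaling that takes al to 1. *)
Definition gmono (al : R) (k : nat) (x : R) : R :=
  al ^+ k.+1 * x ^+ (2 * k + 1) * expR (- (al * x ^+ 2 / 2)).

Lemma measurable_gmono al k : measurable_fun setT (gmono al k).
Proof.
apply: measurable_funM.
  by apply: measurable_funM => //; apply: measurable_funX.
apply: measurableT_comp => //; apply: measurableT_comp => //.
apply: measurable_funM => //; apply: measurable_funM => //.
Qed.

Lemma quarter_gauss (al x : R) (v := al * x ^+ 2 / 2) :
  2 * gbump (al / 4) x = al * x * expR (- (v / 2)).
Proof. by rewrite /gbump /v (_ : al / 4 * x ^+ 2 = al * x ^+ 2 / 2 / 2); field. Qed.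

Lemma power_le_exp (u c : R) k : 0 <= u -> 0 <= c ->
  (c * u) ^+ k <= c ^+ k * k`!%:R * expR u.
Proof.
by move=> u0 c0; rewrite exprMn -mulrA ler_wpM2l ?exprn_ge0// exp_term_le.
Qed.

(** Large enough to dominate both the monomials and the Taylor remainders of the
bumps below, uniformly in al and in the small parameter. *)
Definition gconst (n : nat) : R := 2 * ((4 * n.+1%:R) ^+ n * n`!%:R).

Lemma gconst_ge n : 2 * (4 ^+ n * n`!%:R) <= gconst n.
Proof.
rewrite ler_wpM2l// ler_wpM2r// lerXn2r ?nnegrE ?mulr_ge0//.
by rewrite ler_peMr// ler1n.
Qed.

Lemma gconst_ge1 n : 1 <= gconst n.
Proof.
apply: le_trans (gconst_ge n); rewrite -[leLHS]mul1r ler_pM// ?ler1n//.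
by rewrite -natrX -natrM ler1n muln_gt0 expn_gt0 fact_gt0.
Qed.

(** Half of the Gaussian decay absorbs the powers of x. *)
Lemma dominated_gmono n al (k : 'I_n) : 0 < al ->
  dominated (al / 4) (gconst n) (gmono al k).
Proof.
move=> al0; split; first exact: measurable_gmono.
move=> x x0; apply: (@le_trans _ _ (2 * (4 ^+ n * n`!%:R) * gbump (al / 4) x)); last first.
  by rewrite ler_wpM2r ?gconst_ge// gbump_ge0 ?ltW// divr_gt0.
set v := al * x ^+ 2 / 2.
have v0 : 0 <= v / 2 by rewrite /v !divr_ge0// mulr_ge0 ?sqr_ge0// ltW.
have ax : 0 <= al * x by rewrite mulr_ge0// ltW.
have -> : gmono al k x = al * x * ((4 * (v / 2)) ^+ k * expR (- (v / 2)) * expR (- (v / 2))).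
  have E : expR (- (al * x ^+ 2 / 2)) = expR (- (v / 2)) * expR (- (v / 2)).
    by rewrite -expRD; congr expR; rewrite /v; field.
  rewrite /gmono E (_ : 4 * (v / 2) = al * x ^+ 2); last by rewrite /v; field.
  move: (expR _) => u; rewrite exprMn -exprM exprS exprD expr1; ring.
have N0 : 0 <= (4 * (v / 2)) ^+ k by rewrite exprn_ge0// mulr_ge0.
rewrite ger0_norm; last by rewrite mulr_ge0// mulr_ge0 ?expR_ge0// mulr_ge0 ?expR_ge0.
rewrite (_ : 2 * _ * _ = al * x * ((4 ^+ n * n`!%:R) * expR (- (v / 2)))); last first.
  by rewrite mulrAC quarter_gauss -/v; ring.
rewrite ler_wpM2l// ler_wpM2r ?expR_ge0//.
apply: (@le_trans _ _ (4 ^+ k * k`!%:R)).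
  rewrite expRN ler_pdivrMr ?expR_gt0//.
  exact: power_le_exp.
rewrite ler_pM// ?ler_nat ?leq_fact 1?ltnW// ler_weXn2l ?ler1n//.
exact: ltnW.
Qed.

Lemma det_scaled_Vandermonde n (c x : 'I_n -> R) :
  \det (\matrix_(i < n, k < n) (c k * x i ^+ k)) =
  (\prod_k c k) * \prod_(i < n) \prod_(j < n | (i < j)%N) (x j - x i).
Proof.
have -> : \matrix_(i < n, k < n) (c k * x i ^+ k) =
    (Vandermonde n (\row_i x i))^T *m diag_mx (\row_k c k).
  apply/matrixP => i k; rewrite !mxE (bigD1 k)//= !mxE eqxx mulr1n big1 ?addr0.
    by rewrite mulrC.
  by move=> j jk; rewrite !mxE (negbTE jk) mulr0n mulr0.
rewrite det_mulmx det_tr det_Vandermonde det_diag mulrC; congr (_ * _).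
  by apply: eq_bigr => k _; rewrite mxE.
by apply: eq_bigr => i _; apply: eq_bigr => j _; rewrite !mxE.
Qed.

Lemma cvg_bigprod (J T : Type) (l : seq J) (Q : pred J) (G : set_system T)
    (f : J -> T -> R) (a : J -> R) : Filter G ->
  (forall j, Q j -> f j x @[x --> G] --> a j) ->
  \prod_(j <- l | Q j) f j x @[x --> G] --> \prod_(j <- l | Q j) a j.
Proof. by move=> FG h; apply: (cvg_big mul_continuous). Qed.

Section constant.
Variables (n : nat) (al : R).
Hypothesis al0 : 0 < al.

Let Mx : 'M[R]_n := \matrix_(i < n, k < n) ((k`!%:R)^-1 * (- i%:R / 2) ^+ k).
Let pairs : R := \prod_(i < n) \prod_(j < n | (i < j)%N) (- 1).
Let diffs : R := \prod_(i < n) \prod_(j < n | (i < j)%N) ((j%:R - i%:R) / 2).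

Let diffs_gt0 : 0 < diffs.
Proof.
apply: prodr_gt0 => i _; apply: prodr_gt0 => j ij.
by rewrite divr_gt0// subr_gt0 ltr_nat.
Qed.

Let detMx : \det Mx = pairs * diffs / \prod_(k < n) k`!%:R.
Proof.
rewrite det_scaled_Vandermonde mulrC prodfV; congr (_ / _).
rewrite -big_split/=; apply: eq_bigr => i _; rewrite -big_split/=.
by apply: eq_bigr => j _; field.
Qed.

(** Bumps with parameters al (1 + e i) / 2 that coalesce as e -> 0, normalized so
that their leading term does not depend on i.  In the expansion of
exp(- e i al x^2 / 2), the matrix Mx collects the coefficients of e^k gmono al k. *)
Let F (e : R) (i : 'I_n) (x : R) : R :=
  (1 + e * i%:R)^-1 * gbump (al * (1 + e * i%:R) / 2) x.

Let r (e : R) (i : 'I_n) (x : R) : R :=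
  (F e i x - \sum_(k < n) e ^+ k * Mx i k * gmono al k x) / e ^+ n.

Let e1_gt0 (e : R) (i : 'I_n) : 0 < e -> 0 < 1 + e * i%:R.
Proof. by move=> e0; rewrite ltr_pwDl// mulr_ge0// ltW. Qed.

Let FE (e : R) (i : 'I_n) x : 0 < e ->
  F e i x = al * x * expR (- (al * x ^+ 2 / 2)) * expR (- (e * i%:R * (al * x ^+ 2 / 2))).
Proof.
move=> e0; rewrite /F /gbump.
have -> : expR (- (al * (1 + e * i%:R) / 2 * x ^+ 2)) =
    expR (- (al * x ^+ 2 / 2)) * expR (- (e * i%:R * (al * x ^+ 2 / 2))).
  by rewrite -expRD; congr expR; field.
move: (expR _) (expR _) => u w; field.
by rewrite gt_eqF// e1_gt0.
Qed.

Let dominated_r (e : R) (i : 'I_n) : 0 < e -> e * (4 * n.+1%:R) <= 1 ->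
  dominated (al / 4) (gconst n) (r e i).
Proof.
move=> e0 e4; split.
  apply: measurable_funM => //; apply: measurable_funB.
    by apply: measurable_funM => //; exact: measurable_gbump.
  by apply: measurable_sum => k; apply: measurable_funM => //; exact: measurable_gmono.
move=> x x0; set v := al * x ^+ 2 / 2; pose u := e * i%:R * v.
have v0 : 0 <= v by rewrite /v divr_ge0// mulr_ge0 ?sqr_ge0// ltW.
have u0 : 0 <= u by rewrite !mulr_ge0// ltW.
have i_n : i%:R <= n.+1%:R :> R.
  by rewrite ler_nat; exact: leq_trans (ltnW (ltn_ord i)) (leqnSn n).
have i4 : e * i%:R <= 4^-1.
  have : e * (4 * i%:R) <= 1.
    by apply: le_trans e4; rewrite ler_pM2l// ler_pM2l.
  by move=> h; rewrite -[leRHS]mul1r ler_pdivlMr// -mulrA (mulrC _ 4).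
have uv : u <= v / 4 by rewrite /u mulrC ler_wpM2l.
have ax : 0 <= al * x by rewrite mulr_ge0// ltW.
have en : 0 < e ^+ n by rewrite exprn_gt0.
have sumE : \sum_(k < n) e ^+ k * Mx i k * gmono al k x =
    al * x * expR (- v) * \sum_(k < n) (- u) ^+ k / k`!%:R.
  rewrite mulr_sumr; apply: eq_bigr => k _; rewrite mxE /gmono -/v.
  rewrite (_ : - u = e * ((- i%:R / 2) * (al * x ^+ 2))); last by rewrite /u /v; field.
  rewrite !exprMn exprS exprD mul2n -addnn exprD expr1; move: (expR _) => w.
  by field; rewrite pnatr_eq0 -lt0n fact_gt0.
have h := expR_taylor (- u) n; rewrite normrN (ger0_norm u0) in h.
rewrite /r FE// -/v -/u sumE -mulrBr normrM normfV (gtr0_norm en).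
rewrite ler_pdivrMr// normrM ger0_norm; last by rewrite mulr_ge0 ?expR_ge0.
apply: le_trans (ler_wpM2l _ h) _; first by rewrite mulr_ge0 ?expR_ge0.
have ie : u ^+ n <= e ^+ n * ((4 * n.+1%:R) ^+ n * n`!%:R * expR (v / 4)).
  rewrite (_ : u = e * ((4 * i%:R) * (v / 4))); last by rewrite /u; field.
  rewrite exprMn ler_pM2l//.
  have v40 : 0 <= v / 4 by rewrite divr_ge0.
  have i40 : 0 <= 4 * i%:R :> R by rewrite mulr_ge0.
  apply: le_trans (power_le_exp n v40 i40) _.
  rewrite ler_wpM2r ?expR_ge0// ler_wpM2r// lerXn2r ?nnegrE ?mulr_ge0//.
  by rewrite ler_pM2l// ler_nat ltnW// ltnW.
have eu : expR u <= expR (v / 4) by rewrite ler_expR.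
have b1 : expR (- v) * (expR (v / 4) * expR (v / 4)) = expR (- (v / 2)).
  by rewrite -!expRD; congr expR; field.
rewrite /gconst (_ : 2 * _ * _ * _ = ((4 * n.+1%:R) ^+ n * n`!%:R) *
  (2 * gbump (al / 4) x) * e ^+ n); last by ring.
rewrite quarter_gauss -/v -b1.
apply: (@le_trans _ _ (al * x * expR (- v) * (e ^+ n * ((4 * n.+1%:R) ^+ n * n`!%:R * expR (v / 4)) * expR (v / 4)))).
  apply: ler_wpM2l; first by rewrite mulr_ge0 ?expR_ge0.
  by apply: ler_pM => //; rewrite ?exprn_ge0 ?expR_ge0.
by rewrite le_eqVlt; apply/orP; left; apply/eqP; ring.
Qed.

Let b (e : R) (i : 'I_n) : R := al * (1 + e * i%:R) / 2.

Let b_gt0 (e : R) i : 0 < e -> 0 < b e i.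
Proof. by move=> e0; rewrite divr_gt0// mulr_gt0// e1_gt0. Qed.

Let dominated_b (e : R) (i : 'I_n) : 0 < e -> e * (4 * n.+1%:R) <= 1 ->
  dominated (al / 4) 4 (gbump (b e i)).
Proof.
move=> e0 e4; split; first exact: measurable_gbump.
move=> x x0; rewrite ger0_norm; last by rewrite gbump_ge0 ?b_gt0// ltW.
have ei : 0 <= e * i%:R by rewrite mulr_ge0// ltW.
have ei1 : e * i%:R <= 1.
  apply: le_trans e4; rewrite ler_pM2l//.
  have : i%:R <= n.+1%:R :> R.
    by rewrite ler_nat; exact: leq_trans (ltnW (ltn_ord i)) (leqnSn n).
  by have := ler0n R n.+1; lra.
have bal : b e i <= al by rewrite /b ler_pdivrMr// ler_pM2l//; lra.
have alb : al / 4 <= b e i.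
  by rewrite /b -mulrA ler_pM2l//; lra.
rewrite /gbump (_ : 4 * _ = 2 * al * x * expR (- (al / 4 * x ^+ 2))); last by field.
apply: ler_pM.
- by rewrite mulr_ge0 ?(ltW x0)// mulr_ge0// ltW// b_gt0.
- exact: expR_ge0.
- by rewrite ler_pM2r// ler_pM2l.
- by rewrite ler_expR lerN2 ler_wpM2r// sqr_ge0.
Qed.

(** The quotient of altJ (F e) by prod_k e^k, from altJ_gbumps. *)
Let W (e : R) : R := (\prod_(i < n) (1 + e * i%:R)^-1) *
  \prod_(i < n) \prod_(j < n | (i < j)%N) ((j%:R - i%:R) / (2 + e * (i%:R + j%:R))).

Lemma prod_pairs (e : R) :
  \prod_(i < n) \prod_(j < n | (i < j)%N) e = \prod_(k < n) e ^+ k.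
Proof.
rewrite (exchange_big_dep xpredT)//=; apply: eq_bigr => j _.
rewrite -(big_ord_widen n (fun=> e)); last exact: ltnW.
by rewrite prodr_const card_ord.
Qed.

Let altJ_F (e : R) : 0 < e -> e * (4 * n.+1%:R) <= 1 ->
  altJ (F e) = W e * \prod_(k < n) e ^+ k.
Proof.
move=> e0 e4; have a40 : 0 < al / 4 by rewrite divr_gt0.
rewrite (altJ_scale (fun i : 'I_n => (1 + e * i%:R)^-1) a40
  (fun i => dominated_b i e0 e4)).
rewrite altJ_gbumps; last 2 first.
- by move=> i; exact: b_gt0.
- move=> i j /eqP; rewrite /b -subr_eq0 -mulrBl -mulrBr mulf_eq0 invr_eq0 pnatr_eq0 orbF.
  rewrite mulf_eq0 gt_eqF//= opprD addrACA subrr add0r -mulrBr mulf_eq0 gt_eqF//=.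
  by rewrite subr_eq0 eqr_nat => /eqP/val_inj.
rewrite /W -mulrA; congr (_ * _); rewrite -prod_pairs -big_split/=.
apply: eq_bigr => i _; rewrite -big_split/=; apply: eq_bigr => j _.
have ij : 0 <= e * (i%:R + j%:R) by rewrite mulr_ge0 ?addr_ge0// ltW.
have -> : b e j - b e i = al / 2 * (e * (j%:R - i%:R)) by rewrite /b; field.
have -> : b e i + b e j = al / 2 * (2 + e * (i%:R + j%:R)) by rewrite /b; field.
rewrite -mulf_div divff ?mul1r; last by rewrite gt_eqF// divr_gt0.
by rewrite mulrAC mulrC; ring.
Qed.

Let W0 : W e @[e --> 0^'+] --> diffs.
Proof.
have -> : diffs = (\prod_(i < n) 1) *
    \prod_(i < n) \prod_(j < n | (i < j)%N) ((j%:R - i%:R) / 2).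
  by rewrite big1// mul1r.
have ce (c a : R) : a + e * c @[e --> 0^'+] --> a.
  apply/cvgrPdist_le => eps eps0; near=> e.
  have e0 : 0 < e by near: e; exact: nbhs_right_gt.
  rewrite opprD addrA subrr sub0r normrN normrM (gtr0_norm e0).
  apply: (@le_trans _ _ (e * (`|c| + 1))); first by rewrite ler_pM2l// lerDl.
  rewrite -ler_pdivlMr ?ltr_pwDr//; near: e; apply: nbhs_right_le.
  by rewrite divr_gt0// ltr_pwDr.
apply: cvgM.
  apply: cvg_bigprod => i _.
  by rewrite -[X in _ --> X]invr1; apply: cvgV; [exact: oner_neq0|exact: ce].
apply: cvg_bigprod => i _.
apply: cvg_bigprod => j _.
by apply: cvgMr; apply: cvgV; [rewrite pnatr_eq0|exact: ce].
Unshelve. all: by end_near. Qed.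

(** The quotient of altJ (F e) by prod_k e^k has two limits as e -> 0: one from
the exact formula for bumps, the other from altJ_asymp.  The product of the
-1 over the pairs i < j is only a sign. *)
Theorem altJ_gmono : altJ (fun k : 'I_n => gmono al k) = pairs * \prod_(k < n) k`!%:R.
Proof.
have fact0 : \prod_(k < n) k`!%:R != 0 :> R.
  by apply/prodf_neq0 => k _; rewrite pnatr_eq0 -lt0n fact_gt0.
have pairs2 : pairs * pairs = 1.
  by rewrite -big_split/= big1// => i _; rewrite -big_split/= big1// => j _; ring.
have pairs0 : pairs != 0.
  by apply/eqP => p0; move: pairs2; rewrite p0 mul0r => /esym/eqP; rewrite oner_eq0.
have a40 : 0 < al / 4 by rewrite divr_gt0.
have uM : Mx \in unitmx.
  by rewrite unitmxE detMx unitfE !mulf_neq0// ?invr_eq0// gt_eqF.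
have [K HK] := altJ_asymp uM (gconst_ge1 n).
have close (e : R) : 0 < e -> e * (4 * n.+1%:R) <= 1 ->
    `|W e - \det Mx * altJ (fun k : 'I_n => gmono al k)| <= K * e.
  move=> e0 e4; have p0 : 0 < \prod_(k < n) e ^+ k.
    by rewrite prodr_gt0// => k _; rewrite exprn_gt0.
  have e1 : e <= 1.
    by apply: le_trans e4; rewrite ler_peMr ?(ltW e0)// -natrM ler1n.
  have := HK e (al / 4) (F e) (fun k => gmono al k) (r e) e0 e1 a40.
  rewrite altJ_F// => /(_ _ (fun k => dominated_gmono k al0) (fun i => dominated_r i e0 e4)) h.
  rewrite -(ler_pM2r p0) -{1}(gtr0_norm p0) -normrM mulrBl.
  rewrite [leRHS]mulrAC [X in _ - X]mulrAC; apply: h => i x.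
  by rewrite /r mulrC divfK ?expf_neq0 ?gt_eqF// addrC subrK.
have c1 : W e @[e --> 0^'+] --> \det Mx * altJ (fun k : 'I_n => gmono al k).
  apply/cvgrPdist_le => eps eps0.
  have k0 : 0 < eps / (`|K| + 1) by rewrite divr_gt0// ltr_pwDr.
  have n0 : 0 < (4 * n.+1%:R)^-1 :> R by rewrite invr_gt0 mulr_gt0.
  near=> e.
  have e0 : 0 < e by near: e; exact: nbhs_right_gt.
  rewrite distrC; apply: le_trans (close e e0 _) _.
    rewrite -ler_pdivlMr ?mulr_gt0// mul1r; near: e; exact: nbhs_right_le.
  apply: (@le_trans _ _ ((`|K| + 1) * e)).
    by rewrite ler_pM2r// (le_trans (ler_norm K))// lerDl.
  rewrite mulrC -ler_pdivlMr ?ltr_pwDr//; near: e; exact: nbhs_right_le.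
have := cvg_unique _ c1 W0; rewrite detMx => h.
have {}h := h (@Rhausdorff R).
have d0 : diffs != 0 by rewrite gt_eqF.
apply: (mulfI pairs0); rewrite mulrA pairs2 mul1r.
apply: (mulfI d0); rewrite -[in RHS]h; field.
by [].
Unshelve. all: by end_near. Qed.

End constant.

End gaussian_moments.

(** * The mean of the sign at time t *)

Section reflected_density.
Context (R : realType).
Local Notation mu := (@lebesgue_measure R).
Local Notation pos := (`]0, +oo[%classic : set R).

(** The density at time s^2 of a Brownian motion started at m and killed at 0. *)
Definition reflected_pdf (m s x : R) : R := normal_pdf m s x - normal_pdf m s (- x).

Lemma measurable_reflected_pdf m s : measurable_fun setT (reflected_pdf m s).
Proof.
apply: measurable_funB; first exact: measurable_normal_pdf.
by apply: measurableT_comp; [exact: measurable_normal_pdf|exact: measurable_funN].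
Qed.

(** What chainsg leaves of its first argument v when the others have been
integrated out into h. *)
Definition odd_cut (h : R -> R) (y v : R) : R :=
  if y < `|v| then Num.sg v * h `|v| else 0.

Lemma measurable_odd_cut h y : measurable_fun setT h ->
  measurable_fun setT (odd_cut h y).
Proof.
move=> mh; have mn : measurable_fun setT (fun v : R => `|v|) by exact: measurableT_comp.
apply: measurable_fun_ifT => //.
- by apply: measurable_fun_ltr => //; exact: measurable_cst.
- apply: measurable_funM; last exact: measurableT_comp.
  exact: measurable_fun_sgr.
Qed.

Lemma odd_cut_le (h : R -> R) M y v : 0 <= M -> (forall x, 0 < x -> `|h x| <= M) ->
  0 <= y -> `|odd_cut h y v| <= M.
Proof.
move=> M0 hM y0; rewrite /odd_cut; case: ifP => [yv|_]; last by rewrite normr0.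
rewrite normrM -[leRHS]mul1r ler_pM//; last by apply: hM; exact: le_lt_trans yv.
by rewrite normr_sg; case: (_ != 0).
Qed.

Lemma odd_cutN h y v : odd_cut h y (- v) = - odd_cut h y v.
Proof. by rewrite /odd_cut normrN sgrN; case: ifP; rewrite ?mulNr ?oppr0. Qed.

Lemma normal_pdf_opp (m s x : R) : 0 < s -> normal_pdf m s (- x) = normal_pdf (- m) s x.
Proof. by move=> s0; rewrite !normal_pdfEgt0// -opprD sqrrN opprK. Qed.

(** The integrand without the density is odd, so that folding the negative
half-line onto the positive one produces the reflected density. *)
Lemma Rintegral_odd_cut (h : R -> R) (y m s M : R) : 0 < s -> 0 <= M -> 0 <= y ->
  measurable_fun setT h -> (forall x, 0 < x -> `|h x| <= M) ->
  \int[mu]_x (odd_cut h y x * normal_pdf m s x) =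
  \int[mu]_(x in pos) ((y < x)%R%:R * (reflected_pdf m s x * h x)).
Proof.
move=> s0 M0 y0 mh hM; pose k x := odd_cut h y x * normal_pdf m s x.
have mo := measurable_odd_cut y mh.
have ib (b : R -> bool) m' : measurable_fun setT b -> mu.-integrable setT
    (EFin \o (fun x => (b x)%:R * odd_cut h y x * normal_pdf m' s x)).
  move=> mb; apply: (@integrable_bounded_mul _ _ _ M).
  - by apply: measurable_funM; [exact: measurable_fun_natr|].
  - move=> x; rewrite normrM -[leRHS]mul1r ler_pM ?odd_cut_le//.
    by case: (b x); rewrite ?normr1 ?normr0.
  - exact: integrable_normal_pdf.
have mlt : measurable_fun setT (fun x : R => 0 < x) by exact: measurable_fun_ltr.
have mgt : measurable_fun setT (fun x : R => x < 0) by exact: measurable_fun_ltr.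
pose kp (x : R) := (0 < x)%R%:R * odd_cut h y x * normal_pdf m s x.
pose kn (x : R) := (x < 0)%R%:R * odd_cut h y x * normal_pdf m s x.
pose ko (x : R) := (0 < x)%R%:R * odd_cut h y x * normal_pdf (- m) s x.
have knE x : kn (- x) = - ko x.
  by rewrite /kn /ko oppr_lt0 odd_cutN normal_pdf_opp// mulrN mulNr.
have ikn : mu.-integrable setT (EFin \o (fun x => kn (- x))).
  rewrite (_ : EFin \o _ = (fun x => - (EFin \o ko) x)%E); last first.
    by apply/funext => x /=; rewrite knE EFinN.
  by apply: integrableN; exact: ib.
transitivity (\int[mu]_x (kp x + kn x)).
  apply: eq_Rintegral => x _; rewrite /kp /kn -!mulrDl.
  case: ltgtP => x0; rewrite ?mul1r ?mul0r ?add0r ?addr0 ?mul1r//.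
  by rewrite /odd_cut -x0 normr0 ltNge y0 /= !mul0r.
rewrite RintegralD//; [|exact: ib..].
rewrite -(@Rintegral_opp _ kn)//; last first.
  apply: measurable_funM; last exact: measurable_normal_pdf.
  by apply: measurable_funM => //; exact: measurable_fun_natr.
rewrite -RintegralD//; last exact: ib.
rewrite [RHS]Rintegral_mkcond; apply: eq_Rintegral => x _.
rewrite knE /patch mem_setE in_itv/= andbT /kp /ko /reflected_pdf normal_pdf_opp//.
case: ifP => x0; last by rewrite !mul0r subr0.
rewrite /odd_cut (gtr0_norm x0) gtr0_sg// !mul1r.
by case: ifP => _ /=; rewrite ?sub0r; ring.
Qed.

End reflected_density.

Section chain_law.
Context (d : measure_display) (Omega : measurableType d)
    (R : realType) (P : probability Omega R) (n : nat).
Variables (eta : 'rV[R]_n) (X : 'I_n -> R -> {RV P >-> R}).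
Hypothesis hX : brownian_motion X eta.
Variable t : R.
Hypothesis t0 : 0 < t.

Let f i := reflected_pdf (eta 0 i) (Num.sqrt t).

Let measurable_chain (l : seq 'I_n) (y : R) :
  measurable_fun setT (fun w => chainsg [seq X i t w | i <- l] y).
Proof.
by apply: (measurable_chainsg _ (f := fun i w => X i t w)) => //; exact: measurable_cst.
Qed.

Let integrable_chain (l : seq 'I_n) (y : R) :
  P.-integrable setT (EFin \o (fun w => chainsg [seq X i t w | i <- l] y)).
Proof.
apply: (@bounded_integrable _ _ _ P _ 1) => // w; exact: chainsg_le1.
Qed.

(** Induction on l: the first coordinate is independent of the others, and
resampling its increment from time 0 to time t replaces it by a Gaussian variable. *)
Lemma chain_law (l : seq 'I_n) (y : R) : uniq l -> 0 <= y ->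
  \int[P]_w chainsg [seq X i t w | i <- l] y = iterJ [seq f i | i <- l] y.
Proof.
elim: l y => [|a l IHl] y; first by rewrite /= Rintegral_cst// [X in fine X](probability_setT P) mulr1.
rewrite [uniq _]/= => /andP[al ul] y0; have [bmX _] := hX.
have [X0 _ _ _] := bmX a.
pose h := iterJ [seq f i | i <- l].
have h1 x : 0 < x -> `|h x| <= 1.
  move=> x0; rewrite /h -IHl ?(ltW x0)//.
  by apply: Rintegral_norm_le => // w; exact: chainsg_le1.
have mh : measurable_fun setT h.
  apply: measurable_iterJ => i; rewrite size_map => il.
  by rewrite (nth_map a)//; exact: measurable_reflected_pdf.
pose Om := g_sigma_algebraType (past X (fun=> 0) 0 a).
(* The first coordinate is built from the fresh variable, the others are kept. *)
pose g i (z : Om * R) := if i == a then eta 0 a + z.2 else X i t z.1.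
pose H z := chainsg [seq g i z | i <- a :: l] y.
have mH : measurable_fun setT H.
  apply: (measurable_chainsg _ (f := g)); last exact: measurable_cst.
  move=> i; rewrite /g; case: eqP => [_|/eqP ia].
    by apply: measurable_funD; [exact: measurable_cst|exact: measurable_snd].
  apply: measurableT_comp; last exact: measurable_fst.
  by apply: past_other => //; exact: ltW.
have gl z : [seq g i z | i <- l] = [seq X i t z.1 | i <- l].
  apply/eq_in_map => i il; rewrite /g ifF//; apply: contraNF al => /eqP <-; exact: il.
have HE z : H z = odd_cut (chainsg [seq X i t z.1 | i <- l]) y (eta 0 a + z.2).
  have ga : g a z = eta 0 a + z.2 by rewrite /g eqxx.
  by rewrite /odd_cut -gl -ga.
have s0 : 0 < Num.sqrt t by rewrite sqrtr_gt0.
transitivity (\int[P]_w H (w, X a t w - X a 0 w)).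
  by apply: eq_Rintegral => w _; rewrite HE /= X0 addrC subrK.
have H1 z : `|H z| <= 1 by exact: chainsg_le1.
have -> := resample_swap hX (q := fun=> 0) (k := 0%N) erefl (fun _ _ _ => lexx _) t0 mH H1.
rewrite subr0.
transitivity (\int[normal_prob 0 (Num.sqrt t)]_u odd_cut h y (eta 0 a + u)).
  apply: eq_Rintegral => u _; under eq_Rintegral do rewrite HE /=.
  rewrite /odd_cut.
  case: ifP => yu; last by rewrite Rintegral_cst// mul0r.
  by rewrite RintegralZl ?IHl.
have oc v : `|odd_cut h y v| <= 1 by exact: odd_cut_le.
rewrite (Rintegral_normal_shift s0 (eta 0 a) (measurable_odd_cut y mh) oc).
rewrite (Rintegral_normal _ _ (measurable_odd_cut y mh) oc).
by rewrite (@Rintegral_odd_cut _ _ _ _ _ 1).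
Qed.

Lemma eps_law : \int[P]_w eps (fun i => X i t w) = altJ f.
Proof.
rewrite /eps Rintegral_bigsum// => [|s]; last first.
  have := integrableZl measurableT ((-1) ^+ s) (integrable_chain [seq s i | i <- rev (enum 'I_n)] 0).
  by apply: eq_integrable => // w _; rewrite /= -map_comp.
apply: eq_bigr => s _; rewrite RintegralZl//; last first.
  have := integrable_chain [seq s i | i <- rev (enum 'I_n)] 0.
  by apply: eq_integrable => // w _; rewrite /= -map_comp.
congr (_ * _).
have := @chain_law [seq s i | i <- rev (enum 'I_n)] 0 _ (lexx 0).
rewrite -map_comp => <-; last by rewrite (map_inj_uniq perm_inj) rev_uniq enum_uniq.
by apply: eq_Rintegral => w _; rewrite -map_comp.
Qed.

End chain_law.

(** * The asymptotics of the alternating integral *)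

Section reflected_asymptotics.
Context (R : realType).

(** The reflected density with variance 1 / al, up to a factor free of x. *)
Definition odd_gauss (al m x : R) : R :=
  expR (- (al * x ^+ 2 / 2)) * ((expR (al * m * x) - expR (- (al * m * x))) / 2) / m.

Definition odd_gauss_const (N : nat) (m : R) : R :=
  2 * (m ^+ (2 * N) * 8 ^+ N * N`!%:R * expR (2 * m ^+ 2)).

Lemma reflected_pdfE (m t x : R) : 0 < m -> 0 < t ->
  reflected_pdf m (Num.sqrt t) x =
  2 * m * normal_peak (Num.sqrt t) * expR (- (t^-1 * m ^+ 2 / 2)) * odd_gauss t^-1 m x.
Proof.
move=> m0 t0; have s0 : 0 < Num.sqrt t by rewrite sqrtr_gt0.
rewrite /reflected_pdf !normal_pdfEgt0// sqr_sqrtr ?(ltW t0)// /odd_gauss.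
have tn : t != 0 by rewrite gt_eqF.
have E (a : R) : - (a * x - m) ^+ 2 / (t *+ 2) = - (t^-1 * m ^+ 2 / 2) +
    (- (t^-1 * (a * x) ^+ 2 / 2) + t^-1 * m * (a * x)) by field.
have e1 := E 1; have e2 := E (-1).
rewrite !mul1r in e1; rewrite !mulN1r sqrrN mulrN in e2.
rewrite e1 e2 !expRD; move: (normal_peak _) (expR _) (expR _) (expR _) (expR _) => p a b c d.
by field; rewrite gt_eqF.
Qed.

(** The argument al m x of the hyperbolic sine is at most
al x^2 / 8 + 2 al m^2, so that the Gaussian factor absorbs both the exponential and
the powers of x in the Taylor remainder. *)
Lemma odd_gauss_expansion (al m x : R) N : 0 < al -> al <= 1 -> 0 < m -> 0 < x ->
  `|odd_gauss al m x -
    \sum_(k < N) al ^+ k * (((2 * k + 1)`!%:R)^-1 * (m ^+ 2) ^+ k) * gmono al k x| <=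
  al ^+ N * (odd_gauss_const N m * gbump (al / 4) x).
Proof.
move=> al0 al1 m0 x0; set v := al * x ^+ 2 / 2; set z := al * m * x.
have z0 : 0 <= z by rewrite !mulr_ge0// ltW.
have v0 : 0 <= v / 4 by rewrite /v !divr_ge0// mulr_ge0 ?sqr_ge0// ltW.
have E0 : 0 <= expR (- v) / m by rewrite divr_ge0 ?expR_ge0// ltW.
have -> : \sum_(k < N) al ^+ k * (((2 * k + 1)`!%:R)^-1 * (m ^+ 2) ^+ k) * gmono al k x =
    expR (- v) / m * \sum_(k < N) z ^+ (2 * k + 1) / (2 * k + 1)`!%:R.
  rewrite mulr_sumr; apply: eq_bigr => k _; rewrite /gmono -/v /z.
  rewrite -exprM !exprMn !exprD !expr1 expr0 exprS.
  move: (expR _) => w; field.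
  by rewrite pnatr_eq0 -lt0n fact_gt0 gt_eqF.
have -> : odd_gauss al m x = expR (- v) / m * ((expR z - expR (- z)) / 2).
  by rewrite /odd_gauss -/v -/z; ring.
rewrite -mulrBr normrM (ger0_norm E0).
apply: le_trans (ler_wpM2l E0 (sinh_taylor N z0)) _.
have ez : expR z <= expR (v / 4) * expR (2 * m ^+ 2).
  rewrite -expRD ler_expR.
  have h : z <= al * (x ^+ 2 / 8 + 2 * m ^+ 2).
    rewrite /z -mulrA ler_pM2l//.
    by have := sqr_ge0 (x / 4 - m); nra.
  apply: le_trans h _; rewrite mulrDr lerD//.
    by rewrite /v le_eqVlt; apply/orP; left; apply/eqP; field.
  by rewrite ler_piMl// mulr_ge0 ?sqr_ge0.
have xv : (al * x ^+ 2) ^+ N <= 8 ^+ N * N`!%:R * expR (v / 4).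
  rewrite (_ : al * x ^+ 2 = 8 * (v / 4)); last by rewrite /v; field.
  exact: power_le_exp.
have -> : expR (- v) / m * (z ^+ (2 * N + 1) * expR z) =
    (al ^+ N * m ^+ (2 * N) * (al * x * expR (- v))) * ((al * x ^+ 2) ^+ N * expR z).
  rewrite /z exprD expr1 !exprMn !exprD expr0.
  move: (expR _) (expR _) => w u; field; by rewrite gt_eqF.
have h0 : 0 <= al ^+ N * m ^+ (2 * N) * (al * x * expR (- v)).
  by rewrite !mulr_ge0 ?exprn_ge0 ?expR_ge0// ltW.
have xv0 : 0 <= (al * x ^+ 2) ^+ N by rewrite exprn_ge0// mulr_ge0 ?sqr_ge0// ltW.
apply: le_trans (ler_wpM2l h0 (ler_pM xv0 (expR_ge0 _) xv ez)) _.
have b1 : expR (- v) * (expR (v / 4) * expR (v / 4)) = expR (- (v / 2)).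
  by rewrite -!expRD; congr expR; field.
rewrite /odd_gauss_const (_ : 2 * _ * _ = (m ^+ (2 * N) * 8 ^+ N * N`!%:R * expR (2 * m ^+ 2)) *
  (2 * gbump (al / 4) x)); last by ring.
rewrite quarter_gauss -/v -b1 le_eqVlt; apply/orP; left; apply/eqP.
by move: (expR (- v)) (expR (v / 4)) (expR (2 * m ^+ 2)) => a b c; ring.
Qed.

Lemma measurable_odd_gauss al m : measurable_fun setT (odd_gauss al m).
Proof.
have mx : measurable_fun setT (fun x : R => expR (al * m * x)).
  by apply: measurableT_comp => //; apply: measurable_funM.
have mx2 : measurable_fun setT (fun x : R => expR (- (al * m * x))).
  apply: measurableT_comp => //; apply: measurableT_comp => //; exact: measurable_funM.
apply: measurable_funM => //; apply: measurable_funM.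
  apply: measurableT_comp => //; apply: measurableT_comp => //.
  by apply: measurable_funM => //; apply: measurable_funM => //.
by apply: measurable_funM => //; exact: measurable_funB.
Qed.

Lemma dominated_odd_gauss (al m : R) : 0 < al -> al <= 1 -> 0 < m ->
  dominated (al / 4) (odd_gauss_const 0 m) (odd_gauss al m).
Proof.
move=> al0 al1 m0; split; first exact: measurable_odd_gauss.
move=> x x0; have := odd_gauss_expansion 0 al0 al1 m0 x0.
by rewrite big_ord0 subr0 expr0 mul1r.
Qed.

Section limit.
Variables (n : nat) (y : 'I_n -> R).
Hypotheses (y0 : forall i, 0 < y i) (y_inj : injective y).

Let M : 'M[R]_n :=
  \matrix_(i < n, k < n) (((2 * k + 1)`!%:R)^-1 * (y i ^+ 2) ^+ k).

Let unit_M : M \in unitmx.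
Proof.
rewrite unitmxE det_scaled_Vandermonde unitfE mulf_neq0//.
  by apply/prodf_neq0 => k _; rewrite invr_eq0 pnatr_eq0 -lt0n fact_gt0.
apply/prodf_neq0 => i _; apply/prodf_neq0 => j ij.
rewrite subr_eq0 eqrXn2 ?ltW//; apply/eqP => /y_inj ji.
by move: ij; rewrite ji ltnn.
Qed.

Let C : R := gconst R n + \sum_(i < n) odd_gauss_const n (y i).

Let odd_gauss_const_ge0 N i : 0 <= odd_gauss_const N (y i).
Proof. by rewrite !mulr_ge0 ?exprn_ge0 ?expR_ge0 ?(ltW (y0 i)). Qed.

Let C_ge i : odd_gauss_const n (y i) <= C.
Proof.
rewrite /C (bigD1 i)//= addrCA lerDl addr_ge0 ?sumr_ge0//.
by apply: le_trans (gconst_ge1 R n).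
Qed.

Let C_ge_gconst : gconst R n <= C.
Proof. by rewrite lerDl sumr_ge0. Qed.

Lemma altJ_odd_gauss_expansion : exists K, forall al, 0 < al -> al <= 1 ->
  `|altJ (fun i => odd_gauss al (y i)) / (\prod_(k < n) al ^+ k) -
    \det M * altJ (fun k : 'I_n => gmono al k)| <= K * al.
Proof.
have [K HK] := altJ_asymp unit_M (le_trans (gconst_ge1 R n) C_ge_gconst).
exists K => al al0 al1.
have p0 : 0 < \prod_(k < n) al ^+ k by rewrite prodr_gt0// => k _; rewrite exprn_gt0.
have a40 : 0 < al / 4 by rewrite divr_gt0.
have aln : 0 < al ^+ n by rewrite exprn_gt0.
pose r (i : 'I_n) x := (odd_gauss al (y i) x -
  \sum_(k < n) al ^+ k * M i k * gmono al k x) / al ^+ n.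
rewrite -(ler_pM2r p0) -{2}(gtr0_norm p0) -normrM mulrBl divfK ?gt_eqF//.
rewrite [leRHS]mulrAC [X in _ - X]mulrAC.
apply: (HK al (al / 4) _ _ r al0 al1 a40) => [i x|k|i].
- by rewrite /r mulrC divfK ?gt_eqF// addrC subrK.
- exact: dominated_le a40 C_ge_gconst (dominated_gmono k al0).
- split.
    apply: measurable_funM => //; apply: measurable_funB; first exact: measurable_odd_gauss.
    by apply: measurable_sum => k; apply: measurable_funM => //; exact: measurable_gmono.
  move=> x x0; rewrite /r; under eq_bigr do rewrite mxE.
  have := odd_gauss_expansion n al0 al1 (y0 i) x0.
  rewrite normrM normfV (gtr0_norm aln) ler_pdivrMr// [leRHS]mulrC.
  move=> h; apply: le_trans h _; rewrite ler_pM2r// ler_wpM2r ?C_ge//.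
  by rewrite gbump_ge0// ltW.
Qed.

(** With al = 1/t, the determinant of the coefficients is a Vandermonde
determinant in the squares y_i^2, and its sign cancels that of altJ_gmono. *)
Theorem altJ_reflected_cvg :
  altJ (fun i => reflected_pdf (y i) (Num.sqrt t)) /
    ((\prod_(i < n) (2 * y i * normal_peak (Num.sqrt t))) * \prod_(k < n) t^-1 ^+ k)
    @[t --> +oo] -->
  (\prod_(i < n) \prod_(j < n | (i < j)%N) (y i ^+ 2 - y j ^+ 2)) *
    \prod_(k < n) (k`!%:R / (2 * k + 1)`!%:R).
Proof.
set L := (X in _ --> X).
have LE al : 0 < al -> \det M * altJ (fun k : 'I_n => gmono al k) = L.
  move=> al0; rewrite altJ_gmono// det_scaled_Vandermonde /L.
  rewrite [X in _ * X]mulrC mulrACA mulrC.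
  congr (_ * _); rewrite -big_split/=; apply: eq_bigr => i _; last by rewrite mulrC.
  rewrite -big_split/=; apply: eq_bigr => j _.
  by rewrite mulrN1 opprB.
have [K HK] := altJ_odd_gauss_expansion.
have inv0 : (fun t : R => t^-1) @ +oo --> (0 : R).
  apply/cvgrPdist_le => e e0; near=> t.
  have t0 : 0 < t by near: t; exact: nbhs_pinfty_gt.
  rewrite sub0r normrN gtr0_norm ?invr_gt0//.
  rewrite invf_ple ?posrE//.
pose E t := \prod_(i < n) expR (- (t^-1 * y i ^+ 2 / 2)).
pose Q t := altJ (fun i => odd_gauss t^-1 (y i)) / \prod_(k < n) t^-1 ^+ k.
have cE : E t @[t --> +oo] --> (1 : R).
  rewrite [X in _ --> X](_ : _ = \prod_(i < n) (1 : R)); last by rewrite big1.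
  apply: cvg_bigprod => i _.
  rewrite [X in _ --> X](_ : _ = expR (- (0 * y i ^+ 2 / 2))); last first.
    by rewrite !mul0r oppr0 expR0.
  apply: continuous_cvg; first exact: continuous_expR.
  by apply: cvgN; do 2!apply: cvgMr_tmp.
have cQ : Q t @[t --> +oo] --> L.
  apply/cvgrPdist_le => e e0.
  have k0 : 0 < e / (`|K| + 1) by rewrite divr_gt0// ltr_pwDr.
  near=> t; have t0 : 0 < t by near: t; exact: nbhs_pinfty_gt.
  have i0 : 0 < t^-1 by rewrite invr_gt0.
  have i1 : t^-1 <= 1 by rewrite invf_le1//; near: t; exact: nbhs_pinfty_ge.
  rewrite distrC -(LE _ i0); apply: le_trans (HK _ i0 i1) _.
  apply: (@le_trans _ _ ((`|K| + 1) * t^-1)).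
    by rewrite ler_pM2r// (le_trans (ler_norm K))// lerDl.
  rewrite mulrC -ler_pdivlMr ?ltr_pwDr// invf_ple ?posrE//.
have cEQ : E t * Q t @[t --> +oo] --> L by rewrite -[L]mul1r; exact: cvgM.
apply: cvg_trans cEQ; apply: near_eq_cvg; near=> t.
have t0 : 0 < t by near: t; exact: nbhs_pinfty_gt.
have i0 : 0 < t^-1 by rewrite invr_gt0.
have i1 : t^-1 <= 1 by rewrite invf_le1//; near: t; exact: nbhs_pinfty_ge.
have s0 : Num.sqrt t != 0 by rewrite gt_eqF// sqrtr_gt0.
have a40 : 0 < t^-1 / 4 by rewrite divr_gt0.
have E1 : altJ (fun i => reflected_pdf (y i) (Num.sqrt t)) =
    (\prod_(i < n) (2 * y i * normal_peak (Num.sqrt t) * expR (- (t^-1 * y i ^+ 2 / 2)))) *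
    altJ (fun i => odd_gauss t^-1 (y i)).
  rewrite -(altJ_scale (b := t^-1 / 4) (C := \sum_i odd_gauss_const 0 (y i)) _ a40).
    congr altJ; apply/funext => i; apply/funext => x; exact: reflected_pdfE.
  move=> i; apply: dominated_le a40 _ (dominated_odd_gauss i0 i1 (y0 i)).
  by rewrite (bigD1 i)//= lerDl sumr_ge0.
rewrite E1 big_split/= /E /Q.
have p0 : \prod_(i < n) (2 * y i * normal_peak (Num.sqrt t)) != 0.
  by apply/prodf_neq0 => i _; rewrite !mulf_neq0// gt_eqF// normal_peak_gt0.
have q0 : \prod_(k < n) t^-1 ^+ k != 0.
  by apply/prodf_neq0 => k _; rewrite expf_neq0// gt_eqF.
move: p0 q0; move: (\prod_(i < n) _) (\prod_(k < n) _) (\prod_(i < n) _) (altJ _).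
by move=> p q e j p0 q0; field; rewrite p0 q0.
Unshelve. all: by end_near. Qed.

End limit.

End reflected_asymptotics.

(** * The Gamma function at half-integers *)

Section euler_integrals.
Context (R : realType).
Local Notation mu := (@lebesgue_measure R).
Local Notation pos := (`]0, +oo[%classic : set R).

Let mpos : measurable (pos : set (measurableTypeR R)).
Proof. exact: measurable_itv. Qed.

Lemma integral_exp_tail (c y : R) : 0 < c ->
  (\int[mu]_(x in `]y, +oo[) (c * expR (- (c * x)))%:E = (expR (- (c * y)))%:E)%E.
Proof.
move=> c0; pose G x := - expR (- (c * x)).
have dG (x : R) : is_derive x 1 G (c * expR (- (c * x))).
  by rewrite /G; apply: is_derive_eq; rewrite /GRing.scale /=; ring.
have cf : continuous (fun x : R => c * expR (- (c * x))).
  move=> x; apply: cvgMl_tmp; apply: continuous_cvg; first exact: continuous_expR.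
  by apply: cvgN; apply: cvgMl_tmp; exact: cvg_id.
rewrite integral_itv_obnd_cbnd; last first.
  by apply/measurable_EFinP/measurable_funTS; exact: continuous_measurable_fun.
rewrite (@ge0_continuous_FTC2y _ _ G _ 0).
- by rewrite /G -EFinB opprK add0r.
- by move=> x _; rewrite mulr_ge0 ?expR_ge0// ltW.
- exact: continuous_subspaceT.
- rewrite -oppr0; apply: cvgN.
  apply: (cvg_comp (fun x => c * x) (fun x => expR (- x))); last exact: cvgr_expR.
  by apply: gt0_cvgMry => //; exact: cvg_id.
- by move=> x _; exact: ex_derive.
- apply: cvg_at_right_filter; apply: differentiable_continuous.
  by apply/derivable1_diffP; exact: ex_derive.
- by move=> x _; rewrite derive1E; exact: derive_val.
Qed.

Definition gpow (p x : R) : R := x `^ p * expR (- x).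

Lemma measurable_gpow p : measurable_fun setT (gpow p).
Proof.
apply: measurable_funM; first exact: measurable_powR.
by apply: measurableT_comp => //; exact: measurable_funN.
Qed.

Lemma gpow_ge0 p x : 0 <= gpow p x.
Proof. by rewrite mulr_ge0 ?powR_ge0 ?expR_ge0. Qed.

Lemma gpow_bound p : 0 <= p -> exists K, forall x, 0 < x ->
  gpow p x <= K * (2^-1 * expR (- (2^-1 * x))).
Proof.
move=> p0; pose n := (Num.truncn p).+1.
exists (2 * (1 + 2 ^+ n * n`!%:R)) => x x0.
have x2 : 0 <= x / 2 by rewrite divr_ge0// ltW.
have E : expR (- x) = expR (- (2^-1 * x)) / expR (x / 2).
  by rewrite -expRN -expRD; congr expR; field.
rewrite /gpow E mulrA ler_pdivrMr ?expR_gt0//.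
rewrite (_ : 2 * _ * _ * _ =
  (1 + 2 ^+ n * n`!%:R) * expR (x / 2) * expR (- (2^-1 * x))); last by field.
rewrite ler_wpM2r ?expR_ge0// mulrDl mul1r.
have x1 : 1 <= expR (x / 2) by have := expR_ge1Dx (x / 2); lra.
have xn : x ^+ n <= 2 ^+ n * n`!%:R * expR (x / 2).
  rewrite -mulrA (_ : x ^+ n = 2 ^+ n * (x / 2) ^+ n).
    by rewrite ler_pM2l ?exprn_gt0// exp_term_le.
  by rewrite -exprMn; congr (_ ^+ _); field.
have xn0 : 0 <= x ^+ n by rewrite exprn_ge0// ltW.
have pn : p <= n%:R by apply: ltW; exact: truncnS_gt.
case: (lerP x 1) => h1.
  apply: (@le_trans _ _ 1); last first.
    by rewrite -[leLHS]addr0 lerD// (le_trans xn0).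
  by rewrite -[leRHS](powRr0 x); apply: ger_powR; rewrite ?x0.
apply: (@le_trans _ _ (x ^+ n)).
  by rewrite -powR_mulrn ?(ltW x0)//; apply: ler_powR => //; exact: ltW.
by rewrite -[leLHS]add0r lerD// expR_ge0.
Qed.

Lemma integrable_gpow p : 0 <= p -> mu.-integrable pos (EFin \o gpow p).
Proof.
move=> p0; have [K HK] := gpow_bound p0.
have h2 : 0 < 2^-1 :> R by rewrite invr_gt0.
have ie : mu.-integrable pos (EFin \o (fun x => 2^-1 * expR (- (2^-1 * x)))).
  have me : measurable_fun setT (fun x : R => 2^-1 * expR (- (2^-1 * x))).
    apply: measurable_funM => //; apply: measurableT_comp => //.
    by apply: measurableT_comp => //; exact: measurable_funM.
  apply/integrableP; split; first by apply/measurable_EFinP/measurable_funTS.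
  apply: (@le_lt_trans _ _ (\int[mu]_(x in pos) (2^-1 * expR (- (2^-1 * x)))%:E)%E).
    rewrite le_eqVlt; apply/orP; left; apply/eqP; apply: eq_integral => x _ /=.
    by rewrite ger0_norm// mulr_ge0 ?expR_ge0.
  by rewrite integral_exp_tail// ltry.
apply: (le_integrable mpos _ _ (integrableZl mpos K ie)).
  by apply/measurable_EFinP/measurable_funTS; exact: measurable_gpow.
move=> x /=; rewrite in_itv/= andbT => x0; rewrite lee_fin.
rewrite ger0_norm ?gpow_ge0//; apply: le_trans (HK x x0) _; exact: ler_norm.
Qed.

Lemma cvg_gpow p : 0 <= p -> gpow p x @[x --> +oo] --> (0 : R).
Proof.
move=> p0; have [K HK] := gpow_bound p0.
have h2 : 0 < 2^-1 :> R by rewrite invr_gt0.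
have ce : K * (2^-1 * expR (- (2^-1 * x))) @[x --> +oo] --> (0 : R).
  rewrite -[X in _ --> X](mulr0 K) -[X in _ --> K * X](mulr0 2^-1).
  do 2!apply: cvgMl_tmp.
  apply: (cvg_comp (fun x => 2^-1 * x) (fun x => expR (- x))); last exact: cvgr_expR.
  by apply: gt0_cvgMry => //; exact: cvg_id.
apply: squeeze_cvgr _ (cvg_cst 0) ce; near=> x.
by rewrite gpow_ge0/= HK.
Unshelve. all: by end_near. Qed.

Lemma powR_cvg_right p : 0 <= p -> x `^ p @[x --> 0^'+] --> (0 : R) `^ p.
Proof.
rewrite le_eqVlt => /orP[/eqP <-|p0].
  by under eq_cvg do rewrite powRr0; rewrite powRr0; exact: cvg_cst.
by rewrite powR0 ?gt_eqF//; exact: powR_cvg0.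
Qed.

(** Integration by parts on the half-line.  The constant C makes the derivative
of - (x^b + C) exp(- x) nonnegative, so that the fundamental theorem of calculus
on the half-line applies; it contributes C to both sides and drops out. *)
Lemma gpow_recurrence b : 1 <= b ->
  \int[mu]_(x in pos) gpow b x = b * \int[mu]_(x in pos) gpow (b - 1) x.
Proof.
move=> b1; have b0 : 0 < b by lra.
have b10 : 0 <= b - 1 by lra.
pose C := b * b `^ (b - 1).
have C0 : 0 <= C by rewrite mulr_ge0 ?powR_ge0// ltW.
pose f (x : R) := (x `^ b + C - b * x `^ (b - 1)) * expR (- x).
pose G (x : R) := - ((x `^ b + C) * expR (- x)).
have dG (x : R) : 0 < x -> is_derive x 1 G (f x).
  move=> x0; have h := is_derive1_powR b x0; rewrite /G /f.
  by apply: is_derive_eq; rewrite /GRing.scale /=; ring.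
have cN (x : R) : expR (- z) @[z --> x] --> expR (- x).
  by apply: continuous_cvg; [exact: continuous_expR|apply: cvgN; exact: cvg_id].
have cNr : expR (- z) @[z --> (0 : R)^'+] --> expR (- (0 : R)).
  by apply: cvg_at_right_filter; exact: cN.
have If : (\int[mu]_(x in pos) (f x)%:E = C%:E)%E.
  rewrite integral_itv_obnd_cbnd; last first.
    apply/measurable_EFinP/measurable_funTS; apply: measurable_funM.
      apply: measurable_funB; last by apply: measurable_funM => //; exact: measurable_powR.
      by apply: measurable_funD; [exact: measurable_powR|exact: measurable_cst].
    by apply: measurableT_comp => //; exact: measurable_funN.
  rewrite (@ge0_continuous_FTC2y _ _ G _ 0).
  - rewrite -EFinB sub0r /G opprK powR0 ?gt_eqF// add0r.
    by rewrite oppr0 expR0 mulr1.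
  - move=> x x0; rewrite mulr_ge0 ?expR_ge0//.
    case: (lerP x b) => xb.
      rewrite -addrA addr_ge0 ?powR_ge0// subr_ge0 /C ler_pM2l//.
      by apply: ge0_ler_powR; rewrite ?nnegrE// ltW.
    have x0' : 0 < x by lra.
    rewrite addrAC addr_ge0// subr_ge0 -(mulr_powRB1 (ltW x0') b0).
    by rewrite ler_wpM2r ?powR_ge0// ltW.
  - apply/continuous_within_itvcyP; split=> [x|]; last first.
      apply: cvgM => //; apply: cvgB; last by apply: cvgMl_tmp; exact: powR_cvg_right.
      by apply: cvgD; [apply: powR_cvg_right; exact: ltW|exact: cvg_cst].
    rewrite in_itv/= andbT => x0.
    have cp p : {for x, continuous (fun z : R => z `^ p)}.
      apply: differentiable_continuous.
      by apply/derivable1_diffP; apply: derivable_powR; rewrite in_itv/= x0.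
    suff : f z @[z --> x] --> f x by [].
    apply: cvgM; last exact: cN.
    apply: cvgB; last by apply: cvgMl_tmp; exact: cp.
    by apply: cvgD; [exact: cp|exact: cvg_cst].
  - suff : G x @[x --> +oo] --> - (0 + C * 0) by rewrite mulr0 addr0 oppr0.
    rewrite /G; under eq_cvg do rewrite mulrDl; apply: cvgN; apply: cvgD.
      by apply: cvg_gpow; exact: ltW.
    by apply: cvgMl_tmp; exact: cvgr_expR.
  - by move=> x x0; have := dG x x0 => ?; exact: ex_derive.
  - apply: cvgN; apply: cvgM => //; apply: cvgD; last exact: cvg_cst.
    by apply: powR_cvg_right; exact: ltW.
  - move=> x; rewrite in_itv/= andbT => x0; have ? := dG x x0.
    by rewrite derive1E; exact: derive_val.
have iE : mu.-integrable pos (EFin \o (fun x => expR (- x))).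
  have := integrable_gpow (lexx 0); apply: eq_integrable => // x _.
  by rewrite /= /gpow powRr0 mul1r.
have eE : \int[mu]_(x in pos) expR (- x) = 1.
  have := @integral_exp_tail 1 0 ltr01; rewrite mulr0 oppr0 expR0 => h.
  rewrite /Rintegral -[RHS]/(fine 1%:E) -h; congr fine.
  by apply: eq_integral => x _; rewrite !mul1r.
have fE x : f x = gpow b x + C * expR (- x) - b * gpow (b - 1) x.
  by rewrite /f /gpow; ring.
have ib := integrable_gpow (ltW b0); have ib1 := integrable_gpow b10.
have iC := integrableZl mpos C iE; have ibb := integrableZl mpos b ib1.
have : \int[mu]_(x in pos) f x = C by rewrite /Rintegral If.
under eq_Rintegral do rewrite fE.
rewrite (@RintegralB _ _ _ mu _ _ (fun x => b * gpow (b - 1) x))//; last first.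
  have := integrableD mpos ib iC.
  by apply: eq_integrable => // x _ /=; rewrite -EFinM -EFinD.
rewrite (@RintegralD _ _ _ mu _ _ (fun x => C * expR (- x)))//.
rewrite !RintegralZl// eE mulr1.
move: (Rintegral _ _ _) (Rintegral _ _ _) => u v h.
by apply/eqP; rewrite -subr_eq0; apply/eqP; lra.
Qed.

Lemma Gamma1 : Gamma (1 : R) = 1.
Proof.
have := @integral_exp_tail 1 0 ltr01; rewrite mulr0 oppr0 expR0 => h.
rewrite /Gamma /Rintegral -[RHS]/(fine 1%:E) -h; congr fine.
by apply: eq_integral => x _; rewrite subrr powRr0 !mul1r.
Qed.

Lemma GammaS (b : R) : 1 <= b -> Gamma (1 + b) = b * Gamma b.
Proof. by move=> b1; rewrite /Gamma (addrC 1) addrK; exact: gpow_recurrence. Qed.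

(** sqrt x is the length of the set of the u > 0 with u^2 < x.  By Tonelli's
theorem the integral of sqrt x exp(- x) becomes that of exp(- u^2). *)
Lemma Gamma_three_halves : Gamma (1 + 2^-1 : R) = Num.sqrt pi / 2.
Proof.
pose f (z : measurableTypeR R * measurableTypeR R) : R :=
  ((0 < z.1) && ((0 < z.2) && (z.2 ^+ 2 < z.1)))%R%:R * expR (- z.1).
have f0 z : 0 <= f z by rewrite mulr_ge0 ?expR_ge0.
have mf : measurable_fun setT (EFin \o f).
  apply/measurable_EFinP; apply: measurable_funM; last first.
    by apply: measurableT_comp => //; apply: measurable_funN; exact: measurable_fst.
  have m1 : measurable_fun setT (fun z : measurableTypeR R * measurableTypeR R => z.1).
    exact: measurable_fst.
  have m2 : measurable_fun setT (fun z : measurableTypeR R * measurableTypeR R => z.2).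
    exact: measurable_snd.
  apply: measurable_fun_natr; apply: measurable_and; first by apply: measurable_fun_ltr => //; exact: measurable_cst.
  apply: measurable_and; first by apply: measurable_fun_ltr => //; exact: measurable_cst.
  by apply: measurable_fun_ltr => //; exact: measurable_funX.
have posE (D : set R) (h : R -> R) (b : R -> bool) : (forall x, b x = (x \in D)) ->
    (\int[mu]_x ((b x)%:R * h x)%:E = \int[mu]_(x in D) (h x)%:E)%E.
  move=> bD; rewrite [RHS]integral_mkcond; apply: eq_integral => x _.
  by rewrite /patch -bD; case: (b x); rewrite ?mul1r ?mul0r.
have left_E x : (\int[mu]_y (EFin \o f) (x, y) =
    ((0 < x)%R%:R * (Num.sqrt x * expR (- x)))%:E)%E.
  rewrite /f /=; case: (ltrP 0 x) => x0; last first.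
    by rewrite integral0_eq ?mul0r// => y _; rewrite /= mul0r.
  rewrite (posE `]0, Num.sqrt x[%classic (fun=> expR (- x)) (fun y => (0 < y) && (y ^+ 2 < x))).
    rewrite integral_cst//= lebesgue_measure_itv/= lte_fin sqrtr_gt0 x0.
    by rewrite oppr0 adde0 mul1r mulrC EFinM.
  move=> y; rewrite mem_setE in_itv/=; case: (ltrP 0 y) => //= y0.
  by rewrite -(ltr_sqrt _ x0) sqrtr_sqr gtr0_norm.
have right_E y : (\int[mu]_x (EFin \o f) (x, y) =
    ((0 < y)%R%:R * expR (- (y ^+ 2)))%:E)%E.
  rewrite /f /=; case: (ltrP 0 y) => y0; last first.
    by rewrite integral0_eq ?mul0r// => x _; rewrite /= andbF mul0r.
  rewrite (posE `]y ^+ 2, +oo[%classic (fun x => expR (- x)) (fun x => (0 < x) && (y ^+ 2 < x))).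
    have := @integral_exp_tail 1 (y ^+ 2) ltr01; rewrite mul1r => h.
    by rewrite mul1r -h; apply: eq_integral => x _; rewrite !mul1r.
  move=> x; rewrite mem_setE in_itv/= andbT; case: (ltrP (y ^+ 2) x) => yx; rewrite ?andbF// andbT.
  by apply: le_lt_trans yx; rewrite sqr_ge0.
have := @fubini_tonelli _ _ _ _ R mu mu (EFin \o f) mf f0.
under eq_integral do rewrite left_E.
under [X in _ = X -> _]eq_integral do rewrite right_E.
rewrite (posE pos (fun x => Num.sqrt x * expR (- x)) (fun x => 0 < x)); last first.
  by move=> x; rewrite mem_setE in_itv/= andbT.
rewrite (posE pos (fun y => expR (- (y ^+ 2))) (fun y => 0 < y)); last first.
  by move=> x; rewrite mem_setE in_itv/= andbT.
rewrite [X in _ = X -> _]integral_itv_obnd_cbnd; last first.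
  by apply/measurable_EFinP/measurable_funTS; exact: measurable_gauss_fun.
rewrite [X in _ = X -> _]integral0y_gauss => h.
rewrite /Gamma /Rintegral -[RHS]/(fine (Num.sqrt pi / 2)%:E) -h; congr fine.
apply: eq_integral => x /set_mem; rewrite /= in_itv/= andbT => x0.
by rewrite (addrC 1) addrK powR12_sqrt// ltW.
Qed.

(** Replacing k by k + 1 exchanges the two factors and multiplies one of them by
(k + 1) / 2. *)
Lemma Gamma_duplication k : (1 <= k)%N ->
  Gamma (1 + k%:R / 2) * Gamma ((1 + k%:R) / 2) =
  Num.sqrt pi * k`!%:R / 2 ^+ k :> R.
Proof.
elim: k => [//|[_ _|k IHk _]].
  rewrite div1r Gamma_three_halves (_ : (1 + 1) / 2 = 1 :> R); last by field.
  by rewrite Gamma1 !mulr1 expr1.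
have -> : (1 + k.+2%:R) / 2 = 1 + k.+1%:R / 2 :> R by rewrite -natr1; field.
have E : k.+2%:R / 2 = (1 + k.+1%:R) / 2 :> R by rewrite -(natr1 k.+1) addrC.
rewrite {1}E GammaS; last first.
  by rewrite ler_pdivlMr// mul1r lerD2l ler1n.
have := IHk isT; set u := Gamma (1 + _); set v := Gamma (_ / 2) => h.
rewrite mulrAC -mulrA h -E [k.+2`!]factS natrM [2 ^+ k.+2]exprS.
by field; rewrite expf_neq0.
Qed.

End euler_integrals.

(** * The constant *)

Section constants.
Context (R : realType).
Implicit Types (n : nat) (t : R).

Lemma prod_shift_rising n m : (\prod_(i < m) (n + i.+1) * n`! = (n + m)`!)%N.
Proof.
elim: m => [|m IHm]; first by rewrite big_ord0 mul1n addn0.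
by rewrite big_ord_recr/= mulnAC IHm addnS factS mulnC.
Qed.

Lemma prod_central n :
  \prod_(i < n) ((n%:R - i%:R) * (n%:R + i%:R + 1)) = (2 * n)`!%:R :> R.
Proof.
rewrite big_split/= mulrC mul2n -addnn -(prod_shift_rising n n) natrM; congr (_ * _).
  by rewrite natr_prod; apply: eq_bigr => i _; rewrite natrD -natr1 addrA.
rewrite fact_prod big_add1 big_mkord natr_prod (reindex_inj rev_ord_inj)/=.
by apply: eq_bigr => i _; rewrite -natrB ?leq_subr// subKn.
Qed.

(** Passing from n to n + 1 multiplies both sides by 4^n (2n + 1)!, because
(2n + 1)^2 - (2i + 1)^2 = 4 (n - i) (n + i + 1). *)
Lemma odd_square_differences n :
  (\prod_(i < n) \prod_(j < n | (i < j)%N)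
     ((2 * j.+1%:R - 1) ^+ 2 - (2 * i.+1%:R - 1) ^+ 2)) *
  \prod_(i < n) (2 * n%:R + 1 - 2 * i.+1%:R) =
  (\prod_(k < n) 2 ^+ k) ^+ 2 * \prod_(k < n) (2 * k + 1)`!%:R :> R.
Proof.
have odd m : \prod_(i < m) (2 * m%:R + 1 - 2 * i.+1%:R) = \prod_(i < m) (2 * i%:R + 1) :> R.
  rewrite (reindex_inj rev_ord_inj); apply: eq_bigr => i _ /=.
  rewrite subnSK// natrB; last exact: ltnW.
  by ring.
rewrite odd; elim: n => [|n IHn]; first by rewrite !big_ord0 expr1n.
rewrite big_ord_recr/= [X in _ * X * _]big1 ?mulr1; last first.
  by move=> j /ltn_geF; rewrite -ltnS ltn_ord.
under eq_bigr => i _.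
  rewrite big_mkcond big_ord_recr/= -big_mkcond/= ltn_ord.
  rewrite (_ : (2 * n.+1%:R - 1) ^+ 2 - (2 * i.+1%:R - 1) ^+ 2 =
    2 ^+ 2 * ((n%:R - i%:R) * (n%:R + i%:R + 1))); last by rewrite -!natr1; ring.
  over.
rewrite big_split/= [X in _ * X * _]big_split/= prod_central prodr_const card_ord !big_ord_recr/=.
have E : (2 * n + 1)`!%:R = (2 * n%:R + 1) * (2 * n)`!%:R :> R.
  by rewrite addn1 factS natrM -natr1 natrM.
by rewrite mulrACA IHn E exprAC; ring.
Qed.

Lemma sqrt_exp_square t n : 0 <= t ->
  Num.sqrt t ^+ (n ^ 2) = Num.sqrt t ^+ n * \prod_(k < n) t ^+ k.
Proof.
move=> t0; elim: n => [|n IHn]; first by rewrite big_ord0 mulr1.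
rewrite big_ord_recr/= (_ : n.+1 ^ 2 = n ^ 2 + 2 * n + 1)%N; last by lia.
by rewrite exprD exprD IHn exprM sqr_sqrtr// expr1 exprS; ring.
Qed.

Lemma powR_half_square (a c : R) n m : 0 <= a -> c = (m * n ^ 2)%:R / 2 ->
  a `^ c = (Num.sqrt a ^+ (n ^ 2)) ^+ m.
Proof.
move=> a0 ->; rewrite mulrC powRrM powR12_sqrt// powR_mulrn ?sqrtr_ge0//.
by rewrite mulnC exprM.
Qed.

Lemma superfactorial n :
  \prod_(k < n) k.+1`!%:R = n`!%:R * \prod_(k < n) k`!%:R :> R.
Proof.
elim: n => [|n IHn]; first by rewrite !big_ord0 mulr1.
by rewrite !big_ord_recr/= IHn; ring.
Qed.

Lemma Gamma_product n :
  \prod_(1 <= k < n.+1) (Gamma (1 + k%:R / 2) * Gamma ((1 + k%:R) / 2)) =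
  Num.sqrt pi ^+ n * (n`!%:R * \prod_(k < n) k`!%:R) /
    (2 ^+ n * \prod_(k < n) 2 ^+ k) :> R.
Proof.
rewrite big_add1 big_mkord -superfactorial.
under eq_bigr do rewrite Gamma_duplication//.
rewrite prodf_div big_split/= prodr_const card_ord; congr (_ / _).
have -> : 2 ^+ n = \prod_(k < n) 2 :> R by rewrite prodr_const card_ord.
by rewrite -big_split/=; apply: eq_bigr => k _; rewrite exprS.
Qed.

(** Writing everything with the square roots of 2, pi and t turns the real
exponents into natural ones. *)
Lemma asymptotic_constant n (y : 'I_n -> R) t : 0 < t ->
  (\prod_(i < n) \prod_(j < n | (i < j)%N)
     ((y i ^+ 2 - y j ^+ 2) / ((2 * j.+1%:R - 1) ^+ 2 - (2 * i.+1%:R - 1) ^+ 2)))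
  * (\prod_(i < n) (y i / (2 * n%:R + 1 - 2 * i.+1%:R)))
  * (2 `^ (3 * n%:R ^+ 2 / 2) / (pi ^+ n * n`!%:R))
  * (\prod_(1 <= k < n.+1) (Gamma (1 + k%:R / 2) * Gamma ((1 + k%:R) / 2)))
  * t `^ (- (n%:R ^+ 2 / 2)) =
  (\prod_(i < n) (2 * y i * normal_peak (Num.sqrt t))) * (\prod_(k < n) t^-1 ^+ k) *
  ((\prod_(i < n) \prod_(j < n | (i < j)%N) (y i ^+ 2 - y j ^+ 2)) *
    \prod_(k < n) (k`!%:R / (2 * k + 1)`!%:R)).
Proof.
move=> t0.
have -> : normal_peak (Num.sqrt t) = (Num.sqrt 2 * Num.sqrt pi * Num.sqrt t)^-1.
  rewrite /normal_peak sqr_sqrtr ?(ltW t0)// -mulr_natl.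
  by rewrite !sqrtrM ?mulr_ge0 ?pi_ge0//; last exact: ltW; rewrite -mulrA (mulrC (Num.sqrt t)) mulrA.
rewrite powRN (@powR_half_square t _ n 1) ?(ltW t0) ?mul1n -?natrX// expr1.
rewrite (@powR_half_square 2 _ n 3)//; last by rewrite natrM natrX.
rewrite Gamma_product !sqrt_exp_square ?(ltW t0)//.
under eq_bigr do rewrite prodf_div.
rewrite !prodf_div.
have -> : \prod_(k < n) t^-1 ^+ k = (\prod_(k < n) t ^+ k)^-1.
  by rewrite -prodfV; apply: eq_bigr => k _; rewrite exprVn.
rewrite big_split/= !prodr_const card_ord !exprMn.
have odd := odd_square_differences n.
have E2 : 2 ^+ n = (Num.sqrt 2 ^+ n) ^+ 2 :> R by rewrite exprAC sqr_sqrtr.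
have Epi : pi ^+ n = (Num.sqrt pi ^+ n) ^+ 2 :> R by rewrite exprAC sqr_sqrtr ?pi_ge0.
have pos_neq0 (J : Type) (r : seq J) (Q : pred J) (F : J -> R) :
    (forall j, 0 < F j) -> \prod_(j <- r | Q j) F j != 0.
  by move=> F0; rewrite gt_eqF// prodr_gt0.
have Z0 : \prod_(k < n) 2 ^+ k != 0 :> R by apply: pos_neq0 => k; rewrite exprn_gt0.
have B0 : \prod_(k < n) (2 * k + 1)`!%:R != 0 :> R.
  by apply: pos_neq0 => k; rewrite ltr0n fact_gt0.
have T0 : \prod_(k < n) t ^+ k != 0 by apply: pos_neq0 => k; rewrite exprn_gt0.
have s0 : Num.sqrt t ^+ n != 0 by rewrite expf_neq0// gt_eqF// sqrtr_gt0.
have a0 : Num.sqrt 2 ^+ n != 0 :> R by rewrite expf_neq0// gt_eqF// sqrtr_gt0.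
have p0 : Num.sqrt pi ^+ n != 0 :> R by rewrite expf_neq0// gt_eqF// sqrtr_gt0 pi_gt0.
have n0 : n`!%:R != 0 :> R by rewrite pnatr_eq0 -lt0n fact_gt0.
rewrite E2 Epi; move: odd Z0 B0 T0 s0 a0 p0 n0.
move: (\prod_(i < n) \prod_(j < n | (i < j)%N) ((2 * _ - 1) ^+ 2 - _)) => A.
move: (\prod_(i < n) (_ - 2 * i.+1%:R)) => A'.
move: (\prod_(k < n) 2 ^+ k) (\prod_(k < n) (2 * k + 1)`!%:R) => Z B.
move: (\prod_(k < n) t ^+ k) (Num.sqrt t ^+ n) => T s.
move: (Num.sqrt 2 ^+ n) (Num.sqrt pi ^+ n) (n`!%:R) => a p f.
move: (\prod_(i < n) \prod_(j < n | _) _) (\prod_(i < n) y i) (\prod_(k < n) k`!%:R) => V Y K.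
move=> odd Z0 B0 T0 s0 a0 p0 f0.
have AA0 : A * A' != 0 by rewrite odd mulf_neq0// expf_neq0.
have [A0 A'0] : A != 0 /\ A' != 0 by move: AA0; rewrite mulf_eq0 negb_or => /andP[].
have -> : A = Z ^+ 2 * B / A' by rewrite -odd mulfK.
by field; rewrite Z0 B0 T0 s0 a0 p0 f0 A'0.
Qed.

End constants.

Theorem mainTheorem6 (R : realType) (d : measure_display)
    (Omega : measurableType d) (P : probability Omega R)
    (n : nat) (hn : (1 <= n)%N) (eta : 'rV[R]_n) (heta : chamberB eta)
    (X : 'I_n -> R -> {RV P >-> R}) (hX : brownian_motion X eta) :
  let T (w : Omega) : \bar R :=
    exit_time (@chamberB R n) (fun t : R => \row_(i < n) X i t w) in
  asymp_equiv
    (fun t : R => fine (P [set w | (t%:E < T w)%E]))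
    (fun t : R =>
      (\prod_(i < n) \prod_(j < n | (i < j)%N)
         ((eta 0 i ^+ 2 - eta 0 j ^+ 2)
            / ((2 * j.+1%:R - 1) ^+ 2 - (2 * i.+1%:R - 1) ^+ 2)))
      * (\prod_(i < n) (eta 0 i / (2 * n%:R + 1 - 2 * i.+1%:R)))
      * (2 `^ (3 * n%:R ^+ 2 / 2) / (pi ^+ n * n`!%:R))
      * (\prod_(1 <= k < n.+1)
           (Gamma (1 + k%:R / 2) * Gamma ((1 + k%:R) / 2)))
      * t `^ (- (n%:R ^+ 2 / 2))).
Proof.
have [eta_dec eta_pos] := heta.
have eta_inj : injective (fun i => eta 0 i).
  move=> i j ij; apply/val_inj; case: (ltngtP i j) => // h.
    by have := eta_dec _ _ h; rewrite ij ltxx.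
  by have := eta_dec _ _ h; rewrite ij ltxx.
have h := altJ_reflected_cvg eta_pos eta_inj.
set L := (X in _ --> X) in h.
have L0 : L != 0.
  rewrite mulf_neq0//; last first.
    by apply/prodf_neq0 => k _; rewrite mulf_neq0 ?invr_eq0// pnatr_eq0 -lt0n fact_gt0.
  apply/prodf_neq0 => i _; apply/prodf_neq0 => j ij; rewrite subr_eq0.
  by rewrite eqrXn2 ?ltW//; apply/eqP => /eta_inj e; move: ij; rewrite e ltnn.
move=> T; rewrite /asymp_equiv.
have {}h := cvgMr_tmp (b := L^-1) h; rewrite mulfV// in h.
apply: cvg_trans (h _); apply: near_eq_cvg; near=> t.
have t0 : 0 < t by near: t; exact: nbhs_pinfty_gt.
rewrite (exit_prob hX heta t0) (eps_law hX t0).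
by rewrite (asymptotic_constant (fun i => eta 0 i) t0) -/L [in RHS]invfM mulrA.
Unshelve. all: by end_near. Qed.
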